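(* Let $\mathbb K$ be an algebraically closed field of characteristic zero, $G$ a reductive algebraic group over $\mathbb K$ with Lie algebra $\mathfrak g$, and $\mathcal H\in\mathfrak g\otimes\mathfrak g$ an $\mathrm{Ad}$-invariant symmetric $2$-tensor, not necessarily non-degenerate. The choice of $\mathcal H$ determines an affine Poisson variety structure on each twisted representation space of the kind $\mathrm{Rep}_X(\Gamma,G)$ (realized as an algebraic quotient) and on each representation space of the kind $\mathrm{Rep}(\pi,G)_{\mathbf C}$ (realized as an algebraic quotient). Explicitly: with the bivector $P_{\ell,n}$ on $G^{2\ell}\times\mathcal C_1\times\dots\times\mathcal C_n$ determined by $\mathcal H$, the bracket $\{f,h\}=\langle P_{\ell,n},df\wedge dh\rangle$ on $G$-invariant regular functions is a Poisson bracket and descends to a Poisson bracket on the affine coordinate ring of $\mathrm{Rep}(\pi,G)_{\mathbf C}$ and (for $n=0$) on that of $\mathrm{Rep}_X(\Gamma,G)$.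
   Context: Representation spaces. Let $\ell,n\ge 0$ with $n\geq 3$ when $\ell=0$ and $\ell\geq 1$ when $n=0$. $\pi=\langle x_1,y_1,\dots,x_\ell,y_\ell,z_1,\dots,z_n;r\rangle$, $r=\prod_j[x_j,y_j]\,z_1\cdots z_n$, is the fundamental group of a compact oriented surface of genus $\ell$ with $n$ boundary circles. $\mathbf C=(\mathcal C_1,\dots,\mathcal C_n)$ are conjugacy classes in $G$; as always in the algebraic setting the manifolds involved are understood to be non-singular affine varieties. The word map $r\colon G^{2\ell}\times\mathcal C_1\times\dots\times\mathcal C_n\to G$ is $G$-equivariant for (simultaneous) conjugation, $\mathrm{Hom}(\pi,G)_{\mathbf C}=r^{-1}(e)$, and $\mathrm{Rep}(\pi,G)_{\mathbf C}$ is its affine algebraic (categorical) $G$-quotient. For $n=0$, let $F$ be free on the $2\ell$ generators, $N$ the normal closure of $r$, $\Gamma=F/[F,N]$; for $z=\exp(X)$ a central element of $G$ (with $X$ in the center of $\mathfrak g$) such that $r^{-1}(z)\ne\emptyset$, $\mathrm{Hom}_X(\Gamma,G)$ is the space of homomorphisms $\Gamma\to G$ sending $[r]$ to $z$, identified with $r^{-1}(z)\subseteq G^{2\ell}$, and $\mathrm{Rep}_X(\Gamma,G)$ is its affine algebraic $G$-quotient; only $z$ matters here. The coordinate ring of the quotient is the algebra of $G$-invariant regular functions on $G^{2\ell}\times\mathcal C_1\times\dots\times\mathcal C_n$ modulo the ideal of those vanishing on $r^{-1}(e)$ (resp. $r^{-1}(z)$). An affine Poisson variety is an affine variety with a Poisson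 bracket on its coordinate ring. The bivector. Write $\mathcal H=\sum\eta^{jk}e_j\otimes e_k$; $X^L(q)=qX$, $X^R(q)=Xq$; superscripts $1,2$ refer to the factor of $G\times G$; $a\wedge b=a\otimes b-b\otimes a$. For a $G$-manifold, $X_M(q)=\frac{d}{dt}|_{t=0}\exp(-tX)q$. (i) Double: on $G\times G$ let $P^\times_{\mathcal H}=\frac12\sum\eta^{jk}(e_j^{1,L}\wedge e_k^{2,R}+e_j^{1,R}\wedge e_k^{2,L})$, with $G\times G$ acting by $(x,y)\cdot(q_1,q_2)=(xq_1y^{-1},yq_2x^{-1})$, and with the map $(q_1,q_2)\mapsto(q_1q_2,q_1^{-1}q_2^{-1})$ to $G\times G$. (ii) Fusion: given a $(G\times G)$-manifold $M$ with invariant bivector $P$ and equivariant map $(\Phi^1,\Phi^2)\colon M\to G\times G$, put $P_{\rm fus}=P-\frac12\sum\eta^{jk}(e_j)^1_M\wedge(e_k)^2_M$, where $X^1_M,X^2_M$ are the fundamental vector fields of the first and second copy of $G$, and $\Phi_{\rm fus}=\Phi^1\Phi^2$, with the diagonal $G$-action. (iii) $(G\times G,P_1,\Phi_1)$ arises from (i) by fusion, so $\Phi_1(q_1,q_2)=[q_1,q_2]$. (iv) Conjugacy class: $P_{\mathcal C}$ is the restriction to $\mathcal C$ of $P_G=\frac12\sum\eta^{jk}e_j^R\wedge e_k^L$ (which is tangent to $\mathcal C$), with the inclusion $\mathcal C\to G$. (v) $(P_{\ell,n},\Phi_{\ell,n})$ on $G^{2\ell}\times\mathcal C_1\times\dots\times\mathcal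 C_n$ arises by successively fusing $\ell$ copies of $(G\times G,P_1,\Phi_1)$ and then $\mathcal C_1,\dots,\mathcal C_n$; $\Phi_{\ell,n}=r$. *)

(* Defs.v *)
From HB Require Import structures.
From mathcomp Require Import all_boot all_order all_algebra.
From mathcomp Require Import mpoly.
From Stdlib Require Import ClassicalEpsilon.

Set Implicit Arguments.
Unset Strict Implicit.
Unset Printing Implicit Defensive.

Import GRing.Theory.
Local Open Scope ring_scope.

(* Varieties are taken in the classical sense: a set [V] of K-points together *)
(* with the algebra of its regular functions, given as a predicate on V -> K. *)

Section Varieties.
Variable K : closedFieldType.

Definition is_affine_variety (V : Type) (reg : (V -> K) -> Prop) : Prop :=
  exists (m : nat) (phi : V -> 'I_m -> K),
  [/\ forall x y, phi x =1 phi y -> x = y,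
      exists I : {mpoly K[m]} -> Prop, forall v : 'I_m -> K,
        (exists x, phi x =1 v) <-> (forall p, I p -> p.@[v] = 0)
    & forall f : V -> K,
        reg f <-> exists p : {mpoly K[m]}, forall x, f x = p.@[phi x]].

(* The coordinate ring of a product is K[V] (x) K[W]. *)
Definition prod_reg (V W : Type) (regV : (V -> K) -> Prop)
    (regW : (W -> K) -> Prop) (f : V * W -> K) : Prop :=
  exists (m : nat) (a : 'I_m -> V -> K) (b : 'I_m -> W -> K),
  [/\ forall i, regV (a i), forall i, regW (b i)
    & forall x y, f (x, y) = \sum_(i < m) a i x * b i y].

Definition zariski_closed (V : Type) (reg : (V -> K) -> Prop)
    (Z : V -> Prop) : Prop :=
  exists I : (V -> K) -> Prop,
    (forall f, I f -> reg f) /\ (forall x, Z x <-> forall f, I f -> f x = 0).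

Definition zariski_connected (V : Type) (reg : (V -> K) -> Prop)
    (Z : V -> Prop) : Prop :=
  forall A B : V -> Prop, zariski_closed reg A -> zariski_closed reg B ->
  (forall x, Z x <-> A x \/ B x) -> (forall x, ~ (A x /\ B x)) ->
  (forall x, ~ A x) \/ (forall x, ~ B x).

Definition is_poisson_algebra (V : Type) (A : (V -> K) -> Prop)
    (br : (V -> K) -> (V -> K) -> V -> K) : Prop :=
  [/\ forall f g, A f -> A g -> A (br f g),
      forall (c : K) f g h, A f -> A g -> A h -> forall x,
        br (fun y => c * f y + g y) h x = c * br f h x + br g h x,
      forall f g, A f -> A g -> forall x, br f g x = - br g f x,
      forall f g h, A f -> A g -> A h -> forall x,
        br (fun y => f y * g y) h x = f x * br g h x + br f h x * g x
    & forall f g h, A f -> A g -> A h -> forall x,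
        br (br f g) h x + br (br g h) f x + br (br h f) g x = 0].

End Varieties.

Record alg_group (K : closedFieldType) := AlgGroup {
  ag_sort :> groupType;
  ag_reg : (ag_sort -> K) -> Prop;
  ag_affine : is_affine_variety ag_reg;
  ag_mul : forall f, ag_reg f ->
    prod_reg ag_reg ag_reg (fun p => f (p.1 * p.2)%g);
  ag_inv : forall f, ag_reg f -> ag_reg (fun x => f (x^-1)%g)
}.

Section Groups.
Variables (K : closedFieldType) (G : alg_group K).
Local Notation reg := (@ag_reg K G).

(* u is unipotent iff right translation by u is locally unipotent on K[G]. *)
Definition unipotent (u : G) : Prop :=
  forall f, reg f -> exists n : nat, forall x,
    iter n (fun (h : G -> K) (y : G) => h (y * u)%g - h y) f x = 0.

Definition normal_subgroup (U : G -> Prop) : Prop :=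
  [/\ U 1%g, forall x y, U x -> U y -> U (x * y)%g, forall x, U x -> U (x^-1)%g
    & forall g x, U x -> U (g * x * g^-1)%g].

(* Trivial unipotent radical; G need not be connected. *)
Definition reductive : Prop :=
  forall U : G -> Prop, normal_subgroup U -> zariski_closed reg U ->
  zariski_connected reg U -> (forall u, U u -> unipotent u) ->
  forall u, U u -> u = 1%g.

Definition conjugacy_class (C : G -> Prop) : Prop :=
  exists c : G, forall x, C x <-> exists g : G, x = (g * c * g^-1)%g.

Definition central (z : G) : Prop := forall g : G, (g * z = z * g)%g.

(* The Lie algebra of G is the space of point derivations of K[G] at the unit. *)
(* Only the values of such a functional on regular functions are meaningful.   *)
Definition lie_element (X : (G -> K) -> K) : Prop :=
  [/\ forall (c : K) f h, reg f -> reg h ->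
        X (fun x => c * f x + h x) = c * X f + X h
    & forall f h, reg f -> reg h ->
        X (fun x => f x * h x) = f 1%g * X h + X f * h 1%g].

Definition lie_basis (d : nat) (e : 'I_d -> (G -> K) -> K) : Prop :=
  [/\ forall j, lie_element (e j),
      forall X, lie_element X -> exists c : 'I_d -> K,
        forall f, reg f -> X f = \sum_j c j * e j f
    & forall c : 'I_d -> K,
        (forall f, reg f -> \sum_j c j * e j f = 0) -> forall j, c j = 0].

Definition Ad (g : G) (X : (G -> K) -> K) : (G -> K) -> K :=
  fun f => X (fun p => f (g * p * g^-1)%g).

(* Invariance of H = \sum eta^{jk} e_j (x) e_k, the tensors over the Lie       *)
(* algebra being compared as bilinear functionals on K[G].                     *)
Definition Ad_invariant (d : nat) (e : 'I_d -> (G -> K) -> K)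
    (eta : 'M[K]_d) : Prop :=
  forall (g : G) f h, reg f -> reg h ->
    \sum_j \sum_k eta j k * (Ad g (e j) f * Ad g (e k) h) =
    \sum_j \sum_k eta j k * (e j f * e k h).

End Groups.

(* Vector fields and bivectors act on functions: a bivector P is the operation *)
(* (f, h) |-> <P, df /\ dh>, with the determinantal normalisation              *)
(* <a /\ b, df /\ dh> = a(f) b(h) - b(f) a(h).                                 *)
Definition vfield (K : closedFieldType) (V : Type) := (V -> K) -> V -> K.
Definition bivector (K : closedFieldType) (V : Type) :=
  (V -> K) -> (V -> K) -> V -> K.

Definition wedge (K : closedFieldType) (V : Type) (a b : vfield K V) :
    bivector K V :=
  fun f h x => a f x * b h x - b f x * a h x.

Section Fields.
Variables (K : closedFieldType) (G : alg_group K).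

(* The derivative of f at the point x along t |-> c (exp (t X)) x. *)
Definition along (V : Type) (c : G -> V -> V) (X : (G -> K) -> K) :
    vfield K V :=
  fun f x => X (fun p => f (c p x)).

Variables (d : nat) (e : 'I_d -> (G -> K) -> K) (eta : 'M[K]_d).

(* (1/2) \sum eta^{jk} W (e_j, e_k) *)
Definition half_sum (V : Type)
    (W : ((G -> K) -> K) -> ((G -> K) -> K) -> bivector K V) : bivector K V :=
  fun f h x => 2%:R^-1 * \sum_j \sum_k eta j k * W (e j) (e k) f h x.

End Fields.

(* A G-space with a bivector and a G-valued momentum mapping (data only). *)
Record gspace (K : closedFieldType) (G : alg_group K) := GSpace {
  gs_car : Type;
  gs_reg : (gs_car -> K) -> Prop;
  gs_act : G -> gs_car -> gs_car;
  gs_mom : gs_car -> G;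
  gs_biv : bivector K gs_car
}.

(* The same for the group G x G. *)
Record ggspace (K : closedFieldType) (G : alg_group K) := GGSpace {
  gg_car : Type;
  gg_reg : (gg_car -> K) -> Prop;
  gg_act : G -> G -> gg_car -> gg_car;
  gg_mom1 : gg_car -> G;
  gg_mom2 : gg_car -> G;
  gg_biv : bivector K gg_car
}.

Section Spaces.
Variables (K : closedFieldType) (G : alg_group K).
Variables (d : nat) (e : 'I_d -> (G -> K) -> K) (eta : 'M[K]_d).
Local Notation reg := (@ag_reg K G).
Local Notation gspace := (gspace G).
Local Notation ggspace := (ggspace G).

Definition double : ggspace :=
  let L1 := along (fun (p : G) (q : G * G) => ((q.1 * p)%g, q.2)) in
  let R1 := along (fun (p : G) (q : G * G) => ((p * q.1)%g, q.2)) in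
  let L2 := along (fun (p : G) (q : G * G) => (q.1, (q.2 * p)%g)) in
  let R2 := along (fun (p : G) (q : G * G) => (q.1, (p * q.2)%g)) in
  {| gg_car := (G * G)%type;
     gg_reg := prod_reg reg reg;
     gg_act := fun x y q => ((x * q.1 * y^-1)%g, (y * q.2 * x^-1)%g);
     gg_mom1 := fun q => (q.1 * q.2)%g;
     gg_mom2 := fun q => (q.1^-1 * q.2^-1)%g;
     gg_biv := half_sum e eta (fun X Y f h q =>
       wedge (L1 X) (R2 Y) f h q + wedge (R1 X) (L2 Y) f h q) |}.

Definition fuse (M : ggspace) : gspace :=
  (* fundamental vector fields X_M(q) = d/dt exp(-tX)q of the two factors *)
  let F1 := along (fun (p : G) => @gg_act K G M (p^-1)%g 1%g) in
  let F2 := along (fun (p : G) => @gg_act K G M 1%g (p^-1)%g) in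
  {| gs_car := gg_car M;
     gs_reg := @gg_reg K G M;
     gs_act := fun g => @gg_act K G M g g;
     gs_mom := fun q => (gg_mom1 q * gg_mom2 q)%g;
     gs_biv := fun f h q => @gg_biv K G M f h q -
       half_sum e eta (fun X Y => wedge (F1 X) (F2 Y)) f h q |}.

Definition gprod (M N : gspace) : ggspace :=
  {| gg_car := (gs_car M * gs_car N)%type;
     gg_reg := prod_reg (@gs_reg K G M) (@gs_reg K G N);
     gg_act := fun x y q => (gs_act x q.1, gs_act y q.2);
     gg_mom1 := fun q => gs_mom q.1;
     gg_mom2 := fun q => gs_mom q.2;
     gg_biv := fun f h q =>
       @gs_biv K G M (fun x => f (x, q.2)) (fun x => h (x, q.2)) q.1 +
       @gs_biv K G N (fun y => f (q.1, y)) (fun y => h (q.1, y)) q.2 |}.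

Definition fusion (M N : gspace) : gspace := fuse (gprod M N).

(* Neutral for fusion, up to the canonical identification pt x M = M. *)
Definition point : gspace :=
  {| gs_car := unit;
     gs_reg := fun _ => True;
     gs_act := fun _ x => x;
     gs_mom := fun _ => 1%g;
     gs_biv := fun _ _ _ => 0 |}.

Definition fused_double : gspace := fuse double.

Definition biv_group : bivector K G :=
  half_sum e eta (fun X Y =>
    wedge (along (fun p q : G => (p * q)%g) X)
          (along (fun p q : G => (q * p)%g) Y)).

Definition restricts_to (C : G -> Prop) (f : {x : G | C x} -> K)
    (F : G -> K) : Prop :=
  reg F /\ forall x, F (sval x) = f x.

(* Some regular extension to G of a regular function on C. As P_G is tangent   *)
(* to conjugacy classes, [biv_class] does not depend on the extension.         *)
Definition extend (C : G -> Prop) (f : {x : G | C x} -> K) : G -> K :=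
  epsilon (inhabits (fun _ => 0)) (restricts_to f).

Definition biv_class (C : G -> Prop) : bivector K {x : G | C x} :=
  fun f h x => biv_group (extend f) (extend h) (sval x).

Lemma conj_class_closed (C : G -> Prop) (CC : conjugacy_class C)
  (g x : G) : C x -> C (g * x * g^-1)%g.
Proof.
case: CC => c CE /CE [k ->]; apply/CE; exists (g * k)%g.
by rewrite invgM !mulgA.
Qed.

Definition class_space (C : G -> Prop) (CC : conjugacy_class C) : gspace :=
  {| gs_car := {x : G | C x};
     gs_reg := fun f => exists F, restricts_to f F;
     gs_act := fun g x =>
       exist C (g * sval x * g^-1)%g (conj_class_closed CC g (svalP x));
     gs_mom := fun x => sval x;
     gs_biv := @biv_class C |}.

(* G^(2l), as (..((pt x G^2) x G^2)..) x G^2 *)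
Definition surface (l : nat) : gspace :=
  iter l (fun M => fusion M fused_double) point.

(* G^(2l) x C_1 x .. x C_n, as (..(G^(2l) x C_1)..) x C_n *)
Definition surface_with_classes (l n : nat) (C : 'I_n -> G -> Prop)
    (CC : forall i, conjugacy_class (C i)) : gspace :=
  foldl (fun M i => fusion M (class_space (CC i))) (surface l) (enum 'I_n).

(* The momentum mapping is the word map \prod_j [x_j, y_j] z_1 .. z_n, with    *)
(* [x, y] = x y x^-1 y^-1.                                                     *)
Lemma mom_fusion (M N : gspace) (q : gs_car (fusion M N)) :
  gs_mom q = (gs_mom q.1 * gs_mom q.2)%g.
Proof. by []. Qed.

Lemma mom_fused_double (q : gs_car fused_double) :
  gs_mom q = (q.1 * q.2 * q.1^-1 * q.2^-1)%g.
Proof. by rewrite /= !mulgA. Qed.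

End Spaces.

Section Quotients.
Variables (K : closedFieldType) (G : alg_group K) (M : gspace G) (z : G).

Definition invariant_regular (f : gs_car M -> K) : Prop :=
  gs_reg f /\ forall (g : G) x, f (gs_act g x) = f x.

Definition fibre := {q : gs_car M | gs_mom q = z}.

(* Invariant regular functions modulo those vanishing on the fibre, i.e. the   *)
(* restrictions to the fibre of the invariant regular functions.               *)
Definition rep_coord (u : fibre -> K) : Prop :=
  exists f, invariant_regular f /\ forall q, u q = f (sval q).

(* Y with the functions O and the projection p is a model of the quotient:     *)
(* p^* is an isomorphism of O onto [rep_coord].                                *)
Definition realizes_quotient (Y : Type) (O : (Y -> K) -> Prop)
    (p : fibre -> Y) : Prop :=
  [/\ forall u, O u -> rep_coord (fun q => u (p q)),
      forall w, rep_coord w -> exists2 u, O u & forall q, w q = u (p q)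
    & forall u v, O u -> O v ->
        (forall q, u (p q) = v (p q)) -> forall y, u y = v y].

Definition bracket_descends (Y : Type) (O : (Y -> K) -> Prop)
    (p : fibre -> Y) : Prop :=
  exists br : (Y -> K) -> (Y -> K) -> Y -> K,
    is_poisson_algebra O br /\
    forall u v f h, O u -> O v -> invariant_regular f -> invariant_regular h ->
      (forall q, u (p q) = f (sval q)) -> (forall q, v (p q) = h (sval q)) ->
      forall q, br u v (p q) = gs_biv f h (sval q).

Definition determines_affine_poisson_structure : Prop :=
  [/\ is_poisson_algebra invariant_regular (@gs_biv K G M),
      bracket_descends rep_coord id
    & forall (Y : Type) (O : (Y -> K) -> Prop) (p : fibre -> Y),
        is_affine_variety O -> realizes_quotient O p -> bracket_descends O p].

End Quotients.

(* Main.v *)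
Require Import Defs.
From HB Require Import structures.
From mathcomp Require Import all_boot all_order all_algebra.
From mathcomp Require Import mpoly ring.
From Stdlib Require Import Classical ClassicalEpsilon FunctionalExtensionality.

Import GRing.Theory.
Local Open Scope ring_scope.

Set Implicit Arguments.
Unset Strict Implicit.
Unset Printing Implicit Defensive.

(** The bracket is not Poisson on all functions, but both its failure of the
    Jacobi identity and its pairing with functions of the momentum mapping are
    controlled by the infinitesimal action of G, hence disappear on invariants.

    For regular functions u, v on G put <u, v> = sum eta^{jk} e_j(u) e_k(v)
    ([pairing]), let phi = sum eta^{jk} eta^{lm} [e_j, e_l] (x) e_k (x) e_m be the
    Cartan 3-tensor ([cartan]), and for a function f on a G-space write f_x for
    the function p |-> f(p^-1 x) on G ([orbital]).  A G-space with an invariant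
    bracket and an equivariant momentum mapping Phi is called [hamiltonian] when
      {{f,g},h}(x) + cyclic = - 1/4 phi (f_x, g_x, h_x),
      {f, u o Phi}(x) = - 1/2 (<f_x, u(Phi(x) p)> + <f_x, u(p Phi(x))>),
    where p is the variable of the pairing.  If f is invariant then f_x is
    constant and killed by every e_j.  So invariants satisfy the Jacobi identity
    and Poisson commute with every u o Phi.

    Both identities survive fusion ([fuse_hamiltonian]).  The fusion term is
    invariant only under the diagonal group, and its own Jacobi expression is
    exactly what turns phi_1 + phi_2 into the phi of the diagonal action; this
    uses that phi is totally antisymmetric, which follows from the infinitesimal
    form of the Ad-invariance of eta ([pairing_lie]).  All the spaces come by fusion from
    copies of G with zero bracket, on which G acts by left and by right
    translations: phi_left + phi_right = 0 there ([cartan_edge]).  Fusing the two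
    ends of one copy gives P_G, which restricts to the conjugacy classes
    ([class_hamiltonian]); fusing the ends of two copies crosswise gives the
    double ([double_hamiltonian2]).

    The bracket descends to a fibre of Phi if, for h invariant, the derivation
    D = {h, -} preserves the functions vanishing on the fibre.  It kills the
    equations u o Phi = u(z) of the fibre, but these need not generate a radical
    ideal.  Fix x in the fibre and consider the functions all of whose iterated
    derivatives D^n vanish at x: the kernel of the Taylor expansion at x along
    the formal flow of D.  In characteristic 0 it is a prime ideal ([flat_prime])
    and it contains the equations.  If Df did not vanish at x, then f would lie
    outside that prime ideal, and the Nullstellensatz for prime ideals
    ([prime_nullstellensatz]) would give a point of the fibre where f does not
    vanish. *)

(** * The Nullstellensatz for prime ideals *)

(** The whole ring satisfies these conditions too; it is ruled out wherever some
    element is assumed to lie outside P. *)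
Record prime_ideal (R : comNzRingType) (P : R -> Prop) : Prop := PrimeIdeal {
  pideal0 : P 0;
  pidealD : forall a b, P a -> P b -> P (a + b);
  pidealM : forall a b, P b -> P (a * b);
  pideal_prime : forall a b, P (a * b) -> P a \/ P b
}.

(** The Nullstellensatz for [P], in a form that passes from a ring to polynomials
    over it: [ev] is a family of points of the spectrum of [R]. *)
Definition enough_points (K R : nzRingType) (T : Type)
    (ev : T -> {rmorphism R -> K}) (P : R -> Prop) : Prop :=
  forall g, ~ P g -> exists t, (forall p, P p -> ev t p = 0) /\ ev t g <> 0.

Section PrimeIdealTheory.
Variables (R : comNzRingType) (P : R -> Prop).
Hypothesis PP : prime_ideal P.

Lemma pidealN a : P a -> P (- a).
Proof. by rewrite -mulN1r => /(pidealM PP). Qed.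

Lemma pidealB a b : P a -> P b -> P (a - b).
Proof. by move=> Pa /pidealN; apply: pidealD. Qed.

Lemma pideal_sum (I : Type) (r : seq I) (F : I -> R) :
  (forall i, P (F i)) -> P (\sum_(i <- r) F i).
Proof.
move=> PF; elim/big_ind: _ => //; [exact: pideal0 | exact: pidealD].
Qed.

Lemma pideal_exp a k : ~ P 1 -> P (a ^+ k) -> P a.
Proof.
move=> P1; elim: k => [|k IH]; first by rewrite expr0.
by rewrite exprS => /(pideal_prime PP) [|/IH].
Qed.

End PrimeIdealTheory.

Lemma ex_min_size (R : nzRingType) (Q : {poly R} -> Prop) (p0 : {poly R}) :
  Q p0 -> exists2 p, Q p & forall q, Q q -> (size p <= size q)%N.
Proof.
move: {2}(size p0).+1 (ltnSn (size p0)) => n.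
elim: n p0 => // n IH p lep Qp.
have [[q Qq ltqp]|noq] := classic (exists2 q, Q q & (size q < size p)%N).
  by apply: (IH q) => //; apply: leq_trans ltqp _.
exists p => // q Qq; rewrite leqNgt; apply/negP => ltqp; case: noq.
by exists q.
Qed.

(** Adding a variable X to a ring R that has enough points.  Let P be a prime
    ideal of R[X] with contraction P'.  If P is generated by P', the fibre over a
    zero of P' is a whole line.  Otherwise, over a dense open set of zeros of P',
    it is the root set of an element of P of least degree modulo P'. *)
Section OneMoreVariable.
Variables (K : closedFieldType) (R : idomainType) (T : Type).
Variables (ev : T -> {rmorphism R -> K}) (P : {poly R} -> Prop).
Hypothesis PP : prime_ideal P.

Let P' (r : R) : Prop := P r%:P.

Lemma contraction_prime : prime_ideal P'.
Proof.
split; rewrite /P'.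
- by rewrite polyC0; apply: pideal0.
- by move=> a b Pa Pb; rewrite polyCD; apply: pidealD.
- by move=> a b Pb; rewrite polyCM; apply: pidealM.
- by move=> a b; rewrite polyCM => /(pideal_prime PP).
Qed.

Let Pc (f : {poly R}) : Prop := forall i, P' f`_i.

Lemma coefs_in_prime f : Pc f -> P f.
Proof.
move=> Pf; rewrite -[f]coefK poly_def; apply: (pideal_sum PP) => i.
by rewrite -mul_polyC mulrC; apply: pidealM => //; apply: Pf.
Qed.

(** Removing the leading terms with coefficient in P' does not change the class
    modulo P'[X]; the lemma stands in for division in (R/P')[X], without having
    to form the quotient. *)
Lemma strip_leading f : ~ Pc f ->
  exists f' : {poly R}, [/\ Pc (f - f'), (size f' <= size f)%N & ~ P' (lead_coef f')].
Proof.
move: {2}(size f).+1 (ltnSn (size f)) => n; elim: n f => // n IH f lef nf.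
have [Pl|nPl] := classic (P' (lead_coef f)); last first.
  by exists f; split=> // i; rewrite subrr coef0; apply: pideal0 contraction_prime.
have f0 : f != 0.
  apply/eqP=> f0; apply: nf => i; rewrite f0 coef0.
  exact: pideal0 contraction_prime.
pose t : {poly R} := lead_coef f *: 'X^((size f).-1).
have Pt : Pc t.
  move=> i; rewrite coefZ mulrC; exact: pidealM contraction_prime _ _ Pl.
have ltf : (size (f - t)%R < size f)%N.
  have sf : (0 < size f)%N by rewrite size_poly_gt0.
  rewrite -(prednK sf) ltnS; apply/leq_sizeP => j.
  rewrite leq_eqVlt coefB coefZ coefXn => /orP[/eqP <-|ltj].
    by rewrite eqxx mulr1 subrr.
  rewrite [_ == _]gtn_eqF // mulr0 subr0; apply: nth_default.
  by rewrite -(prednK sf).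
have [||f' [Pf' sf' lf']] := IH (f - t).
- exact: leq_trans ltf _.
- move=> Pft; apply: nf => i; rewrite -[f](subrK t) coefD.
  exact: pidealD contraction_prime _ _ (Pft i) (Pt i).
- exists f'; split=> //; last exact: leq_trans sf' (ltnW ltf).
  move=> i; have -> : f - f' = (f - t - f') + t by rewrite addrAC subrK.
  by rewrite coefD; apply: pidealD contraction_prime _ _ _ _.
Qed.

Let evX (tx : T * K) (p : {poly R}) : K := (map_poly (ev tx.1) p).[tx.2].

Lemma evX_D tx p q : evX tx (p + q) = evX tx p + evX tx q.
Proof. by rewrite /evX rmorphD hornerD. Qed.

Lemma evX_M tx p q : evX tx (p * q) = evX tx p * evX tx q.
Proof. by rewrite /evX rmorphM hornerM. Qed.

Lemma evX_C tx c : evX tx c%:P = ev tx.1 c.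
Proof. by rewrite /evX map_polyC hornerC. Qed.

Lemma evX_coefs tx (p : {poly R}) : (forall i, ev tx.1 p`_i = 0) -> evX tx p = 0.
Proof.
move=> p0; rewrite /evX [map_poly _ _](_ : _ = 0) ?horner0 //.
by apply/polyP=> i; rewrite coef_map coef0 /= p0.
Qed.

Hypothesis evP' : enough_points ev P'.

Lemma points_over_constants g : (forall p, P p -> Pc p) -> ~ P g ->
  exists tx, (forall p, P p -> evX tx p = 0) /\ evX tx g <> 0.
Proof.
move=> PPc nPg.
have [i ngi] : exists i, ~ P' g`_i.
  apply: not_all_ex_not => Pg; apply: nPg; exact: coefs_in_prime.
have [t [evt0 evtg]] := evP' ngi.
have : map_poly (ev t) g != 0.
  by apply/eqP => /polyP/(_ i); rewrite coef_map coef0.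
case/closed_nonrootP => x /negP gx; exists (t, x); split=> [p /PPc Pp|g0].
  by apply: evX_coefs => i'; apply: evt0.
by apply: gx; apply/eqP.
Qed.

(** Over the fraction field of R/P' the ideal P is generated by one irreducible
    polynomial f, so f and g have a Bezout relation b = s g + q with b outside P'
    and q in P.  Both are obtained here by minimising degrees; over a point where
    neither b nor the leading coefficient of f vanishes, every root of f is a zero
    of P at which g does not vanish. *)
Lemma points_over_curve f0 g : P f0 -> ~ Pc f0 -> ~ P g ->
  exists tx, (forall p, P p -> evX tx p = 0) /\ evX tx g <> 0.
Proof.
have P'P := contraction_prime.
move=> Pf0 nPcf0 nPg.
have nP1 : ~ P 1 by move=> P1; apply: nPg; rewrite -[g]mulr1; apply: pidealM.
have nP'X a k : ~ P' a -> ~ P' (a ^+ k).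
  move=> nPa Pak; apply: nPa; apply: (pideal_exp P'P) Pak.
  by rewrite /P' polyC1.
have strip u : ~ Pc u -> exists u' : {poly R}, [/\ P (u - u'), (size u' <= size u)%N &
    ~ P' (lead_coef u')].
  by case/strip_leading => u' [/coefs_in_prime ? ? ?]; exists u'.
have [{nPcf0} f1 [Pf1 _ lf1]] := strip _ nPcf0.
have [] :=
    @ex_min_size _ (fun u => P u /\ ~ P' (lead_coef u)) f1.
  split=> //; rewrite (_ : f1 = f0 - (f0 - f1)); last by rewrite opprB addrC subrK.
  exact: pidealB.
move=> f [Pf nPlf] minf {f0 f1 Pf0 Pf1 lf1}.
set c := lead_coef f in nPlf.
(* By minimality, elements of P of smaller degree lie in P'[X]. *)
have small h : P h -> (size h < size f)%N -> Pc h.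
  move=> Ph lth; apply: NNPP => /strip [h' [Phh' leh nPlh]].
  have /minf : P h' /\ ~ P' (lead_coef h').
    split=> //; rewrite (_ : h' = h - (h - h')); last by rewrite opprB addrC subrK.
    exact: pidealB.
  by move/(leq_trans)/(_ leh); rewrite leqNgt lth.
have f0 : f != 0.
  apply/eqP => f0; apply: nPlf; rewrite /c f0 lead_coef0; exact: pideal0 P'P.
have [g1 [[s [q [Pq Dg1]]] nPg1 nPlg1] ming1] :
    exists2 u, [/\ exists s q, P q /\ u = s * g + q, ~ P u & ~ P' (lead_coef u)] &
    forall v, [/\ exists s q, P q /\ v = s * g + q, ~ P v & ~ P' (lead_coef v)] ->
      (size u <= size v)%N.
  have [|u [Pgu _ nPlu]] := @strip g.
    by move=> /coefs_in_prime.
  apply: (@ex_min_size _ _ u); split=> //.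
    exists 1, (u - g); split; last by ring.
    by rewrite -opprB; apply: pidealN.
  by move=> Pu; apply: nPg; rewrite -[g](subrK u); apply: pidealD.
(* Likewise elements of P + (g) of degree smaller than g1 lie in P. *)
have smallg r s' q' : P q' -> r = s' * g + q' -> (size r < size g1)%N -> P r.
  move=> Pq' Dr ltr; apply: NNPP => nPr.
  have [|r' [Prr' ler nPlr]] := strip r; first by move/coefs_in_prime.
  have /ming1 : [/\ exists s q, P q /\ r' = s * g + q, ~ P r' & ~ P' (lead_coef r')].
    split=> //; last by move=> Pr'; apply: nPr; rewrite -[r](subrK r'); apply: pidealD.
    exists s', (q' - (r - r')); split; first exact: pidealB.
    by rewrite Dr; ring.
  by move/(leq_trans)/(_ ler); rewrite leqNgt ltr.
have g10 : g1 != 0.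
  apply/eqP => g10; apply: nPg1; rewrite g10; exact: pideal0 PP.
have ltg1 : (size g1 < size f)%N.
  pose k := Pdiv.Ring.rscalp g1 f.
  have E := Pdiv.ComRing.rdivp_eq f g1.
  rewrite leqNgt; apply/negP => lef; rewrite ltnS in lef.
  have ltr : (size (Pdiv.Ring.rmodp g1 f) < size g1)%N.
    by apply: leq_trans lef; rewrite Pdiv.Ring.ltn_rmodp.
  have Er : Pdiv.Ring.rmodp g1 f =
     ((c ^+ k)%:P * s) * g + ((c ^+ k)%:P * q - Pdiv.Ring.rdivp g1 f * f).
    rewrite addrA -mulrA -mulrDr -Dg1 mul_polyC E.
    by rewrite addrAC subrr add0r.
  have Pr := smallg _ _ _ _ Er ltr.
  have /Pr {}Pr : P ((c ^+ k)%:P * q - Pdiv.Ring.rdivp g1 f * f).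
    by apply: pidealB => //; apply: pidealM.
  have : P ((c ^+ k)%:P * g1).
    by rewrite mul_polyC E; apply: pidealD => //; apply: pidealM.
  by case/(pideal_prime PP) => // /(nP'X _ _ nPlf).
set b := lead_coef g1 in nPlg1.
(* If g1 had positive degree, the quotient of f by g1 would be an element of P
   of degree smaller than f, hence in P'[X]; so would then be the product of f
   with an element outside P'. *)
have g1C : (size g1 <= 1)%N.
  pose k := Pdiv.Ring.rscalp f g1; pose Q := Pdiv.Ring.rdivp f g1.
  pose r := Pdiv.Ring.rmodp f g1.
  have E : b ^+ k *: f = Q * g1 + r := Pdiv.ComRing.rdivp_eq g1 f.
  rewrite leqNgt; apply/negP => lt1.
  have ltr : (size r < size g1)%N by rewrite Pdiv.Ring.ltn_rmodp.
  have Pr : P r.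
    apply: (smallg r (- (Q * s)) ((b ^+ k)%:P * f - Q * q)) => //.
      by apply: pidealB => //; apply: pidealM.
    by rewrite mul_polyC E Dg1; ring.
  have Pcr : Pc r by apply: small => //; apply: ltn_trans ltr _.
  have PQ : P Q.
    have : P (Q * g1).
      rewrite -[_ * g1](addrK r) -E; apply: pidealB => //.
      by rewrite -mul_polyC; apply: pidealM.
    by case/(pideal_prime PP).
  have bk0 : b ^+ k != 0.
    by apply/eqP => bk0; apply: (nP'X _ k nPlg1); rewrite bk0; apply: pideal0 P'P.
  have PcQ : Pc Q.
    apply: small => //.
    have [->|Q0] := eqVneq Q 0; first by rewrite size_poly0 size_poly_gt0.
    have : (size (Q * g1)%R <= size f)%N.
      rewrite -[_ * g1](addrK r) -E (leq_trans (size_polyD _ _)) //.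
      by rewrite size_polyN geq_max size_scale // leqnn (ltnW (ltn_trans ltr ltg1)).
    rewrite size_mul //; case: (size g1) lt1 => [|[|m]] // _.
    by rewrite !addnS /=; apply: leq_trans; rewrite ltnS leq_addr.
  have PcE : Pc (b ^+ k *: f).
    move=> i; rewrite E coefD coefM; apply: (pidealD P'P); last exact: Pcr.
    apply: (pideal_sum P'P) => j; rewrite mulrC; exact: (pidealM P'P).
  have := PcE (size f).-1; rewrite coefZ /P' polyCM => /(pideal_prime PP) [].
    exact: nP'X.
  exact: nPlf.
have {g1C} g1E : g1 = b%:P.
  have /size_poly1P[a _ Da] : size g1 == 1%N by rewrite eqn_leq g1C size_poly_gt0.
  by rewrite /b Da lead_coefC.
have nPbc : ~ P' (b * c) by move=> /(pideal_prime P'P) [].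
have [t [evt0 evtbc]] := evP' nPbc.
have [evb evc] : ev t b != 0 /\ ev t c != 0.
  by apply/andP; rewrite -negb_or -mulf_eq0 -rmorphM; apply/eqP.
have szf : size (map_poly (ev t) f) = size f by rewrite size_map_poly_id0.
have : size (map_poly (ev t) f) != 1%N.
  apply/negP; rewrite szf => /size_poly1P [a a0 fE].
  by apply: nPlf; rewrite /P' /c fE lead_coefC -fE.
case/closed_rootP => x /eqP fx.
have ev0 p : P p -> evX (t, x) p = 0.
  move=> Pp; have E := Pdiv.ComRing.rdivp_eq f p.
  set k := Pdiv.Ring.rscalp p f in E; set Q := Pdiv.Ring.rdivp p f in E.
  set r := Pdiv.Ring.rmodp p f in E.
  have Pcr : Pc r.
    apply: small; last by rewrite Pdiv.Ring.ltn_rmodp.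
    have -> : r = (c ^+ k)%:P * p - Q * f.
      by rewrite mul_polyC E addrAC subrr add0r.
    by apply: pidealB => //; apply: pidealM.
  have /(congr1 (evX (t, x))) := E.
  rewrite -mul_polyC evX_M evX_C evX_D evX_M (fx : evX (t, x) f = 0) mulr0 add0r.
  rewrite [evX _ r]evX_coefs; last by move=> i; apply: evt0; apply: Pcr.
  by move/eqP; rewrite mulf_eq0 rmorphXn expf_eq0 (negPf evc) andbF => /eqP.
exists (t, x); split=> // g0.
have /(congr1 (evX (t, x))) := Dg1.
rewrite g1E evX_C evX_D evX_M g0 (ev0 q Pq) mulr0 addr0 /= => b0.
by rewrite b0 eqxx in evb.
Qed.

Lemma enough_points_poly g : ~ P g ->
  exists tx, (forall p, P p -> evX tx p = 0) /\ evX tx g <> 0.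
Proof.
move=> nPg; have [[f [Pf nPcf]]|noneP] := classic (exists f, P f /\ ~ Pc f).
  exact: points_over_curve Pf nPcf nPg.
apply: points_over_constants nPg => p Pp; apply: NNPP => nPcp.
by apply: noneP; exists p.
Qed.

End OneMoreVariable.

Lemma mpoly_alg_ind (n : nat) (R : comNzRingType) (Q : {mpoly R[n]} -> Prop) :
  (forall c, Q c%:MP) -> (forall i, Q 'X_i) ->
  (forall p q, Q p -> Q q -> Q (p + q)) ->
  (forall p q, Q p -> Q q -> Q (p * q)) -> forall p, Q p.
Proof.
move=> QC QX QD QM; elim/mpolyind => [|c m p _ _ Qp]; first by rewrite -mpolyC0.
apply: (QD) => //; rewrite -mul_mpolyC; apply: (QM) => //.
rewrite mpolyXE_id; elim/big_ind: _ => [|p1 p2|i _]; [by rewrite -mpolyC1 | exact: QM|].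
by elim: (m i) => [|k IH]; rewrite ?expr0 -?mpolyC1 // exprS; apply: QM.
Qed.

Section Nullstellensatz.
Variable K : closedFieldType.

Local Notation widen := (widen_ord (leqnSn _)).

Let join n (w : 'I_n -> K) (x : K) (i : 'I_n.+1) : K :=
  if unlift ord_max i is Some j then w j else x.

Let join_max n (w : 'I_n -> K) x : join w x ord_max = x.
Proof. by rewrite /join unlift_none. Qed.

Let join_widen n (w : 'I_n -> K) x i : join w x (widen i) = w i.
Proof.
rewrite /join (_ : widen i = lift ord_max i) ?liftK //.
by apply: val_inj; apply: esym (lift_max i).
Qed.

Let muni_X n (i : 'I_n) : muni 'X_(widen i) = ('X_i)%:P :> {poly {mpoly K[n]}}.
Proof.
rewrite /muni mmapX mmap1U; case: splitP => [j eqj|j].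
  by congr ('X__)%:P; apply: val_inj; rewrite /= -eqj.
by rewrite ord1 /= addn0 => ni; have := ltn_ord i; rewrite ni ltnn.
Qed.

Let muni_Xmax n : muni 'X_ord_max = 'X :> {poly {mpoly K[n]}}.
Proof.
rewrite /muni mmapX mmap1U; case: splitP => // j nj.
by have := ltn_ord j; rewrite -nj /= ltnn.
Qed.

Lemma meval_muni n (w : 'I_n -> K) (x : K) p :
  p.@[join w x] = (map_poly (meval w) (muni p)).[x].
Proof.
elim/mpoly_alg_ind: p => [c|i|p q Ep Eq|p q Ep Eq].
- by rewrite mevalC muniC map_polyC hornerC /= mevalC.
- have [[j ->]|->] : (exists j, i = widen j) \/ i = ord_max.
    case: (unliftP ord_max i) => [j ->|->]; [left|by right].
    by exists j; apply: val_inj; apply: lift_max.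
  + by rewrite mevalXU join_widen muni_X map_polyC hornerC /= mevalXU.
  + by rewrite mevalXU join_max muni_Xmax map_polyX hornerX.
- by rewrite mevalD muniD rmorphD hornerD Ep Eq.
- by rewrite mevalM muniM rmorphM hornerM Ep Eq.
Qed.

Definition of_poly n (q : {poly {mpoly K[n]}}) : {mpoly K[n.+1]} :=
  (map_poly (@mwiden n K) q).['X_ord_max].

Lemma of_polyD n : {morph @of_poly n : p q / p + q}.
Proof. by move=> p q; rewrite /of_poly [map_poly _ _]rmorphD [LHS]hornerD. Qed.

Lemma of_polyM n : {morph @of_poly n : p q / p * q}.
Proof. by move=> p q; rewrite /of_poly [map_poly _ _]rmorphM [LHS]hornerM. Qed.

Lemma muniK n : cancel (@muni n K) (@of_poly n).
Proof.
elim/mpoly_alg_ind => [c|i|p q Ep Eq|p q Ep Eq].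
- by rewrite muniC /of_poly map_polyC hornerC /= mwidenC.
- have [[j ->]|->] : (exists j, i = widen j) \/ i = ord_max.
    case: (unliftP ord_max i) => [j ->|->]; [left|by right].
    by exists j; apply: val_inj; apply: lift_max.
  + by rewrite muni_X /of_poly map_polyC hornerC /= mwidenX mnmwiden1.
  + by rewrite muni_Xmax /of_poly map_polyX hornerX.
- by rewrite muniD of_polyD; apply: congr2 Ep Eq.
- by rewrite muniM of_polyM; apply: congr2 Ep Eq.
Qed.

(** Induction on the number of variables; a point of the field itself, for n = 0,
    works because a prime ideal that misses g contains no nonzero constant. *)
Theorem prime_nullstellensatz n (P : {mpoly K[n]} -> Prop) g :
  prime_ideal P -> ~ P g ->
  exists v : 'I_n -> K, (forall p, P p -> p.@[v] = 0) /\ g.@[v] <> 0.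
Proof.
elim: n P g => [|n IH] P g PP nPg.
  have cst (p : {mpoly K[0]}) : exists c, p = c%:MP.
    elim/mpoly_alg_ind: p => [c|[]//|p q [c ->] [c' ->]|p q [c ->] [c' ->]].
    - by exists c.
    - by exists (c + c'); rewrite mpolyCD.
    - by exists (c * c'); rewrite mpolyCM.
  exists (fun=> 0); split=> [p Pp|]; last first.
    have [c Dg] := cst g; rewrite Dg mevalC => c0.
    by apply: nPg; rewrite Dg c0 mpolyC0; apply: pideal0 PP.
  have [c Dp] := cst p; rewrite Dp mevalC; apply/eqP/negPn/negP => c0.
  apply: nPg; rewrite -[g]mulr1 -mpolyC1 -(mulVf c0) mpolyCM -Dp.
  by apply: (pidealM PP); apply: (pidealM PP).
have QP : prime_ideal (fun q => P (of_poly q)).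
  split=> [|a b Pa Pb|a b Pb|a b].
  - by rewrite -[0]muni0 muniK; apply: pideal0 PP.
  - by rewrite of_polyD; apply: pidealD.
  - by rewrite of_polyM; apply: pidealM.
  - by rewrite of_polyM => /(pideal_prime PP).
have evP : enough_points (fun w : 'I_n -> K => meval w : {rmorphism _ -> _})
    (fun r => P (of_poly r%:P)).
  by move=> h nPh; apply: IH nPh; apply: (contraction_prime QP).
have [|[w x] [ev0 evg]] := enough_points_poly QP evP (g := muni g).
  by rewrite muniK.
exists (join w x); split=> [p Pp|]; rewrite meval_muni //.
by apply: (ev0 (muni p)); rewrite muniK.
Qed.

End Nullstellensatz.

(** * Algebras of functions *)

(** Regular functions are predicates on functions, so the ring operations on them
    are available as closure properties only. *)
Record fun_alg (K : nzRingType) (V : Type) (A : (V -> K) -> Prop) : Prop := FunAlg {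
  fa_cst : forall c, A (fun=> c);
  faD : forall f g, A f -> A g -> A (fun x => f x + g x);
  faM : forall f g, A f -> A g -> A (fun x => f x * g x)
}.

Definition lin_form (K : nzRingType) (V : Type) (A : (V -> K) -> Prop)
    (X : (V -> K) -> K) : Prop :=
  forall c f h, A f -> A h -> X (fun x => c * f x + h x) = c * X f + X h.

Section FunAlg.
Variables (K : comNzRingType) (V : Type) (A : (V -> K) -> Prop).

Lemma fa_ext f g : A f -> f =1 g -> A g.
Proof. by move=> Af /functional_extensionality <-. Qed.

Hypothesis AA : fun_alg A.

Lemma faZ c f : A f -> A (fun x => c * f x).
Proof. exact: (faM AA (fa_cst AA c)). Qed.

Lemma faN f : A f -> A (fun x => - f x).
Proof. by move/(faZ (- 1))/fa_ext; apply=> x; rewrite mulN1r. Qed.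

Lemma faB f g : A f -> A g -> A (fun x => f x - g x).
Proof. by move=> Af /faN; apply: faD. Qed.

Lemma fa_sum (I : Type) (r : seq I) (F : I -> V -> K) :
  (forall i, A (F i)) -> A (fun x => \sum_(i <- r) F i x).
Proof.
move=> AF; elim: r => [|i r IH].
  by apply: fa_ext (fa_cst AA 0) _ => x; rewrite big_nil.
by apply: fa_ext (faD AA (AF i) IH) _ => x; rewrite big_cons.
Qed.

Lemma fa_meval m (phi : V -> 'I_m -> K) (p : {mpoly K[m]}) :
  (forall i, A (phi^~ i)) -> A (fun x => p.@[phi x]).
Proof.
move=> Aphi; elim/mpoly_alg_ind: p => [c|i|p q Ap Aq|p q Ap Aq].
- by apply: fa_ext (fa_cst AA c) _ => x; rewrite mevalC.
- by apply: fa_ext (Aphi i) _ => x; rewrite mevalXU.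
- by apply: fa_ext (faD AA Ap Aq) _ => x; rewrite mevalD.
- by apply: fa_ext (faM AA Ap Aq) _ => x; rewrite mevalM.
Qed.

Variable X : (V -> K) -> K.
Hypothesis lX : lin_form A X.

Lemma lfD f g : A f -> A g -> X (fun x => f x + g x) = X f + X g.
Proof.
move=> Af Ag; rewrite -[X f]mul1r -lX //; congr X.
by apply: functional_extensionality => x; rewrite mul1r.
Qed.

Lemma lf0 : X (fun=> 0) = 0.
Proof.
apply: (@addrI _ (X (fun=> 0))); rewrite addr0 -lfD; try exact: fa_cst AA _.
by congr X; apply: functional_extensionality => x; rewrite addr0.
Qed.

Lemma lfZ c f : A f -> X (fun x => c * f x) = c * X f.
Proof.
move=> Af; rewrite -[RHS]addr0 -lf0 -lX //; last exact: fa_cst AA _.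
by congr X; apply: functional_extensionality => x; rewrite addr0.
Qed.

Lemma lfZr c f : A f -> X (fun x => f x * c) = X f * c.
Proof.
move=> Af; rewrite mulrC -lfZ //; congr X.
by apply: functional_extensionality => x; rewrite mulrC.
Qed.

Lemma lfN f : A f -> X (fun x => - f x) = - X f.
Proof.
move=> Af; rewrite -mulN1r -lfZ //; congr X.
by apply: functional_extensionality => x; rewrite mulN1r.
Qed.

Lemma lfB f g : A f -> A g -> X (fun x => f x - g x) = X f - X g.
Proof. by move=> Af Ag; rewrite lfD ?lfN //; apply: faN. Qed.

Lemma lf_sum (I : Type) (r : seq I) (F : I -> V -> K) :
  (forall i, A (F i)) -> X (fun x => \sum_(i <- r) F i x) = \sum_(i <- r) X (F i).
Proof.
move=> AF; elim: r => [|i r IH].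
  rewrite big_nil; apply: etrans lf0; congr X.
  by apply: functional_extensionality => x; rewrite big_nil.
rewrite big_cons -IH -lfD //; last exact: fa_sum.
by congr X; apply: functional_extensionality => x; rewrite big_cons.
Qed.

End FunAlg.

Lemma affine_fun_alg (K : closedFieldType) V (reg : (V -> K) -> Prop) :
  is_affine_variety reg -> fun_alg reg.
Proof.
case=> m [phi [_ _ regE]]; split=> [c|f g /regE[p Ef] /regE[q Eg]|f g /regE[p Ef] /regE[q Eg]];
  apply/regE.
- by exists c%:MP => x; rewrite mevalC.
- by exists (p + q) => x; rewrite mevalD Ef Eg.
- by exists (p * q) => x; rewrite mevalM Ef Eg.
Qed.

(** * Products *)

Section Product.
Variables (K : closedFieldType) (V W : Type).
Variables (A : (V -> K) -> Prop) (B : (W -> K) -> Prop).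

Lemma prod_reg_fin (I : finType) (a : I -> V -> K) (b : I -> W -> K) f :
  (forall i, A (a i)) -> (forall i, B (b i)) ->
  (forall x y, f (x, y) = \sum_i a i x * b i y) -> prod_reg A B f.
Proof.
move=> Aa Bb Ef; exists #|I|, (fun i => a (enum_val i)), (fun i => b (enum_val i)).
split=> // x y; rewrite Ef (reindex (@enum_val I I)) //.
by exists enum_rank => i _; [apply: enum_valK | apply: enum_rankK].
Qed.

Lemma prod_reg_tensor a b : A a -> B b -> prod_reg A B (fun q => a q.1 * b q.2).
Proof.
move=> Aa Bb; apply: (@prod_reg_fin unit (fun=> a) (fun=> b)) => // x y.
by rewrite (big_pred1 tt) // => -[].
Qed.

Hypotheses (AA : fun_alg A) (BB : fun_alg B).

Lemma prod_fun_alg : fun_alg (prod_reg A B).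
Proof.
split=> [c|f g|f g].
- by apply: fa_ext (prod_reg_tensor (fa_cst AA c) (fa_cst BB 1)) _ => q; rewrite mulr1.
- move=> [m [a [b [Aa Bb Ef]]]] [n [a' [b' [Aa' Bb' Eg]]]].
  pose sel T (u : 'I_m -> T) (v : 'I_n -> T) (i : 'I_m + 'I_n) :=
    match i with inl j => u j | inr j => v j end.
  apply: (@prod_reg_fin ('I_m + 'I_n)%type (sel _ a a') (sel _ b b')) => [[]|[]|x y] //.
  by rewrite big_sumType Ef Eg.
- move=> [m [a [b [Aa Bb Ef]]]] [n [a' [b' [Aa' Bb' Eg]]]].
  apply: (@prod_reg_fin ('I_m * 'I_n)%type (fun i x => a i.1 x * a' i.2 x)
    (fun i x => b i.1 x * b' i.2 x)) => [i|i|x y]; try exact: faM.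
  rewrite Ef Eg mulr_suml -(pair_bigA _ (fun i j => a i x * a' j x * (b i y * b' j y))) /=.
  by apply: eq_bigr => i _; rewrite mulr_sumr; apply: eq_bigr => j _; ring.
Qed.

Lemma prod_reg_ind (Q : (V * W -> K) -> Prop) :
  (forall a b, A a -> B b -> Q (fun q => a q.1 * b q.2)) ->
  (forall f g, prod_reg A B f -> prod_reg A B g -> Q f -> Q g ->
     Q (fun q => f q + g q)) ->
  forall f, prod_reg A B f -> Q f.
Proof.
move=> Qt QD f [m [a [b [Aa Bb Ef]]]].
have -> : f = fun q => \sum_(i < m) a i q.1 * b i q.2.
  by apply: functional_extensionality => -[x y]; rewrite Ef.
elim: (index_enum _) => [|i r IH].
  have -> : (fun q => \sum_(i <- [::]) a i q.1 * b i q.2) = (fun q : V * W => 0 * 0).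
    by apply: functional_extensionality => q; rewrite big_nil mul0r.
  exact: (Qt (fun=> 0) (fun=> 0) (fa_cst AA 0) (fa_cst BB 0)).
have -> : (fun q => \sum_(i <- i :: r) a i q.1 * b i q.2) =
    (fun q : V * W => a i q.1 * b i q.2 + \sum_(i <- r) a i q.1 * b i q.2).
  by apply: functional_extensionality => q; rewrite big_cons.
apply: QD => //; [exact: prod_reg_tensor | | exact: Qt].
apply: (fa_sum prod_fun_alg) => j; exact: prod_reg_tensor.
Qed.

Lemma prod_reg_fst a : A a -> prod_reg A B (fun q => a q.1).
Proof.
by move=> Aa; apply: fa_ext (prod_reg_tensor Aa (fa_cst BB 1)) _ => q; rewrite mulr1.
Qed.

Lemma prod_reg_snd b : B b -> prod_reg A B (fun q => b q.2).
Proof.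
by move=> Bb; apply: fa_ext (prod_reg_tensor (fa_cst AA 1) Bb) _ => q; rewrite mul1r.
Qed.

Lemma prod_reg_slicel f y : prod_reg A B f -> A (fun x => f (x, y)).
Proof.
elim/prod_reg_ind => [a b Aa _|g h _ _ Ag Ah]; last exact: faD.
by apply: fa_ext (faM AA Aa (fa_cst AA (b y))) _.
Qed.

Lemma prod_reg_slicer f x : prod_reg A B f -> B (fun y => f (x, y)).
Proof.
elim/prod_reg_ind => [a b _ Bb|g h _ _ Bg Bh]; last exact: faD.
exact: (faZ BB (a x) Bb).
Qed.

Lemma prod_reg_lf f X : lin_form A X -> prod_reg A B f ->
  B (fun y => X (fun x => f (x, y))).
Proof.
move=> lX; elim/prod_reg_ind => [a b Aa Bb|g h Pg Ph Bg Bh].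
  by apply: fa_ext (faZ BB (X a) Bb) _ => y; rewrite -(lfZr AA lX).
apply: fa_ext (faD BB Bg Bh) _ => y.
by rewrite -(lfD lX) //; apply: prod_reg_slicel.
Qed.

Lemma prod_reg_lf_swap f Y : lin_form B Y -> prod_reg A B f ->
  A (fun x => Y (fun y => f (x, y))).
Proof.
move=> lY; elim/prod_reg_ind => [a b Aa Bb|g h Pg Ph Ag Ah].
  by apply: fa_ext (faM AA Aa (fa_cst AA (Y b))) _ => x; rewrite -(lfZ BB lY).
apply: fa_ext (faD AA Ag Ah) _ => x.
by rewrite -(lfD lY) //; apply: prod_reg_slicer.
Qed.

(** Functionals in different variables commute because they do so on tensors;
    this is what makes vector fields of commuting actions commute. *)
Lemma lf_fubini f X Y : lin_form A X -> lin_form B Y -> prod_reg A B f ->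
  X (fun x => Y (fun y => f (x, y))) = Y (fun y => X (fun x => f (x, y))).
Proof.
move=> lX lY; elim/prod_reg_ind => [a b Aa Bb|g h Pg Ph IHg IHh].
  transitivity (X (fun x => a x * Y b)).
    by congr X; apply: functional_extensionality => x; rewrite -(lfZ BB lY).
  rewrite (lfZr AA lX) // -(lfZ BB lY) //; congr Y.
  by apply: functional_extensionality => y; rewrite -(lfZr AA lX).
transitivity (X (fun x => Y (fun y => g (x, y)) + Y (fun y => h (x, y)))).
  congr X; apply: functional_extensionality => x.
  by rewrite -(lfD lY) //; apply: prod_reg_slicer.
rewrite (lfD lX) ?IHg ?IHh; try exact: (prod_reg_lf_swap lY).
rewrite -(lfD lY); try exact: (prod_reg_lf lX).
congr Y; apply: functional_extensionality => y.
by rewrite -(lfD lX) //; apply: prod_reg_slicel.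
Qed.

End Product.

Lemma prod_reg_mono (K : closedFieldType) V W V' W' (A : (V -> K) -> Prop)
    (B : (W -> K) -> Prop) (A' : (V' -> K) -> Prop) (B' : (W' -> K) -> Prop)
    (u : V' -> V) (v : W' -> W) f :
  (forall a, A a -> A' (fun x => a (u x))) ->
  (forall b, B b -> B' (fun y => b (v y))) ->
  prod_reg A B f -> prod_reg A' B' (fun q => f (u q.1, v q.2)).
Proof.
move=> Au Bv [m [a [b [Aa Bb Ef]]]].
exists m, (fun i x => a i (u x)), (fun i y => b i (v y)).
by split=> [i|i|x y] /=; [apply: Au | apply: Bv | rewrite Ef].
Qed.

Lemma prod_reg_diag (K : closedFieldType) V (A : (V -> K) -> Prop) f :
  fun_alg A -> prod_reg A A f -> A (fun x => f (x, x)).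
Proof.
move=> AA; elim/(prod_reg_ind AA AA) => [a b Aa Ab|g h _ _ Ag Ah].
  exact: (faM AA Aa Ab).
exact: (faD AA Ag Ah).
Qed.

Lemma prod_reg_pullback (K : closedFieldType) U V W (C : (U -> K) -> Prop)
    (A : (V -> K) -> Prop) (B : (W -> K) -> Prop) (u : U -> V) (v : U -> W) f :
  fun_alg C -> (forall a, A a -> C (fun x => a (u x))) ->
  (forall b, B b -> C (fun x => b (v x))) ->
  prod_reg A B f -> C (fun x => f (u x, v x)).
Proof.
move=> CC Cu Cv /(prod_reg_mono Cu Cv); exact: prod_reg_diag.
Qed.

(** The equations of a product are those of the two factors. *)
Lemma prod_affine (K : closedFieldType) V W (A : (V -> K) -> Prop)
    (B : (W -> K) -> Prop) :
  is_affine_variety A -> is_affine_variety B -> is_affine_variety (prod_reg A B).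
Proof.
move=> aA aB; have AA := affine_fun_alg aA; have BB := affine_fun_alg aB.
have PP := prod_fun_alg AA BB.
case: aA => m [phi [phi_inj [I zI] regA]]; case: aB => n [psi [psi_inj [J zJ] regB]].
pose th (q : V * W) (i : 'I_(m + n)) : K :=
  match split i with inl j => phi q.1 j | inr j => psi q.2 j end.
have thl q j : th q (lshift n j) = phi q.1 j.
  by rewrite /th (unsplitK (inl j : 'I_m + 'I_n)).
have thr q j : th q (rshift m j) = psi q.2 j.
  by rewrite /th (unsplitK (inr j : 'I_m + 'I_n)).
pose lft (p : {mpoly K[m]}) : {mpoly K[m + n]} :=
  p \mPo [tuple 'X_(lshift n i) | i < m].
pose rgt (p : {mpoly K[n]}) : {mpoly K[m + n]} :=
  p \mPo [tuple 'X_(rshift m i) | i < n].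
have lftE p v : (lft p).@[v] = p.@[fun i => v (lshift n i)].
  by rewrite comp_mpoly_meval; apply: meval_eq => i; rewrite tnth_mktuple mevalXU.
have rgtE p v : (rgt p).@[v] = p.@[fun i => v (rshift m i)].
  by rewrite comp_mpoly_meval; apply: meval_eq => i; rewrite tnth_mktuple mevalXU.
exists (m + n)%N, th; split.
- move=> [x y] [x' y'] E; congr pair.
    by apply: phi_inj => j; have := E (lshift n j); rewrite !thl.
  by apply: psi_inj => j; have := E (rshift m j); rewrite !thr.
- exists (fun p => (exists2 p', I p' & p = lft p') \/ (exists2 p', J p' & p = rgt p')).
  move=> v; split.
    case=> [[x y] E] p [[p' Ip' ->]|[p' Jp' ->]].
      rewrite lftE; apply: (proj1 (zI _)) Ip'; exists x => j.
      by rewrite -E thl.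
    rewrite rgtE; apply: (proj1 (zJ _)) Jp'; exists y => j.
    by rewrite -E thr.
  move=> v0.
  have [|x Ex] := proj2 (zI (fun i => v (lshift n i))).
    by move=> p Ip; rewrite -lftE; apply: v0; left; exists p.
  have [|y Ey] := proj2 (zJ (fun i => v (rshift m i))).
    by move=> p Jp; rewrite -rgtE; apply: v0; right; exists p.
  exists (x, y) => i; rewrite -[i]splitK; case: (split i) => j /=.
    by rewrite thl Ex.
  by rewrite thr Ey.
- move=> f; split.
    elim/(prod_reg_ind AA BB) => [a b /regA[p Ep] /regB[q Eq]|g h _ _ [p Ep] [q Eq]].
      exists (lft p * rgt q) => z; rewrite mevalM lftE rgtE Ep Eq.
      by congr (_ * _); apply: meval_eq => i; rewrite ?thl ?thr.
    by exists (p + q) => z; rewrite mevalD Ep Eq.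
  case=> p Ep; apply: (@fa_ext _ _ _ (fun z => p.@[th z])) => [|z]; last by rewrite Ep.
  apply: (fa_meval PP (phi := th) p) => i.
  rewrite -[i]splitK; case: (split i) => j /=.
    apply: (@fa_ext _ _ _ (fun q => phi q.1 j)) => [|q]; last by rewrite thl.
    by apply: (prod_reg_fst BB (a := phi^~ j)); apply/regA; exists 'X_j => x; rewrite mevalXU.
  apply: (@fa_ext _ _ _ (fun q => psi q.2 j)) => [|q]; last by rewrite thr.
  by apply: (prod_reg_snd AA (b := psi^~ j)); apply/regB; exists 'X_j => x; rewrite mevalXU.
Qed.

(** * Morphisms of varieties *)

Definition regular_map (K : closedFieldType) U V (C : (U -> K) -> Prop)
    (A : (V -> K) -> Prop) (phi : U -> V) : Prop :=
  forall a, A a -> C (fun x => a (phi x)).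

Section Morphisms.
Variables (K : closedFieldType) (U : Type) (C : (U -> K) -> Prop).
Hypothesis CC : fun_alg C.

Lemma mor_cst V (A : (V -> K) -> Prop) (v : V) : regular_map C A (fun=> v).
Proof. by move=> a _; apply: fa_cst. Qed.

Lemma mor_pair V W (A : (V -> K) -> Prop) (B : (W -> K) -> Prop) (phi : U -> V)
    (psi : U -> W) :
  regular_map C A phi -> regular_map C B psi ->
  regular_map C (prod_reg A B) (fun x => (phi x, psi x)).
Proof. by move=> Cp Cq f; apply: prod_reg_pullback. Qed.

Variable G : alg_group K.
Local Notation reg := (@ag_reg K G).

Lemma mor_mul (phi psi : U -> G) : regular_map C reg phi -> regular_map C reg psi ->
  regular_map C reg (fun x => (phi x * psi x)%g).
Proof. by move=> Cp Cq f /ag_mul; apply: (mor_pair Cp Cq). Qed.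

Lemma mor_inv (phi : U -> G) : regular_map C reg phi ->
  regular_map C reg (fun x => (phi x)^-1%g).
Proof. by move=> Cp f /ag_inv; apply: Cp. Qed.

End Morphisms.

Lemma mor_id (K : closedFieldType) V (A : (V -> K) -> Prop) : regular_map A A id.
Proof. by []. Qed.

Lemma mor_fst (K : closedFieldType) V W (A : (V -> K) -> Prop) (B : (W -> K) -> Prop)
    U (D : (U -> K) -> Prop) (phi : V -> U) :
  fun_alg B -> regular_map A D phi -> regular_map (prod_reg A B) D (fun q => phi q.1).
Proof. by move=> BB Ap d /Ap; apply: prod_reg_fst. Qed.

Lemma mor_snd (K : closedFieldType) V W (A : (V -> K) -> Prop) (B : (W -> K) -> Prop)
    U (D : (U -> K) -> Prop) (phi : W -> U) :
  fun_alg A -> regular_map B D phi -> regular_map (prod_reg A B) D (fun q => phi q.2).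
Proof. by move=> AA Bp d /Bp; apply: prod_reg_snd. Qed.

(** * Point derivations of a group *)

Section Group.
Variables (K : closedFieldType) (G : alg_group K).
Local Notation reg := (@ag_reg K G).

Lemma ag_fun_alg : fun_alg reg.
Proof. exact: affine_fun_alg (ag_affine G). Qed.

Let GG := ag_fun_alg.
Let GG2 := prod_fun_alg GG GG.

Definition mor1 := @mor_id _ _ reg.
Definition mor2l := mor_fst GG mor1.
Definition mor2r := mor_snd GG mor1.

Lemma reg_mull g f : reg f -> reg (fun p => f (g * p)%g).
Proof. exact: (mor_mul GG (mor_cst GG g) mor1). Qed.

Lemma reg_mulr g f : reg f -> reg (fun p => f (p * g)%g).
Proof. exact: (mor_mul GG mor1 (mor_cst GG g)). Qed.

Lemma reg_conj g f : reg f -> reg (fun p => f (g * p * g^-1)%g).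
Proof. by move=> rf; apply: reg_mull (reg_mulr _ rf). Qed.

Section LieElement.
Variable X : (G -> K) -> K.
Hypothesis LX : lie_element X.

Lemma lie_lf : lin_form reg X.
Proof. by case: LX. Qed.

Lemma lieM f h : reg f -> reg h ->
  X (fun x => f x * h x) = f 1%g * X h + X f * h 1%g.
Proof. by case: LX => _; apply. Qed.

Lemma lie_cst c : X (fun=> c) = 0.
Proof.
have X1 : X (fun=> 1) = 0.
  have := lieM (fa_cst GG 1) (fa_cst GG 1); rewrite mulr1 !mul1r mulr1.
  by rewrite -{1}[X _]addr0 => /addrI.
have := lfZ GG lie_lf c (fa_cst GG 1); rewrite X1 mulr0 => <-.
by congr X; apply: functional_extensionality => x; rewrite mulr1.
Qed.

(** The chain rule for the diagonal of G x G: by the Leibniz rule it holds on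
    tensors.  The derivatives of inversion, of conjugation and of diagonal actions
    are all read off from it. *)
Lemma lie_diag F : prod_reg reg reg F ->
  X (fun p => F (p, p)) = X (fun p => F (p, 1%g)) + X (fun p => F (1%g, p)).
Proof.
elim/(prod_reg_ind GG GG) => [a b ra rb|f h Pf Ph IHf IHh] /=.
  by rewrite lieM // (lfZr GG lie_lf) // (lfZ GG lie_lf) // addrC.
have rd f' : prod_reg reg reg f' -> reg (fun p => f' (p, p)) by apply: prod_reg_diag.
have rl f' : prod_reg reg reg f' -> reg (fun p => f' (p, 1%g)) by apply: prod_reg_slicel.
have rr f' : prod_reg reg reg f' -> reg (fun p => f' (1%g, p)) by apply: prod_reg_slicer.
by rewrite !(lfD lie_lf) ?IHf ?IHh; try solve [exact: rd | exact: rl | exact: rr]; ring.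
Qed.

Lemma lie_inv f : reg f -> X (fun p => f (p^-1)%g) = - X f.
Proof.
move=> rf; apply/eqP; rewrite -addr_eq0 addrC.
have := lie_diag (mor_mul GG2 mor2l (mor_inv mor2r) rf) => /=.
have -> : (fun p : G => f (p * p^-1)%g) = fun=> f 1%g.
  by apply: functional_extensionality => p; rewrite mulgV.
rewrite lie_cst => E; rewrite [X in _ == X]E; apply/eqP; congr (X _ + X _);
  by apply: functional_extensionality => p; rewrite ?invg1 ?mulg1 ?mul1g.
Qed.

End LieElement.

(** The commutator for the convolution product of functionals on G. *)
Definition lie_br (X Y : (G -> K) -> K) : (G -> K) -> K := fun f =>
  X (fun p => Y (fun q => f (p * q)%g)) - Y (fun p => X (fun q => f (p * q)%g)).

Lemma lie_br_anti X Y f : lie_br Y X f = - lie_br X Y f.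
Proof. by rewrite /lie_br opprB. Qed.

Section LieBracket.
Variables X Y : (G -> K) -> K.
Hypotheses (LX : lie_element X) (LY : lie_element Y).

Lemma reg_lier f : reg f -> reg (fun p => X (fun q => f (p * q)%g)).
Proof.
move=> rf.
exact: (prod_reg_lf GG GG (f := fun t => f (t.2 * t.1)%g) (lie_lf LX)
  (mor_mul GG2 mor2r mor2l rf)).
Qed.

Lemma reg_liel f : reg f -> reg (fun p => X (fun q => f (q * p)%g)).
Proof.
move=> rf.
exact: (prod_reg_lf GG GG (f := fun t => f (t.1 * t.2)%g) (lie_lf LX)
  (mor_mul GG2 mor2l mor2r rf)).
Qed.

Lemma lie_fubini f : reg f ->
  X (fun p => Y (fun q => f (p * q)%g)) = Y (fun q => X (fun p => f (p * q)%g)).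
Proof.
move=> rf.
exact: (lf_fubini GG GG (f := fun t => f (t.1 * t.2)%g) (lie_lf LX) (lie_lf LY)
  (mor_mul GG2 mor2l mor2r rf)).
Qed.

End LieBracket.

Lemma lie_comp_lin X Y c f h : lie_element X -> lie_element Y -> reg f -> reg h ->
  X (fun p => Y (fun q => c * f (p * q)%g + h (p * q)%g)) =
  c * X (fun p => Y (fun q => f (p * q)%g)) + X (fun p => Y (fun q => h (p * q)%g)).
Proof.
move=> LX LY rf rh; rewrite -(lie_lf LX); try exact: (reg_lier LY).
congr X; apply: functional_extensionality => p.
by rewrite -(lie_lf LY) //; apply: reg_mull.
Qed.

Lemma lie_comp_mul X Y f h : lie_element X -> lie_element Y -> reg f -> reg h ->
  X (fun p => Y (fun q => f (p * q)%g * h (p * q)%g)) =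
  f 1%g * X (fun p => Y (fun q => h (p * q)%g)) + X f * Y h +
  (X h * Y f + X (fun p => Y (fun q => f (p * q)%g)) * h 1%g).
Proof.
move=> LX LY rf rh.
have e1 k : (fun q : G => k (1 * q)%g) = k :> (G -> K).
  by apply: functional_extensionality => q; rewrite mul1g.
transitivity (X (fun p => f p * Y (fun q => h (p * q)%g) +
                          Y (fun q => f (p * q)%g) * h p)).
  congr X; apply: functional_extensionality => p.
  by rewrite (lieM LY) ?mulg1 //; apply: reg_mull.
rewrite (lfD (lie_lf LX)); last first.
- by apply: (faM GG) => //; apply: (reg_lier LY).
- by apply: (faM GG) => //; apply: (reg_lier LY).
rewrite !(lieM LX) //; try exact: (reg_lier LY).
by rewrite !e1; ring.
Qed.

Lemma lie_br_lie X Y : lie_element X -> lie_element Y -> lie_element (lie_br X Y).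
Proof.
move=> LX LY; split=> [c f h rf rh|f h rf rh]; rewrite /lie_br /=.
  by rewrite (lie_comp_lin c LX LY rf rh) (lie_comp_lin c LY LX rf rh); ring.
by rewrite (lie_comp_mul LX LY rf rh) (lie_comp_mul LY LX rf rh); ring.
Qed.

(** The chain rule applied to g |-> Y (p |-> f (g p g'^-1)) with g' = g. *)
Lemma lie_conj X Y f : lie_element X -> lie_element Y -> reg f ->
  X (fun g => Y (fun p => f (g * p * g^-1)%g)) = lie_br X Y f.
Proof.
move=> LX LY rf; rewrite /lie_br.
pose F (q : G * G) := Y (fun p => f (q.1 * p * q.2^-1)%g).
have PF : prod_reg reg reg F.
  have GG3 := prod_fun_alg GG GG2.
  have /(prod_reg_lf GG GG2 (lie_lf LY)) // : prod_reg reg (prod_reg reg reg)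
      (fun t => f (t.2.1 * t.1 * t.2.2^-1)%g).
  apply: (mor_mul GG3 _ _ rf); last exact: mor_inv (mor_snd GG mor2r).
  exact: (mor_mul GG3 (mor_snd GG mor2l) (mor_fst GG2 mor1)).
rewrite (lie_diag LX PF) /F /=; congr (_ + _).
  congr X; apply: functional_extensionality => g; congr Y.
  by apply: functional_extensionality => p; rewrite invg1 mulg1.
rewrite (lie_fubini LY LX) // -(lie_inv LX (reg_liel LY rf)).
congr X; apply: functional_extensionality => g; congr Y.
by apply: functional_extensionality => p; rewrite mul1g.
Qed.

End Group.

Arguments mor1 {K G}.
Arguments mor2l {K G}.
Arguments mor2r {K G}.

(** * The Casimir pairing and the Cartan 3-tensor *)

Section Casimir.
Variables (K : closedFieldType) (G : alg_group K).
Variables (d : nat) (e : 'I_d -> (G -> K) -> K) (eta : 'M[K]_d).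
Hypotheses (e_lie : forall j, lie_element (e j)) (eta_sym : eta^T = eta).
Hypothesis eta_inv : Ad_invariant e eta.
Local Notation reg := (@ag_reg K G).
Let GG := ag_fun_alg G.
Let e_lf j := lie_lf (e_lie j).

Definition pairing (u v : G -> K) : K :=
  \sum_j \sum_k eta j k * (e j u * e k v).

Lemma eta_symE j k : eta j k = eta k j.
Proof. by rewrite -{1}eta_sym mxE. Qed.

Lemma pairingC u v : pairing u v = pairing v u.
Proof.
rewrite /pairing exchange_big; apply: eq_bigr => j _; apply: eq_bigr => k _.
by rewrite eta_symE [e k u * _]mulrC.
Qed.

Lemma pairing_lf v : lin_form reg (pairing^~ v).
Proof.
move=> c f h rf rh; rewrite /pairing mulr_sumr -big_split; apply: eq_bigr => j _ /=.
rewrite mulr_sumr -big_split; apply: eq_bigr => k _ /=; rewrite e_lf //; ring.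
Qed.

Lemma pairing_cst c u : pairing (fun=> c) u = 0.
Proof.
rewrite /pairing big1 // => j _; rewrite big1 // => k _.
by rewrite (lie_cst (e_lie j)) mul0r mulr0.
Qed.

Lemma pairing_invl u v : reg u -> pairing (fun p => u p^-1%g) v = - pairing u v.
Proof.
move=> ru; rewrite /pairing -sumrN; apply: eq_bigr => j _; rewrite -sumrN.
by apply: eq_bigr => k _; rewrite lie_inv //; ring.
Qed.

Lemma pairing_invr u v : reg v -> pairing u (fun p => v p^-1%g) = - pairing u v.
Proof. by move=> rv; rewrite ![pairing u _]pairingC pairing_invl. Qed.

Lemma pairing_conj g u v : reg u -> reg v ->
  pairing (fun p => u (g * p * g^-1)%g) (fun p => v (g * p * g^-1)%g) = pairing u v.
Proof. exact: eta_inv. Qed.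

(** Derivative at g = 1 of the invariance of [pairing] under conjugation by g. *)
Lemma pairing_lie X u v : lie_element X -> reg u -> reg v ->
  \sum_j \sum_k eta j k * (lie_br X (e j) u * e k v) =
  - \sum_j \sum_k eta j k * (e j u * lie_br X (e k) v).
Proof.
move=> LX ru rv; apply/eqP; rewrite -addr_eq0; apply/eqP.
have rc Y f : lie_element Y -> reg f -> reg (fun g => Y (fun p => f (g * p * g^-1)%g)).
  move=> LY rf.
  have GG2 := prod_fun_alg GG GG.
  apply: (prod_reg_lf GG GG (f := fun t => f (t.2 * t.1 * t.2^-1)%g) (lie_lf LY)).
  exact: (mor_mul GG2 (mor_mul GG2 mor2r mor2l) (mor_inv mor2r) rf).
have e1 f : (fun p : G => f (1 * p * 1^-1)%g) = f :> (G -> K).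
  by apply: functional_extensionality => p; rewrite invg1 mul1g mulg1.
transitivity (X (fun g => pairing (fun p => u (g * p * g^-1)%g) (fun p => v (g * p * g^-1)%g))).
  rewrite (lf_sum GG (lie_lf LX)) => [|j]; last first.
    by apply: (fa_sum GG) => k; apply: (faZ GG); apply: (faM GG); apply: (rc (e _)).
  rewrite -big_split; apply: eq_bigr => j _ /=.
  rewrite (lf_sum GG (lie_lf LX)) => [|k]; last first.
    by apply: (faZ GG); apply: (faM GG); apply: (rc (e _)).
  rewrite -big_split; apply: eq_bigr => k _ /=.
  rewrite (lfZ GG (lie_lf LX)); last by apply: (faM GG); apply: (rc (e _)).
  rewrite (lieM LX); [|exact: (rc (e j))|exact: (rc (e k))].
  by rewrite (lie_conj LX (e_lie j) ru) (lie_conj LX (e_lie k) rv) (e1 u) (e1 v); ring.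
rewrite (_ : (fun g => _) = fun=> pairing u v) ?lie_cst //.
by apply: functional_extensionality => g; apply: pairing_conj.
Qed.

(** All the quadratic expressions in eta below are contractions of a 4-index
    array with eta (x) eta.  They are compared after relabelling the indices: the
    two copies of eta may be exchanged and each copy is symmetric. *)
Definition contract2 (Z : 'I_d -> 'I_d -> 'I_d -> 'I_d -> K) : K :=
  \sum_j \sum_k \sum_l \sum_m eta j k * eta l m * Z j k l m.

Lemma contract2_eq Z Z' : (forall j k l m, Z j k l m = Z' j k l m) ->
  contract2 Z = contract2 Z'.
Proof.
move=> E; apply: eq_bigr => j _; apply: eq_bigr => k _; apply: eq_bigr => l _.
by apply: eq_bigr => m _; rewrite E.
Qed.

Lemma contract2D Z Z' :
  contract2 (fun j k l m => Z j k l m + Z' j k l m) = contract2 Z + contract2 Z'.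
Proof.
rewrite /contract2 -big_split; apply: eq_bigr => j _; rewrite -big_split.
apply: eq_bigr => k _; rewrite -big_split; apply: eq_bigr => l _; rewrite -big_split.
by apply: eq_bigr => m _; rewrite /= mulrDr.
Qed.

Lemma contract2Z c Z : contract2 (fun j k l m => c * Z j k l m) = c * contract2 Z.
Proof.
rewrite /contract2 mulr_sumr; apply: eq_bigr => j _; rewrite mulr_sumr.
apply: eq_bigr => k _; rewrite mulr_sumr; apply: eq_bigr => l _; rewrite mulr_sumr.
by apply: eq_bigr => m _; rewrite mulrCA.
Qed.

Lemma contract2N Z : contract2 (fun j k l m => - Z j k l m) = - contract2 Z.
Proof.
by rewrite -mulN1r -contract2Z; apply: contract2_eq => *; rewrite mulN1r.
Qed.

Lemma contract2_swap Z : contract2 Z = contract2 (fun j k l m => Z l m j k).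
Proof.
have R F : \sum_(j < d) \sum_(k < d) \sum_(l < d) \sum_(m < d) F j k l m =
    \sum_(l < d) \sum_(m < d) \sum_(j < d) \sum_(k < d) F j k l m :> K.
  under eq_bigr => j _ do rewrite exchange_big.
  rewrite exchange_big; apply: eq_bigr => l _.
  under eq_bigr => j _ do rewrite exchange_big.
  by rewrite exchange_big.
rewrite /contract2 R; do 4 apply: eq_bigr => ? _.
by congr (_ * _); rewrite mulrC.
Qed.

Lemma contract2_flip Z : contract2 Z = contract2 (fun j k l m => Z k j l m).
Proof.
rewrite /contract2 exchange_big; do 2 apply: eq_bigr => ? _.
by rewrite eta_symE.
Qed.

Lemma contract2_flip2 Z : contract2 Z = contract2 (fun j k l m => Z j k m l).
Proof.
by rewrite contract2_swap contract2_flip contract2_swap.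
Qed.

(** The Cartan 3-tensor as a trilinear functional on K[G]. *)
Definition cartan (u v w : G -> K) : K :=
  contract2 (fun j k l m => lie_br (e j) (e l) u * e k v * e m w).

Lemma cartan_anti u v w : cartan u w v = - cartan u v w.
Proof.
rewrite /cartan contract2_swap -contract2N; apply: contract2_eq => j k l m.
by rewrite lie_br_anti; ring.
Qed.

(** Moving [e_l] across the first copy of eta by [pairing_lie]. *)
Lemma cartan_swap u v w : reg u -> reg v -> cartan v u w = - cartan u v w.
Proof.
move=> ru rv; apply/eqP; rewrite -addr_eq0 /cartan contract2_flip -contract2D.
apply/eqP.
have -> : contract2 (fun j k l m => lie_br (e k) (e l) v * e j u * e m w +
    lie_br (e j) (e l) u * e k v * e m w) =
  \sum_l \sum_m eta l m * e m w * - (\sum_j \sum_k eta j k * (e j u * lie_br (e l) (e k) v) +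
    \sum_j \sum_k eta j k * (lie_br (e l) (e j) u * e k v)).
  rewrite contract2_swap; apply: eq_bigr => l _; apply: eq_bigr => m _.
  rewrite -big_split -sumrN mulr_sumr; apply: eq_bigr => j _ /=.
  rewrite -big_split -sumrN mulr_sumr; apply: eq_bigr => k _ /=.
  by rewrite (lie_br_anti (e l) (e k)) (lie_br_anti (e l) (e j)); ring.
rewrite big1 // => l _; rewrite big1 // => m _.
by rewrite (pairing_lie (e_lie l) ru rv) subrr oppr0 mulr0.
Qed.

Lemma cartan_cyc u v w : reg u -> reg v -> cartan u v w = cartan v w u.
Proof. by move=> ru rv; rewrite (cartan_anti v u w) (cartan_swap w ru rv) opprK. Qed.

Lemma cartan_inv u v w : reg u -> reg v -> reg w ->
  cartan (fun p => u p^-1%g) (fun p => v p^-1%g) (fun p => w p^-1%g) = - cartan u v w.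
Proof.
move=> ru rv rw; rewrite -contract2N; apply: contract2_eq => j k l m.
have LB := lie_br_lie (e_lie j) (e_lie l).
by rewrite (lie_inv LB ru) (lie_inv (e_lie k) rv) (lie_inv (e_lie m) rw); ring.
Qed.

Lemma reg_comm u : reg u ->
  prod_reg reg reg (fun t => u (t.1 * t.2)%g - u (t.2 * t.1)%g).
Proof.
have GG2 := prod_fun_alg GG GG; move=> ru; apply: (faB GG2).
  exact: (mor_mul GG2 mor2l mor2r ru).
exact: (mor_mul GG2 mor2r mor2l ru).
Qed.

(** An expression without the basis, in which the invariance under conjugation
    is visible. *)
Lemma cartan_pairing u v w : reg u -> cartan u v w =
  pairing (fun q => pairing (fun p => u (p * q)%g - u (q * p)%g) v) w.
Proof.
move=> ru; rewrite /cartan contract2_swap; apply: eq_bigr => l _; apply: eq_bigr => m _.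
rewrite -(lf_fubini GG GG (f := fun t => u (t.1 * t.2)%g - u (t.2 * t.1)%g)
  (pairing_lf v) (e_lf l) (reg_comm ru)) /=.
rewrite /pairing mulr_suml mulr_sumr; apply: eq_bigr => j _.
rewrite mulr_suml mulr_sumr; apply: eq_bigr => k _.
suff -> : e j (fun p => e l (fun q => u (p * q)%g - u (q * p)%g)) = lie_br (e j) (e l) u.
  by ring.
rewrite /lie_br (lie_fubini (e_lie l) (e_lie j)) // -(lfB GG (e_lf j)); last first.
- exact: (reg_liel (e_lie l) ru).
- exact: (reg_lier (e_lie l) ru).
congr (e j); apply: functional_extensionality => p.
by rewrite -(lfB GG (e_lf l) (reg_mull p ru) (reg_mulr p ru)).
Qed.

Lemma cartan_conj g u v w : reg u -> reg v -> reg w ->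
  cartan (fun p => u (g * p * g^-1)%g) (fun p => v (g * p * g^-1)%g)
    (fun p => w (g * p * g^-1)%g) = cartan u v w.
Proof.
move=> ru rv rw; rewrite !cartan_pairing //; last exact: reg_conj.
have rD q : reg (fun p => u (p * q)%g - u (q * p)%g).
  by apply: faB => //; [apply: reg_mulr | apply: reg_mull].
rewrite -[RHS](pairing_conj g) //; last first.
  exact: (prod_reg_lf GG GG (f := fun t => u (t.1 * t.2)%g - u (t.2 * t.1)%g)
    (pairing_lf v) (reg_comm ru)).
congr pairing; apply: functional_extensionality => q.
rewrite -[RHS](pairing_conj g) //; congr pairing.
apply: functional_extensionality => p.
by congr (u _ - u _); rewrite !mulgA mulgVK.
Qed.

End Casimir.

(** * Brackets *)

(** Biderivations.  The bracket of functions that are not regular is arbitrary, so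
    every clause is restricted to the algebra A. *)
Record bracket (K : nzRingType) (V : Type) (A : (V -> K) -> Prop)
    (br : (V -> K) -> (V -> K) -> V -> K) : Prop := Bracket {
  br_reg : forall f g, A f -> A g -> A (br f g);
  br_lin : forall h x, A h -> lin_form A (fun f => br f h x);
  br_anti : forall f g x, A f -> A g -> br f g x = - br g f x;
  br_leib : forall f g h x, A f -> A g -> A h ->
    br (fun y => f y * g y) h x = f x * br g h x + br f h x * g x
}.

Definition jacobiator (K : nzRingType) (V : Type)
    (br : (V -> K) -> (V -> K) -> V -> K) f g h (x : V) : K :=
  br (br f g) h x + br (br g h) f x + br (br h f) g x.

Section BracketTheory.
Variables (K : comNzRingType) (V : Type) (A : (V -> K) -> Prop).
Variable br : (V -> K) -> (V -> K) -> V -> K.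
Hypotheses (AA : fun_alg A) (B : bracket A br).

Lemma br_linr f x : A f -> lin_form A (fun h => br f h x).
Proof.
move=> Af c h h' Ah Ah'; rewrite (br_anti B) //; last first.
  by apply: (faD AA) => //; apply: faZ.
by rewrite (br_lin B) // (br_anti B x Ah) // (br_anti B x Ah') //; ring.
Qed.

Lemma br_leibr f g h x : A f -> A g -> A h ->
  br f (fun y => g y * h y) x = g x * br f h x + br f g x * h x.
Proof.
move=> Af Ag Ah; rewrite (br_anti B) //; last exact: (faM AA).
rewrite (br_leib B) // (br_anti B x Ah) // (br_anti B x Ag) //; ring.
Qed.

Lemma br_cstr f c x : A f -> br f (fun=> c) x = 0.
Proof.
move=> Af; have A1 := fa_cst AA 1.
have E : br f (fun=> 1) x = 0.
  have := br_leibr x Af A1 A1; rewrite mulr1 !mul1r mulr1.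
  by rewrite -{1}[br f _ x]addr0 => /addrI.
have := lfZ AA (br_linr x Af) c A1; rewrite E mulr0 => <-.
by congr br; apply: functional_extensionality => y; rewrite mulr1.
Qed.

End BracketTheory.

(** * Group actions and their fundamental fields *)

Section Actions.
Variables (K : closedFieldType) (G : alg_group K) (V : Type) (A : (V -> K) -> Prop).
Local Notation reg := (@ag_reg K G).
Let GG := ag_fun_alg G.
Hypothesis AA : fun_alg A.
Let GA := prod_fun_alg GG AA.

Record regular_action (a : G -> V -> V) : Prop := RegularAction {
  act1 : forall x, a 1%g x = x;
  actM : forall g h x, a (g * h)%g x = a g (a h x);
  act_reg : regular_map (prod_reg reg A) A (fun q => a q.1 q.2)
}.

Lemma mor_act U (C : (U -> K) -> Prop) (a : G -> V -> V) (phi : U -> G) (psi : U -> V) :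
  fun_alg C -> regular_action a -> regular_map C reg phi -> regular_map C A psi ->
  regular_map C A (fun x => a (phi x) (psi x)).
Proof. by move=> CC Ra Cp Cq f /(act_reg Ra); apply: (mor_pair CC Cp Cq). Qed.

Definition commuting (a b : G -> V -> V) : Prop :=
  forall p q x, a p (b q x) = b q (a p x).

Definition diagonal (a b : G -> V -> V) : G -> V -> V := fun p x => a p (b p x).

Lemma diagonal_action a b : regular_action a -> regular_action b -> commuting a b ->
  regular_action (diagonal a b).
Proof.
move=> Ra Rb ab; split=> [x|g h x|]; rewrite /diagonal.
- by rewrite (act1 Rb) (act1 Ra).
- by rewrite (actM Rb) (actM Ra) ab.
- apply: (mor_act GA Ra (mor_fst AA mor1)).
  exact: (mor_act GA Rb (mor_fst AA mor1) (mor_snd GG (@mor_id _ _ A))).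
Qed.

(** The fundamental field of X at x is the functional X applied to
    [orbital a f x]; the inverse is that of the convention X_M(x) = d/dt exp(-tX)x. *)
Definition orbital (a : G -> V -> V) (f : V -> K) (x : V) : G -> K :=
  fun p => f (a p^-1%g x).

Section OneAction.
Variable a : G -> V -> V.
Hypothesis Ra : regular_action a.

Lemma reg_orbital2 f : A f -> prod_reg reg A (fun q => f (a q.1^-1%g q.2)).
Proof.
apply: (mor_act GA Ra (mor_inv (mor_fst AA mor1)) (mor_snd GG (@mor_id _ _ A))).
Qed.

Lemma reg_orbital f x : A f -> reg (orbital a f x).
Proof. by move/reg_orbital2/(prod_reg_slicel GG AA x). Qed.

Lemma act_map g : regular_map A A (a g).
Proof. exact: (mor_act AA Ra (mor_cst AA g) (@mor_id _ _ A)). Qed.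

Lemma orbital1 f x : orbital a f x 1%g = f x.
Proof. by rewrite /orbital invg1 (act1 Ra). Qed.

Lemma fund_reg X f : lie_element X -> A f -> A (fun x => X (orbital a f x)).
Proof.
move=> LX Af; exact: (prod_reg_lf GG AA (lie_lf LX) (reg_orbital2 Af)).
Qed.

Lemma fund_leib X f g x : lie_element X -> A f -> A g ->
  X (orbital a (fun y => f y * g y) x) =
  f x * X (orbital a g x) + X (orbital a f x) * g x.
Proof.
by move=> LX Af Ag; rewrite -(orbital1 f x) -(orbital1 g x) -(lieM LX) //;
   apply: reg_orbital.
Qed.

Lemma fund_lin X x : lie_element X -> lin_form A (fun f => X (orbital a f x)).
Proof.
by move=> LX c f h Af Ah; apply: (lie_lf LX); apply: reg_orbital.
Qed.

(** The inverse in [orbital] makes X |-> X_M a morphism of Lie algebras, not an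
    antimorphism. *)
Lemma fund_bracket X Y f x : lie_element X -> lie_element Y -> A f ->
  X (orbital a (fun y => Y (orbital a f y)) x) -
  Y (orbital a (fun y => X (orbital a f y)) x) = lie_br X Y (orbital a f x).
Proof.
move=> LX LY Af; rewrite /lie_br /orbital.
have E Z Z' : Z (fun p : G => Z' (fun q : G => f (a q^-1 (a p^-1 x))%g)) =
   Z (fun p : G => Z' (fun q : G => f (a (p * q)^-1%g x))) :> K.
  congr Z; apply: functional_extensionality => p; congr Z'.
  by apply: functional_extensionality => q; rewrite invgM (actM Ra).
by rewrite !E.
Qed.

End OneAction.

Lemma fund_comm a b X Y f x : regular_action a -> regular_action b -> commuting a b ->
  lie_element X -> lie_element Y -> A f ->
  X (orbital a (fun y => Y (orbital b f y)) x) =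
  Y (orbital b (fun y => X (orbital a f y)) x).
Proof.
move=> Ra Rb ab LX LY Af; rewrite /orbital.
transitivity (X (fun p => Y (fun q => f (a p^-1 (b q^-1 x)))%g)).
  congr X; apply: functional_extensionality => p; congr Y.
  by apply: functional_extensionality => q; rewrite ab.
apply: (lf_fubini GG GG (f := fun t => f (a t.1^-1 (b t.2^-1 x))%g) (lie_lf LX) (lie_lf LY)).
have GG2 := prod_fun_alg GG GG.
apply: (mor_act GG2 Ra (mor_inv mor2l)) => //.
exact: (mor_act GG2 Rb (mor_inv mor2r) (mor_cst GG2 x)).
Qed.

(** The chain rule [lie_diag] along the orbit map of G x G. *)
Lemma fund_diagonal a b X f x : regular_action a -> regular_action b ->
  lie_element X -> A f ->
  X (orbital (diagonal a b) f x) = X (orbital a f x) + X (orbital b f x).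
Proof.
move=> Ra Rb LX Af; have GG2 := prod_fun_alg GG GG.
have P : prod_reg reg reg (fun t => f (a t.1^-1 (b t.2^-1 x))%g).
  apply: (mor_act GG2 Ra (mor_inv mor2l)) => //.
  exact: (mor_act GG2 Rb (mor_inv mor2r) (mor_cst GG2 x)).
rewrite /orbital /diagonal (lie_diag LX P) /=; congr (X _ + X _);
  by apply: functional_extensionality => p; rewrite invg1 ?(act1 Ra) ?(act1 Rb).
Qed.

Definition invariant_under (br : (V -> K) -> (V -> K) -> V -> K) (tau : V -> V) :=
  forall f h x, A f -> A h ->
    br (fun y => f (tau y)) (fun y => h (tau y)) x = br f h (tau x).

Lemma reg_bracket2 br F H x : bracket A br -> prod_reg reg A F -> prod_reg reg A H ->
  prod_reg reg reg (fun q => br (fun y => F (q.1, y)) (fun y => H (q.2, y)) x).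
Proof.
move=> B PF PH; have GG2 := prod_fun_alg GG GG.
elim/(prod_reg_ind GG AA): F / PF => [u f ru Af|F F' PF PF' IH IH'].
  apply: fa_ext (prod_reg_tensor ru (prod_reg_lf_swap GG AA (br_linr AA B x Af) PH)) _.
  by move=> q /=; rewrite (lfZ AA (br_lin B x _)) //; apply: (prod_reg_slicer GG AA).
apply: fa_ext (faD GG2 IH IH') _ => q /=.
by rewrite (lfD (br_lin B x _)) //; apply: (prod_reg_slicer GG AA).
Qed.

(** Derivative at g = 1 of the invariance of the bracket under g: the chain rule
    separates the two arguments, and the functional X is exchanged with the
    bracket by [lf_fubini]. *)
Lemma fund_derivation br a X f h x : bracket A br -> regular_action a ->
  (forall g, invariant_under br (a g)) -> lie_element X -> A f -> A h ->
  X (orbital a (br f h) x) =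
  br (fun y => X (orbital a f y)) h x + br f (fun y => X (orbital a h y)) x.
Proof.
move=> B Ra Ia LX Af Ah.
have := lie_diag LX (reg_bracket2 x B (reg_orbital2 Ra Af) (reg_orbital2 Ra Ah)).
rewrite /= => E.
transitivity (X (fun p => br (fun y => f (a p^-1%g y)) (fun y => h (a p^-1%g y)) x)).
  by congr X; apply: functional_extensionality => p; rewrite Ia.
rewrite E; congr (_ + _).
  rewrite -(lf_fubini GG AA (lie_lf LX) (br_lin B x Ah) (reg_orbital2 Ra Af)) /=.
  congr X; apply: functional_extensionality => p.
  by congr br; apply: functional_extensionality => y; rewrite invg1 (act1 Ra).
rewrite -(lf_fubini GG AA (lie_lf LX) (br_linr AA B x Af) (reg_orbital2 Ra Ah)) /=.
congr X; apply: functional_extensionality => p.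
by congr br; apply: functional_extensionality => y; rewrite invg1 (act1 Ra).
Qed.

End Actions.

(** * Fusion *)

Section Fusion.
Variables (K : closedFieldType) (G : alg_group K).
Variables (d : nat) (e : 'I_d -> (G -> K) -> K) (eta : 'M[K]_d).
Hypotheses (e_lie : forall j, lie_element (e j)) (eta_sym : eta^T = eta).
Hypothesis eta_inv : Ad_invariant e eta.
Variables (V : Type) (A : (V -> K) -> Prop).
Local Notation reg := (@ag_reg K G).
Local Notation pairing := (pairing e eta).
Local Notation cartan := (cartan e eta).
Local Notation contract2 := (contract2 eta).
Let GG := ag_fun_alg G.
Let e_lf j := lie_lf (e_lie j).
Hypothesis AA : fun_alg A.

Definition fusion_term (a b : G -> V -> V) (f h : V -> K) (x : V) : K :=
  2%:R^-1 * (pairing (orbital a f x) (orbital b h x) -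
             pairing (orbital a h x) (orbital b f x)).

Section Term.
Variables a b : G -> V -> V.
Hypotheses (Ra : regular_action A a) (Rb : regular_action A b).

Local Notation D1 j f := (fun y => e j (orbital a f y)).
Local Notation D2 k f := (fun y => e k (orbital b f y)).

Lemma fusion_termE f h x : fusion_term a b f h x =
  2%:R^-1 * \sum_j \sum_k eta j k * (D1 j f x * D2 k h x - D1 j h x * D2 k f x).
Proof.
congr (_ * _); rewrite /pairing -sumrB; apply: eq_bigr => j _.
by rewrite -sumrB; apply: eq_bigr => k _; ring.
Qed.

Lemma fusion_term_bracket : bracket A (fusion_term a b).
Proof.
have rO c f x : regular_action A c -> A f -> reg (orbital c f x).
  by move=> Rc; apply: reg_orbital.
split=> [f g Af Ag|h x Ah c f g Af Ag|f g x Af Ag|f g h x Af Ag Ah].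
- apply: (@fa_ext _ _ _ _ _ _ (fun x => esym (fusion_termE f g x))).
  apply: (faZ AA); apply: (fa_sum AA) => j; apply: (fa_sum AA) => k.
  apply: (faZ AA); apply: (faB AA); apply: (faM AA); exact: (fund_reg AA _ (e_lie _)).
- rewrite !fusion_termE mulrCA -mulrDr; congr (_ * _).
  rewrite mulr_sumr -big_split; apply: eq_bigr => j _ /=.
  rewrite mulr_sumr -big_split; apply: eq_bigr => k _ /=.
  rewrite (fund_lin AA Ra x (e_lie j)) // (fund_lin AA Rb x (e_lie k)) //; ring.
- by rewrite /fusion_term -mulrN opprB.
- rewrite !fusion_termE mulrCA -[_ * _ * g x]mulrA -mulrDr; congr (_ * _).
  rewrite mulr_sumr mulr_suml -big_split; apply: eq_bigr => j _ /=.
  rewrite mulr_sumr mulr_suml -big_split; apply: eq_bigr => k _ /=.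
  rewrite (fund_leib AA Ra x (e_lie j)) // (fund_leib AA Rb x (e_lie k)) //; ring.
Qed.

(** The hypothesis covers the two cases in use: maps commuting with both actions
    (g = 1), and the diagonal action of g.  Both actions must be conjugated by the
    same g, since eta is invariant only under simultaneous conjugation. *)
Lemma fusion_term_invariant (tau : V -> V) (g : G) : regular_map A A tau ->
  (forall p x, tau (a p x) = a (g * p * g^-1)%g (tau x)) ->
  (forall p x, tau (b p x) = b (g * p * g^-1)%g (tau x)) ->
  invariant_under A (fusion_term a b) tau.
Proof.
move=> At ta tb f h x Af Ah; rewrite /fusion_term.
have E c k : (forall p x, tau (c p x) = c (g * p * g^-1)%g (tau x)) ->
    orbital c (fun y => k (tau y)) x = fun p => orbital c k (tau x) (g * p * g^-1)%g.
  move=> tc; apply: functional_extensionality => p.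
  by rewrite /orbital tc !invgM invgK mulgA.
by rewrite !E // !(pairing_conj eta_inv) //;
  try exact: (reg_orbital AA Ra); exact: (reg_orbital AA Rb).
Qed.

Hypothesis ab : commuting a b.
Variable br : (V -> K) -> (V -> K) -> V -> K.
Hypotheses (B : bracket A br) (Ia : forall g, invariant_under A br (a g))
  (Ib : forall g, invariant_under A br (b g)).

Definition fused (f h : V -> K) (x : V) : K := br f h x - fusion_term a b f h x.

Let psi := fusion_term a b.
Let Bpsi : bracket A psi := fusion_term_bracket.

Lemma fused_bracket : bracket A fused.
Proof.
split=> [f g Af Ag|h x Ah c f g Af Ag|f g x Af Ag|f g h x Af Ag Ah]; rewrite /fused.
- by apply: (faB AA); [apply: (br_reg B) | apply: (br_reg Bpsi)].
- by rewrite (br_lin B) // (br_lin fusion_term_bracket) //; ring.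
- by rewrite (br_anti B) // (br_anti fusion_term_bracket) //; ring.
- by rewrite (br_leib B) // (br_leib fusion_term_bracket) //; ring.
Qed.

Lemma fused_invariant (tau : V -> V) (g : G) : regular_map A A tau ->
  (forall p x, tau (a p x) = a (g * p * g^-1)%g (tau x)) ->
  (forall p x, tau (b p x) = b (g * p * g^-1)%g (tau x)) ->
  invariant_under A br tau -> invariant_under A fused tau.
Proof.
move=> At ta tb It f h x Af Ah.
by rewrite /fused It // (fusion_term_invariant At ta tb).
Qed.

Hypothesis half_neq0 : (2%:R : K) != 0.

(** The mixed terms are a Schouten bracket of br with the bivector of the fusion
    term; that bivector is made of fundamental fields, which are derivations of
    br, so the mixed terms cancel. *)
Lemma jacobiator_fusedE f g h x : A f -> A g -> A h ->
  jacobiator fused f g h x = jacobiator br f g h x + jacobiator psi f g h x.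
Proof.
move=> Af Ag Ah.
have DDr c j k : regular_action A c -> A k -> A (fun y => e j (orbital c k y)).
  by move=> Rc Ak; apply: (fund_reg AA Rc (e_lie j)).
pose M u v w := br (psi u v) w x + psi (br u v) w x.
have fE u v w : A u -> A v -> A w ->
    fused (fused u v) w x = br (br u v) w x + psi (psi u v) w x - M u v w.
  move=> Au Av Aw; rewrite /fused.
  rewrite (lfB AA (br_lin B x Aw)); [|exact: (br_reg B)|exact: (br_reg Bpsi)].
  rewrite -/psi (lfB AA (br_lin Bpsi x Aw)); [|exact: (br_reg B)|exact: (br_reg Bpsi)].
  by rewrite /M; ring.
have ME u v w : A u -> A v -> A w -> M u v w = 2%:R^-1 * \sum_j \sum_k eta j k *
   (D1 j u x * br (D2 k v) w x + br (D1 j u) w x * D2 k v x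
    - D1 j v x * br (D2 k u) w x - br (D1 j v) w x * D2 k u x
    + (br (D1 j u) v x - br (D1 j v) u x) * D2 k w x
    - D1 j w x * (br (D2 k u) v x - br (D2 k v) u x)).
  move=> Au Av Aw; rewrite /M.
  have -> : psi u v = fun y => 2%:R^-1 * \sum_j \sum_k eta j k *
      (D1 j u y * D2 k v y - D1 j v y * D2 k u y).
    by apply: functional_extensionality => y; rewrite /psi fusion_termE.
  have AAm k k' i i' : A k -> A k' -> A (fun y => D1 i k y * D2 i' k' y).
    by move=> Ak Ak'; apply: (faM AA); apply: DDr.
  rewrite (lfZ AA (br_lin B x Aw)); last first.
    apply: (fa_sum AA) => j; apply: (fa_sum AA) => k; apply: (faZ AA).
    by apply: (faB AA); apply: AAm.
  rewrite /psi fusion_termE -mulrDr; congr (_ * _).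
  rewrite (lf_sum AA (br_lin B x Aw)) => [|j]; last first.
    by apply: (fa_sum AA) => k; apply: (faZ AA); apply: (faB AA); apply: AAm.
  rewrite -big_split; apply: eq_bigr => j _ /=.
  rewrite (lf_sum AA (br_lin B x Aw)) => [|k]; last first.
    by apply: (faZ AA); apply: (faB AA); apply: AAm.
  rewrite -big_split; apply: eq_bigr => k _ /=.
  rewrite (lfZ AA (br_lin B x Aw)); last by apply: (faB AA); apply: AAm.
  rewrite (lfB AA (br_lin B x Aw)); [|exact: AAm|exact: AAm].
  rewrite !(br_leib B) ?(fund_derivation AA x B Ra Ia (e_lie j))
    ?(fund_derivation AA x B Rb Ib (e_lie k)) //; try exact: DDr.
  rewrite (br_anti B x Au (DDr _ j v Ra Av)) (br_anti B x Au (DDr _ k v Rb Av)).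
  ring.
have cyc0 : M f g h + M g h f + M h f g = 0.
  rewrite !ME // -!mulrDr -!big_split big1 ?mulr0 // => j _ /=.
  rewrite -!big_split big1 // => k _ /=; ring.
rewrite /jacobiator !fE //.
by rewrite -[RHS]subr0 -cyc0; ring.
Qed.

Let D11 i j f := (D1 i (D1 j f)).
Let D22 i j f := (D2 i (D2 j f)).
Let D12 i j f := (D1 i (D2 j f)).

(** In the Jacobi expression of the fusion term the second derivatives combine to
    commutators; those mixing the two actions cancel, since the actions commute. *)
Lemma jacobiator_fusion_term f g h x : A f -> A g -> A h ->
  let C u v w := contract2 (fun j k l m =>
    lie_br (e j) (e l) (orbital a u x) * D2 m v x * D2 k w x +
    lie_br (e k) (e m) (orbital b u x) * D1 l v x * D1 j w x) in
  jacobiator psi f g h x = 4%:R^-1 * (C f g h + C g h f + C h f g).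
Proof.
move=> Af Ag Ah C.
have DDr c j k : regular_action A c -> A k -> A (fun y => e j (orbital c k y)).
  by move=> Rc Ak; apply: (fund_reg AA Rc (e_lie j)).
pose E u v w j k l m : K :=
  (D11 j l u x * D2 m v x + D1 l u x * D12 j m v x
   - D11 j l v x * D2 m u x - D1 l v x * D12 j m u x) * D2 k w x
  - D1 j w x * (D12 l k u x * D2 m v x + D1 l u x * D22 k m v x
   - D12 l k v x * D2 m u x - D1 l v x * D22 k m u x).
have psiE u v w : A u -> A v -> A w ->
    psi (psi u v) w x = 4%:R^-1 * contract2 (E u v w).
  move=> Au Av Aw; rewrite {1}/psi fusion_termE.
  have AAm k k' i i' : A k -> A k' -> A (fun y => D1 i k y * D2 i' k' y).
    by move=> Ak Ak'; apply: (faM AA); apply: DDr.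
  have DE (c : G -> V -> V) X : regular_action A c -> lie_element X -> X (orbital c (psi u v) x) =
      2%:R^-1 * \sum_l \sum_m eta l m *
     (D1 l u x * X (orbital c (D2 m v) x) + X (orbital c (D1 l u) x) * D2 m v x -
      (D1 l v x * X (orbital c (D2 m u) x) + X (orbital c (D1 l v) x) * D2 m u x)).
    move=> Rc LX; have FX := fund_lin AA Rc x LX.
    have -> : psi u v = fun y => 2%:R^-1 * \sum_l \sum_m eta l m *
      (D1 l u y * D2 m v y - D1 l v y * D2 m u y).
      by apply: functional_extensionality => y; rewrite /psi fusion_termE.
    rewrite (lfZ AA FX); last first.
      apply: (fa_sum AA) => l; apply: (fa_sum AA) => m; apply: (faZ AA).
      by apply: (faB AA); apply: AAm.
    congr (_ * _); rewrite (lf_sum AA FX) => [|l]; last first.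
      by apply: (fa_sum AA) => m; apply: (faZ AA); apply: (faB AA); apply: AAm.
    apply: eq_bigr => l _; rewrite (lf_sum AA FX) => [|m]; last first.
      by apply: (faZ AA); apply: (faB AA); apply: AAm.
    apply: eq_bigr => m _.
    rewrite (lfZ AA FX); last by apply: (faB AA); apply: AAm.
    rewrite (lfB AA FX); [|exact: AAm|exact: AAm].
    by rewrite !(fund_leib AA Rc) //; apply: DDr.
  have -> : 4%:R^-1 = 2%:R^-1 * 2%:R^-1 :> K by rewrite -invfM -natrM.
  rewrite -mulrA; congr (_ * _).
  rewrite /contract2 mulr_sumr; apply: eq_bigr => j _.
  rewrite mulr_sumr; apply: eq_bigr => k _.
  rewrite (DE a (e j)) // (DE b (e k)) //.
  have factor c r S P Q T : c * (r * S * P - Q * (r * T)) = r * (c * (S * P - Q * T)) :> K.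
    by ring.
  rewrite factor; congr (_ * _).
  rewrite mulr_suml mulr_sumr -sumrB mulr_sumr; apply: eq_bigr => l _.
  rewrite mulr_suml mulr_sumr -sumrB mulr_sumr; apply: eq_bigr => m _.
  rewrite /E /D11 /D12 /D22.
  rewrite -(fund_comm x Ra Rb ab (e_lie l) (e_lie k) Au).
  rewrite -(fund_comm x Ra Rb ab (e_lie l) (e_lie k) Av).
  by ring.
rewrite /jacobiator !psiE // -!mulrDr; congr (_ * _).
rewrite /C -!contract2D.
(* The two sides agree only after exchanging the two copies of eta, so both are
   replaced with their symmetrisations. *)
pose sym Z := 2%:R^-1 * contract2 (fun j k l m => Z j k l m + Z l m j k).
have symE Z : contract2 Z = sym Z.
  rewrite /sym contract2D -(contract2_swap eta Z).
  by apply: (mulfI half_neq0); rewrite mulVKf // mulr_natl mulr2n.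
rewrite [LHS]symE [RHS]symE; congr (_ * _).
apply: contract2_eq => j k l m.
rewrite -!(fund_bracket Ra) // -!(fund_bracket Rb) //.
rewrite /E /D11 /D12 /D22; ring.
Qed.

(** The 3-tensor of the diagonal action expands into eight terms; cyclic
    invariance brings the six mixed ones to the shape in which they occur in
    [jacobiator_fusion_term]. *)
Lemma cartan_diagonal f g h x : A f -> A g -> A h ->
  let c := diagonal a b in
  cartan (orbital c f x) (orbital c g x) (orbital c h x) =
  cartan (orbital a f x) (orbital a g x) (orbital a h x) +
  cartan (orbital b f x) (orbital b g x) (orbital b h x) +
  (cartan (orbital a f x) (orbital b g x) (orbital b h x) +
   cartan (orbital b f x) (orbital a g x) (orbital a h x)) +
  (cartan (orbital a g x) (orbital b h x) (orbital b f x) +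
   cartan (orbital b g x) (orbital a h x) (orbital a f x)) +
  (cartan (orbital a h x) (orbital b f x) (orbital b g x) +
   cartan (orbital b h x) (orbital a f x) (orbital a g x)).
Proof.
move=> Af Ag Ah c.
have cyc o o' o'' u v w : regular_action A o -> regular_action A o' -> A u -> A v ->
    cartan (orbital o u x) (orbital o' v x) (orbital o'' w x) =
    cartan (orbital o' v x) (orbital o'' w x) (orbital o u x).
  by move=> Ro Ro' Au Av; apply: (cartan_cyc e_lie eta_sym eta_inv);
     [apply: (reg_orbital AA Ro) | apply: (reg_orbital AA Ro')].
rewrite -(cyc b a b f g h) // -(cyc a b a f g h) //.
rewrite (cyc a b b h f g) // (cyc b a a h f g) //.
rewrite /cartan -!contract2D; apply: contract2_eq => j k l m.
rewrite !(fund_diagonal x Ra Rb) //; last exact: lie_br_lie.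
ring.
Qed.

(** The remainder R makes it possible to fuse two of several commuting actions:
    it holds the 3-tensors of the other ones. *)
Lemma fused_jacobi (R : (V -> K) -> (V -> K) -> (V -> K) -> V -> K) :
  (forall f g h x, A f -> A g -> A h -> jacobiator br f g h x = - 4%:R^-1 *
     (cartan (orbital a f x) (orbital a g x) (orbital a h x) +
      cartan (orbital b f x) (orbital b g x) (orbital b h x) + R f g h x)) ->
  forall f g h x, A f -> A g -> A h -> jacobiator fused f g h x = - 4%:R^-1 *
    (cartan (orbital (diagonal a b) f x) (orbital (diagonal a b) g x)
       (orbital (diagonal a b) h x) + R f g h x).
Proof.
move=> Jbr f g h x Af Ag Ah; rewrite jacobiator_fusedE // Jbr //.
rewrite jacobiator_fusion_term // cartan_diagonal //.
set C := (X in 4%:R^-1 * X).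
have CE u v w : contract2 (fun j k l m =>
    lie_br (e j) (e l) (orbital a u x) * D2 m v x * D2 k w x +
    lie_br (e k) (e m) (orbital b u x) * D1 l v x * D1 j w x) =
  - (cartan (orbital a u x) (orbital b v x) (orbital b w x) +
     cartan (orbital b u x) (orbital a v x) (orbital a w x)).
  rewrite contract2D opprD -!cartan_anti; congr (_ + _).
    by apply: contract2_eq => j k l m; ring.
  rewrite contract2_flip // contract2_flip2 //.
  by apply: contract2_eq => j k l m; ring.
by rewrite /C !CE; ring.
Qed.

Lemma pairing_diagonal f x w : A f -> pairing (orbital (diagonal a b) f x) w =
  pairing (orbital a f x) w + pairing (orbital b f x) w.
Proof.
move=> Af; rewrite /pairing -big_split; apply: eq_bigr => j _; rewrite -big_split.
by apply: eq_bigr => k _; rewrite (fund_diagonal x Ra Rb) //=; ring.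
Qed.

(** Up to sign, the Hamiltonian field of u o Phi at x is the fundamental field of
    the image under eta of the mean of the left and right derivatives of u at
    Phi(x). *)
Definition moment (c : G -> V -> V) (B' : (V -> K) -> (V -> K) -> V -> K)
    (Phi : V -> G) : Prop :=
  forall f u x, A f -> reg u -> B' f (fun y => u (Phi y)) x =
    - 2%:R^-1 * (pairing (orbital c f x) (fun p => u (Phi x * p)%g) +
                 pairing (orbital c f x) (fun p => u (p * Phi x)%g)).

(** Let l, r, m be the derivatives of u at Phi Psi in the direction placed after,
    before and between the two factors.  The moment conditions give the pairing of
    the first action with r + m and of the second one with m + l; the fusion term
    replaces m by l, respectively by r. *)
Lemma fused_moment (Phi Psi : V -> G) :
  regular_map A reg Phi -> regular_map A reg Psi ->
  (forall g x, Phi (a g x) = (g * Phi x * g^-1)%g) ->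
  (forall g x, Phi (b g x) = Phi x) ->
  (forall g x, Psi (b g x) = (g * Psi x * g^-1)%g) ->
  (forall g x, Psi (a g x) = Psi x) ->
  moment a br Phi -> moment b br Psi ->
  moment (diagonal a b) fused (fun x => (Phi x * Psi x)%g).
Proof.
move=> rPhi rPsi Pa Pb Qb Qa mP mQ f u x Af ru.
have GG2 := prod_fun_alg GG GG.
(* Leibniz rule for functions of (Phi, Psi). *)
have split2 F : prod_reg reg reg F -> br f (fun y => F (Phi y, Psi y)) x =
    br f (fun y => F (Phi y, Psi x)) x + br f (fun y => F (Phi x, Psi y)) x.
  have L := br_linr AA B x Af.
  have pb k : prod_reg reg reg k -> A (fun y => k (Phi y, Psi y)).
    exact: (mor_pair AA rPhi rPsi).
  have pl k : prod_reg reg reg k -> A (fun y => k (Phi y, Psi x)).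
    exact: (mor_pair AA rPhi (mor_cst AA _)).
  have pr k : prod_reg reg reg k -> A (fun y => k (Phi x, Psi y)).
    exact: (mor_pair AA (mor_cst AA _) rPsi).
  elim/(prod_reg_ind GG GG) => [k k' rk rk'|k k' Pk Pk' IH IH'] /=.
    have [Ak Ak'] := (rPhi _ rk, rPsi _ rk').
    by rewrite (br_leibr AA B) // (lfZ AA L) // (lfZr AA L) // addrC.
  rewrite !(lfD L) ?IH ?IH'; try solve [exact: pb | exact: pl | exact: pr].
  ring.
have rmid : reg (fun p => u (Phi x * p * Psi x)%g) by apply: reg_mull (reg_mulr _ ru).
have rl : reg (fun p => u (Phi x * Psi x * p)%g) by apply: reg_mull.
have rr : reg (fun p => u (p * (Phi x * Psi x))%g) by apply: reg_mulr.
have rO y (o : G -> V -> V) : regular_action A o -> reg (orbital o f y).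
  by move=> Ro; apply: (reg_orbital AA Ro).
rewrite /fused (split2 (fun q => u (q.1 * q.2)%g)) /=; last exact: (mor_mul GG2 mor2l mor2r).
rewrite (mP f (fun v => u (v * Psi x)%g) x Af (reg_mulr _ ru)).
rewrite (mQ f (fun v => u (Phi x * v)%g) x Af (reg_mull _ ru)).
rewrite !pairing_diagonal // /fusion_term.
have oa w : pairing (orbital a (fun y => u (Phi y * Psi y)%g) x) w =
    - pairing (fun p => u (p * (Phi x * Psi x))%g) w +
      pairing (fun p => u (Phi x * p * Psi x)%g) w.
  rewrite /pairing -sumrN -big_split; apply: eq_bigr => j _ /=.
  rewrite -sumrN -big_split; apply: eq_bigr => k _ /=.
  have -> : e j (orbital a (fun y => u (Phi y * Psi y)%g) x) =
    - e j (fun p => u (p * (Phi x * Psi x))%g) + e j (fun p => u (Phi x * p * Psi x)%g).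
    have PF : prod_reg reg reg (fun q => u (q.1^-1 * Phi x * q.2 * Psi x)%g).
      apply: (mor_mul GG2 _ (mor_cst GG2 _) ru).
      exact: (mor_mul GG2 (mor_mul GG2 (mor_inv mor2l) (mor_cst GG2 _)) mor2r).
    rewrite -(lie_inv (e_lie j) rr).
    transitivity (e j (fun p => u (p^-1 * Phi x * p * Psi x)%g)).
      congr (e j); apply: functional_extensionality => p.
      by rewrite /orbital Pa Qa invgK.
    rewrite (lie_diag (e_lie j) PF) /=; congr (e j _ + e j _);
      by apply: functional_extensionality => p; rewrite ?invg1 ?mulg1 ?mul1g ?mulgA.
  ring.
have ob w : pairing w (orbital b (fun y => u (Phi y * Psi y)%g) x) =
    - pairing w (fun p => u (Phi x * p * Psi x)%g) +
      pairing w (fun p => u (Phi x * Psi x * p)%g).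
  rewrite /pairing -sumrN -big_split; apply: eq_bigr => j _ /=.
  rewrite -sumrN -big_split; apply: eq_bigr => k _ /=.
  have -> : e k (orbital b (fun y => u (Phi y * Psi y)%g) x) =
    - e k (fun p => u (Phi x * p * Psi x)%g) + e k (fun p => u (Phi x * Psi x * p)%g).
    have PF : prod_reg reg reg (fun q => u (Phi x * q.1^-1 * Psi x * q.2)%g).
      apply: (mor_mul GG2 _ mor2r ru).
      apply: (mor_mul GG2 _ (mor_cst GG2 _)).
      exact: (mor_mul GG2 (mor_cst GG2 _) (mor_inv mor2l)).
    rewrite -(lie_inv (e_lie k) rmid).
    transitivity (e k (fun p => u (Phi x * p^-1 * Psi x * p)%g)).
      congr (e k); apply: functional_extensionality => p.
      by rewrite /orbital Pb Qb invgK !mulgA.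
    rewrite (lie_diag (e_lie k) PF) /=; congr (e k _ + e k _);
      by apply: functional_extensionality => p; rewrite ?invg1 ?mulg1 ?mul1g ?mulgA.
  ring.
rewrite oa ob.
rewrite (pairingC _ eta_sym (fun p => u (p * (Phi x * Psi x))%g)).
rewrite (pairingC _ eta_sym (fun p => u (Phi x * p * Psi x)%g) (orbital b f x)).
have -> : (fun p => u (p * Phi x * Psi x)%g) = (fun p => u (p * (Phi x * Psi x))%g).
  by apply: functional_extensionality => p; rewrite mulgA.
have -> : (fun p => u (Phi x * (Psi x * p))%g) = (fun p => u (Phi x * Psi x * p)%g).
  by apply: functional_extensionality => p; rewrite mulgA.
have -> : (fun p => u (Phi x * (p * Psi x))%g) = (fun p => u (Phi x * p * Psi x)%g).
  by apply: functional_extensionality => p; rewrite mulgA.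
apply: (mulfI half_neq0).
rewrite mulrBr mulrDr !mulNr !mulrN !mulVKf //; ring.
Qed.

End Term.
End Fusion.

(** * Hamiltonian quasi-Poisson spaces *)

Section Hamiltonian.
Variables (K : closedFieldType) (G : alg_group K).
Variables (d : nat) (e : 'I_d -> (G -> K) -> K) (eta : 'M[K]_d).
Hypotheses (e_lie : forall j, lie_element (e j)) (eta_sym : eta^T = eta).
Hypothesis eta_inv : Ad_invariant e eta.
Hypothesis half_neq0 : (2%:R : K) != 0.
Local Notation reg := (@ag_reg K G).
Local Notation pairing := (pairing e eta).
Local Notation cartan := (cartan e eta).
Local Notation moment := (moment e eta).
Local Notation fused := (fused e eta).
Let GG := ag_fun_alg G.

Definition cartan_along V (a : G -> V -> V) (f g h : V -> K) (x : V) : K :=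
  cartan (orbital a f x) (orbital a g x) (orbital a h x).

(** Hamiltonian quasi-Poisson spaces, in the sense of Alekseev,
    Kosmann-Schwarzbach and Meinrenken, with a tensor eta that may degenerate. *)
Record hamiltonian V (A : (V -> K) -> Prop) (a : G -> V -> V)
    (br : (V -> K) -> (V -> K) -> V -> K) (Phi : V -> G) : Prop := Hamiltonian {
  ham_affine : is_affine_variety A;
  ham_action : regular_action A a;
  ham_bracket : bracket A br;
  ham_inv : forall g, invariant_under A br (a g);
  ham_mom : regular_map A reg Phi;
  ham_equiv : forall g x, Phi (a g x) = (g * Phi x * g^-1)%g;
  ham_moment : moment A a br Phi;
  ham_jacobi : forall f g h x, A f -> A g -> A h ->
    jacobiator br f g h x = - 4%:R^-1 * cartan_along a f g h x
}.

(** The same for the group G x G, whose action is given as two commuting ones. *)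
Record hamiltonian2 V (A : (V -> K) -> Prop) (a b : G -> V -> V)
    (br : (V -> K) -> (V -> K) -> V -> K) (Phi Psi : V -> G) : Prop := Hamiltonian2 {
  ham2_affine : is_affine_variety A;
  ham2_action1 : regular_action A a;
  ham2_action2 : regular_action A b;
  ham2_comm : commuting a b;
  ham2_bracket : bracket A br;
  ham2_inv1 : forall g, invariant_under A br (a g);
  ham2_inv2 : forall g, invariant_under A br (b g);
  ham2_mom1 : regular_map A reg Phi;
  ham2_mom2 : regular_map A reg Psi;
  ham2_equiv11 : forall g x, Phi (a g x) = (g * Phi x * g^-1)%g;
  ham2_equiv12 : forall g x, Phi (b g x) = Phi x;
  ham2_equiv21 : forall g x, Psi (a g x) = Psi x;
  ham2_equiv22 : forall g x, Psi (b g x) = (g * Psi x * g^-1)%g;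
  ham2_moment1 : moment A a br Phi;
  ham2_moment2 : moment A b br Psi;
  ham2_jacobi : forall f g h x, A f -> A g -> A h ->
    jacobiator br f g h x =
      - 4%:R^-1 * (cartan_along a f g h x + cartan_along b f g h x)
}.

(** Two brackets may differ on functions that are not regular. *)
Lemma hamiltonian_ext V (A : (V -> K) -> Prop) a br br' Phi :
  (forall f h, A f -> A h -> br' f h = br f h) ->
  hamiltonian A a br Phi -> hamiltonian A a br' Phi.
Proof.
move=> E H; have AA := affine_fun_alg (ham_affine H); have B := ham_bracket H.
have AM := act_map AA (ham_action H).
split.
- exact: ham_affine H.
- exact: ham_action H.
- split=> [f g Af Ag|h x Ah c f g Af Ag|f g x Af Ag|f g h x Af Ag Ah].
  + by rewrite E //; apply: (br_reg B).
  + rewrite !E //; first exact: (br_lin B).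
    by apply: (faD AA) => //; apply: (faZ AA).
  + by rewrite !E //; apply: (br_anti B).
  + by rewrite !E //; [apply: (br_leib B) | apply: (faM AA)].
- by move=> g f h x Af Ah; rewrite !E //; [apply: (ham_inv H) | apply: AM | apply: AM].
- exact: ham_mom H.
- exact: ham_equiv H.
- by move=> f u x Af ru; rewrite E //; [apply: (ham_moment H) | apply: (ham_mom H)].
- move=> f g h x Af Ag Ah; rewrite -(ham_jacobi H) // /jacobiator.
  by rewrite !(E f g, E g h, E h f) // !E //; apply: (br_reg B).
Qed.

Lemma invariant_under_comp V (A : (V -> K) -> Prop) br (s t : V -> V) :
  regular_map A A s -> invariant_under A br s -> invariant_under A br t ->
  invariant_under A br (fun x => s (t x)).
Proof.
move=> As Is It f h x Af Ah.
by rewrite (It (fun y => f (s y)) (fun y => h (s y))) ?Is //; apply: As.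
Qed.

Lemma conj_act V (A : (V -> K) -> Prop) (a : G -> V -> V) : regular_action A a ->
  forall g p x, a g (a p x) = a (g * p * g^-1)%g (a g x).
Proof. by move=> Ra g p x; rewrite -!(actM Ra) mulgVK. Qed.

Lemma fuse_hamiltonian V (A : (V -> K) -> Prop) (a b : G -> V -> V) br Phi Psi :
  hamiltonian2 A a b br Phi Psi ->
  hamiltonian A (diagonal a b) (fused a b br) (fun x => (Phi x * Psi x)%g).
Proof.
move=> H; have AA := affine_fun_alg (ham2_affine H).
have [[[Ra Rb] ab] B] := (ham2_action1 H, ham2_action2 H, ham2_comm H, ham2_bracket H).
have Rd := diagonal_action AA Ra Rb ab.
split=> //.
- exact: ham2_affine H.
- exact: fused_bracket.
- move=> g; apply: (fused_invariant eta_inv AA Ra Rb (g := g)).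
  + exact: (act_map AA Rd).
  + by move=> p x; rewrite /diagonal -ab (conj_act Ra).
  + by move=> p x; rewrite /diagonal (conj_act Rb) ab.
  + exact: (invariant_under_comp (act_map AA Ra g) (ham2_inv1 H g) (ham2_inv2 H g)).
- exact: (mor_mul AA (ham2_mom1 H) (ham2_mom2 H)).
- move=> g x; rewrite /diagonal (ham2_equiv11 H) (ham2_equiv12 H).
  by rewrite (ham2_equiv21 H) (ham2_equiv22 H) !mulgA mulgVK.
- apply: fused_moment => //.
  + exact: ham2_mom1 H.
  + exact: ham2_mom2 H.
  + exact: ham2_equiv11 H.
  + exact: ham2_equiv12 H.
  + exact: ham2_equiv22 H.
  + exact: ham2_equiv21 H.
  + exact: ham2_moment1 H.
  + exact: ham2_moment2 H.
- move=> f g h x Af Ag Ah.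
  rewrite (fused_jacobi e_lie eta_sym eta_inv AA Ra Rb ab B (ham2_inv1 H) (ham2_inv2 H)
    half_neq0 (R := fun _ _ _ _ => 0)) ?addr0 // => f' g' h' x' Af' Ag' Ah'.
  by rewrite addr0 (ham2_jacobi H).
Qed.

(** * Products of Hamiltonian spaces *)

Section ActionsOnProducts.
Variables (V W : Type) (A : (V -> K) -> Prop) (B : (W -> K) -> Prop).
Hypotheses (AA : fun_alg A) (BB : fun_alg B).
Let CC := prod_fun_alg AA BB.
Let GC := prod_fun_alg GG CC.

Lemma action_fst (a : G -> V -> V) : regular_action A a ->
  regular_action (prod_reg A B) (fun g q => (a g q.1, q.2)).
Proof.
move=> Ra; split=> [[x y]|g h [x y]|] /=; rewrite ?(act1 Ra) ?(actM Ra) //.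
apply: (mor_pair GC); last exact: (mor_snd GG (mor_snd AA (@mor_id _ _ B))).
exact: (mor_act GC Ra (mor_fst CC mor1) (mor_snd GG (mor_fst BB (@mor_id _ _ A)))).
Qed.

Lemma action_snd (b : G -> W -> W) : regular_action B b ->
  regular_action (prod_reg A B) (fun g q => (q.1, b g q.2)).
Proof.
move=> Rb; split=> [[x y]|g h [x y]|] /=; rewrite ?(act1 Rb) ?(actM Rb) //.
apply: (mor_pair GC); first exact: (mor_snd GG (mor_fst BB (@mor_id _ _ A))).
exact: (mor_act GC Rb (mor_fst CC mor1) (mor_snd GG (mor_snd AA (@mor_id _ _ B)))).
Qed.

End ActionsOnProducts.

Section ProductSpace.
Variables (V W : Type) (A : (V -> K) -> Prop) (B : (W -> K) -> Prop).
Variables (a : G -> V -> V) (b : G -> W -> W).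
Variables (br1 : (V -> K) -> (V -> K) -> V -> K) (br2 : (W -> K) -> (W -> K) -> W -> K).
Variables (Phi : V -> G) (Psi : W -> G).
Hypotheses (H1 : hamiltonian A a br1 Phi) (H2 : hamiltonian B b br2 Psi).

Let AA := affine_fun_alg (ham_affine H1).
Let BB := affine_fun_alg (ham_affine H2).
Let B1 := ham_bracket H1.
Let B2 := ham_bracket H2.
Let C := prod_reg A B.
Let CC : fun_alg C := prod_fun_alg AA BB.
Let sl f y : C f -> A (fun x => f (x, y)) := prod_reg_slicel AA BB y.
Let sr f x : C f -> B (fun y => f (x, y)) := prod_reg_slicer AA BB x.

Let brl (f h : V * W -> K) (q : V * W) : K :=
  br1 (fun x => f (x, q.2)) (fun x => h (x, q.2)) q.1.
Let brr (f h : V * W -> K) (q : V * W) : K :=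
  br2 (fun y => f (q.1, y)) (fun y => h (q.1, y)) q.2.

Definition prod_bracket (f h : V * W -> K) (q : V * W) : K := brl f h q + brr f h q.

Let tensor (u : V -> K) (v : W -> K) : V * W -> K := fun q => u q.1 * v q.2.

Let Ct u v : A u -> B v -> C (tensor u v). Proof. exact: prod_reg_tensor. Qed.

Let brl_tensor u v u' v' : A u -> A u' ->
  brl (tensor u v) (tensor u' v') = tensor (br1 u u') (fun y => v y * v' y).
Proof.
move=> Au Au'; apply: functional_extensionality => -[x y]; rewrite /brl /tensor /=.
rewrite (lfZr AA (br_lin B1 x (_ : A (fun x => u' x * v' y)))) //; last first.
  by apply: (faM AA) => //; apply: fa_cst.
by rewrite (lfZr AA (br_linr AA B1 x Au)) //; ring.
Qed.

Let brr_tensor u v u' v' : B v -> B v' ->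
  brr (tensor u v) (tensor u' v') = tensor (fun x => u x * u' x) (br2 v v').
Proof.
move=> Bv Bv'; apply: functional_extensionality => -[x y]; rewrite /brr /tensor /=.
rewrite (lfZ BB (br_lin B2 y (_ : B (fun y => u' x * v' y)))) //; last exact: (faZ BB).
by rewrite (lfZ BB (br_linr BB B2 y Bv)) //; ring.
Qed.

Let brl_lin h q : C h -> lin_form C (fun f => brl f h q).
Proof. by move=> Ch c f g Cf Cg; apply: (br_lin B1); apply: sl. Qed.

Let brr_lin h q : C h -> lin_form C (fun f => brr f h q).
Proof. by move=> Ch c f g Cf Cg; apply: (br_lin B2); apply: sr. Qed.

Let brl_anti f h q : C f -> C h -> brl f h q = - brl h f q.
Proof. by move=> Cf Ch; apply: (br_anti B1); apply: sl. Qed.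

Let brr_anti f h q : C f -> C h -> brr f h q = - brr h f q.
Proof. by move=> Cf Ch; apply: (br_anti B2); apply: sr. Qed.

Let bracket_of_tensors br :
  (forall h q, C h -> lin_form C (fun f => br f h q)) ->
  (forall f h q, C f -> C h -> br f h q = - br h f q) ->
  (forall u v u' v', A u -> B v -> A u' -> B v' -> C (br (tensor u v) (tensor u' v'))) ->
  forall f h, C f -> C h -> C (br f h).
Proof.
move=> bl ba bt f h Cf Ch.
elim/(prod_reg_ind AA BB): h / Ch => [u' v' Au' Bv'|h h' Ch Ch' IH IH'].
  elim/(prod_reg_ind AA BB): f / Cf => [u v Au Bv|f f' Cf Cf' IH IH']; first exact: bt.
  apply: fa_ext (faD CC IH IH') _ => q.
  by rewrite -(lfD (bl _ q (Ct Au' Bv'))).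
apply: fa_ext (faD CC IH IH') _ => q.
rewrite [RHS]ba //; last exact: (faD CC).
by rewrite (lfD (bl _ q Cf)) // opprD -!ba.
Qed.

Let brl_bracket : bracket C brl.
Proof.
split=> //.
- apply: bracket_of_tensors => // u v u' v' Au Bv Au' Bv'; rewrite brl_tensor //.
  by apply: Ct; [apply: (br_reg B1) | apply: (faM BB)].
- by move=> f g h q Cf Cg Ch; rewrite /brl (br_leib B1) -?surjective_pairing //; apply: sl.
Qed.

Let brr_bracket : bracket C brr.
Proof.
split=> //.
- apply: bracket_of_tensors => // u v u' v' Au Bv Au' Bv'; rewrite brr_tensor //.
  by apply: Ct; [apply: (faM AA) | apply: (br_reg B2)].
- by move=> f g h q Cf Cg Ch; rewrite /brr (br_leib B2) -?surjective_pairing //; apply: sr.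
Qed.

Lemma prod_bracketP : bracket C prod_bracket.
Proof.
split=> [f g Cf Cg|h x Ch c f g Cf Cg|f g x Cf Cg|f g h x Cf Cg Ch]; rewrite /prod_bracket.
- by apply: (faD CC); [apply: (br_reg brl_bracket) | apply: (br_reg brr_bracket)].
- by rewrite (br_lin brl_bracket) // (br_lin brr_bracket) //; ring.
- by rewrite (br_anti brl_bracket) // (br_anti brr_bracket) //; ring.
- by rewrite (br_leib brl_bracket) // (br_leib brr_bracket) //; ring.
Qed.

(** The part of the Jacobi expression that mixes the two factors. *)
Let cross f g h q := brl (brr f g) h q + brr (brl f g) h q.

Let cross_tensor u v u' v' u'' v'' x y :
  A u -> B v -> A u' -> B v' -> A u'' -> B v'' ->
  cross (tensor u v) (tensor u' v') (tensor u'' v'') (x, y) =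
    (u x * br1 u' u'' x + br1 u u'' x * u' x) * (br2 v v' y * v'' y) +
    (br1 u u' x * u'' x) * (v y * br2 v' v'' y + br2 v v'' y * v' y).
Proof.
move=> Au Bv Au' Bv' Au'' Bv''.
have Auu : A (fun x => u x * u' x) by apply: (faM AA).
have Bvv : B (fun y => v y * v' y) by apply: (faM BB).
rewrite /cross brr_tensor // !brl_tensor // brr_tensor // /tensor /=.
by rewrite (br_leib B1) // (br_leib B2).
Qed.

(** By additivity it is enough to check tensors, where only the antisymmetry of
    the two brackets is left to use. *)
Let cross_jacobi f g h q : C f -> C g -> C h ->
  cross f g h q + cross g h f q + cross h f g q = 0.
Proof.
have Cbl k k' : C k -> C k' -> C (brl k k') := br_reg brl_bracket (g := k').
have Cbr k k' : C k -> C k' -> C (brr k k') := br_reg brr_bracket (g := k').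
have add k k' g' h' : C k -> C k' -> C g' -> C h' ->
    (cross (fun z => k z + k' z) g' h' q + cross g' h' (fun z => k z + k' z) q +
     cross h' (fun z => k z + k' z) g' q) =
    (cross k g' h' q + cross g' h' k q + cross h' k g' q) +
    (cross k' g' h' q + cross g' h' k' q + cross h' k' g' q).
  move=> Ck Ck' Cg' Ch'; have Ckk : C (fun z => k z + k' z) := faD CC Ck Ck'.
  have El w : C w -> brl (fun z => k z + k' z) w = fun z => brl k w z + brl k' w z.
    by move=> Cw; apply: functional_extensionality => z; rewrite (lfD (brl_lin z Cw)).
  have Er w : C w -> brr (fun z => k z + k' z) w = fun z => brr k w z + brr k' w z.
    by move=> Cw; apply: functional_extensionality => z; rewrite (lfD (brr_lin z Cw)).
  have El' w : C w -> brl w (fun z => k z + k' z) = fun z => brl w k z + brl w k' z.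
    move=> Cw; apply: functional_extensionality => z.
    by rewrite (lfD (br_linr CC brl_bracket z Cw)).
  have Er' w : C w -> brr w (fun z => k z + k' z) = fun z => brr w k z + brr w k' z.
    move=> Cw; apply: functional_extensionality => z.
    by rewrite (lfD (br_linr CC brr_bracket z Cw)).
  rewrite /cross (El g') // (Er g') // (El' h') // (Er' h') //.
  rewrite (El' _ (Cbr _ _ Cg' Ch')) (Er' _ (Cbl _ _ Cg' Ch')).
  rewrite (lfD (brl_lin q Ch')); [|exact: Cbr|exact: Cbr].
  rewrite (lfD (brr_lin q Ch')); [|exact: Cbl|exact: Cbl].
  rewrite (lfD (brl_lin q Cg')); [|exact: Cbr|exact: Cbr].
  rewrite (lfD (brr_lin q Cg')); [|exact: Cbl|exact: Cbl].
  ring.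
have cyc k k' k'' : cross k k' k'' q + cross k' k'' k q + cross k'' k k' q =
    cross k' k'' k q + cross k'' k k' q + cross k k' k'' q by ring.
move=> Cf Cg Ch; elim/(prod_reg_ind AA BB): f / Cf => [u v Au Bv|k k' Ck Ck' IH IH'].
  rewrite cyc; elim/(prod_reg_ind AA BB): g / Cg => [u' v' Au' Bv'|k k' Ck Ck' IH IH'].
    rewrite cyc; elim/(prod_reg_ind AA BB): h / Ch => [u'' v'' Au'' Bv''|k k' Ck Ck' IH IH'].
      case: q {add cyc} => x y; rewrite -!/(tensor _ _) !cross_tensor //.
      rewrite (br_anti B1 x Au'' Au) (br_anti B1 x Au'' Au') (br_anti B1 x Au' Au).
      rewrite (br_anti B2 y Bv'' Bv) (br_anti B2 y Bv'' Bv') (br_anti B2 y Bv' Bv).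
      ring.
    by rewrite add ?IH ?IH' ?addr0 //; apply: Ct.
  by rewrite add ?IH ?IH' ?addr0 //; apply: Ct.
by rewrite add ?IH ?IH' ?addr0.
Qed.

Lemma prod_hamiltonian : hamiltonian2 C
  (fun g q => (a g q.1, q.2)) (fun g q => (q.1, b g q.2)) prod_bracket
  (fun q => Phi q.1) (fun q => Psi q.2).
Proof.
have [Ra Rb] := (ham_action H1, ham_action H2).
split.
- exact: prod_affine (ham_affine H1) (ham_affine H2).
- exact: (action_fst AA BB Ra).
- exact: (action_snd AA BB Rb).
- by move=> p q [x y].
- exact: prod_bracketP.
- move=> g f h [x y] Cf Ch; rewrite /prod_bracket /brl /brr /=; congr (_ + _).
  exact: (ham_inv H1 g x (sl y Cf) (sl y Ch)).
- move=> g f h [x y] Cf Ch; rewrite /prod_bracket /brl /brr /=; congr (_ + _).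
  exact: (ham_inv H2 g y (sr x Cf) (sr x Ch)).
- exact: (mor_fst BB (ham_mom H1)).
- exact: (mor_snd AA (ham_mom H2)).
- by move=> g q; apply: (ham_equiv H1).
- by [].
- by [].
- by move=> g q; apply: (ham_equiv H2).
- move=> f u [x y] Cf ru; rewrite /prod_bracket /brl /brr /=.
  rewrite (br_cstr BB B2 _ _ (sr x Cf)) addr0.
  exact: (ham_moment H1 x (sl y Cf) ru).
- move=> f u [x y] Cf ru; rewrite /prod_bracket /brl /brr /=.
  rewrite (br_cstr AA B1 _ _ (sl y Cf)) add0r.
  exact: (ham_moment H2 y (sr x Cf) ru).
- move=> f g h [x y] Cf Cg Ch.
  have E k k' k'' z : C k -> C k' -> C k'' -> prod_bracket (prod_bracket k k') k'' z =
      brl (brl k k') k'' z + brr (brr k k') k'' z + cross k k' k'' z.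
    move=> Ck Ck' Ck''; rewrite {1}/prod_bracket.
    have [Cl Cr] := (br_reg brl_bracket Ck Ck', br_reg brr_bracket Ck Ck').
    rewrite (lfD (brl_lin z Ck'') Cl Cr) (lfD (brr_lin z Ck'') Cl Cr) /cross; ring.
  have J1 := ham_jacobi H1 x (sl y Cf) (sl y Cg) (sl y Ch).
  have J2 := ham_jacobi H2 y (sr x Cf) (sr x Cg) (sr x Ch).
  transitivity (jacobiator br1 (fun x => f (x, y)) (fun x => g (x, y)) (fun x => h (x, y)) x +
    jacobiator br2 (fun y => f (x, y)) (fun y => g (x, y)) (fun y => h (x, y)) y).
    rewrite /jacobiator !E // -[RHS]addr0 -(cross_jacobi (x, y) Cf Cg Ch).
    rewrite /brl /brr /=; ring.
  by rewrite J1 J2 mulrDr.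
Qed.

End ProductSpace.
End Hamiltonian.

(** * The group, its conjugacy classes and the double *)

Section BaseSpaces.
Variables (K : closedFieldType) (G : alg_group K).
Variables (d : nat) (e : 'I_d -> (G -> K) -> K) (eta : 'M[K]_d).
Hypotheses (e_lie : forall j, lie_element (e j)) (eta_sym : eta^T = eta).
Hypothesis eta_inv : Ad_invariant e eta.
Hypothesis half_neq0 : (2%:R : K) != 0.
Local Notation reg := (@ag_reg K G).
Local Notation pairing := (pairing e eta).
Local Notation cartan := (cartan e eta).
Local Notation moment := (moment e eta).
Local Notation fused := (fused e eta).
Local Notation hamiltonian := (hamiltonian e eta).
Local Notation hamiltonian2 := (hamiltonian2 e eta).
Local Notation cartan_along := (cartan_along e eta).
Let GG := ag_fun_alg G.
Let GG2 := prod_fun_alg GG GG.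

Lemma zero_bracket V (A : (V -> K) -> Prop) : fun_alg A -> bracket A (fun _ _ _ => 0).
Proof.
move=> AA; split=> [f g _ _|h x _ c f g _ _|f g x _ _|f g h x _ _ _].
- exact: (fa_cst AA 0).
- by rewrite mulr0 addr0.
- by rewrite oppr0.
- by rewrite mulr0 mul0r addr0.
Qed.

Lemma half_sum_wedge V (c c' : G -> V -> V) f h x :
  half_sum e eta (fun X Y => wedge (along c X) (along c' Y)) f h x =
  2%:R^-1 * (pairing (fun p => f (c p x)) (fun p => h (c' p x)) -
             pairing (fun p => h (c p x)) (fun p => f (c' p x))).
Proof.
congr (_ * _); rewrite /pairing -sumrB; apply: eq_bigr => j _.
rewrite -sumrB; apply: eq_bigr => k _; rewrite /wedge /along; ring.
Qed.

Lemma half_sum_fusion_term V (c c' : G -> V -> V) f h x :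
  half_sum e eta (fun X Y => wedge (along (fun p => c p^-1%g) X)
    (along (fun p => c' p^-1%g) Y)) f h x = fusion_term e eta c c' f h x.
Proof. exact: half_sum_wedge. Qed.

Lemma point_affine : is_affine_variety (fun _ : unit -> K => True).
Proof.
exists 0%N, (fun _ _ => 0); split.
- by case=> [] [].
- exists (fun=> False) => v; split=> [_ p //|_]; exists tt => -[] //.
- move=> f; split=> // _; exists (f tt)%:MP => -[]; by rewrite mevalC.
Qed.

Lemma point_hamiltonian : hamiltonian (fun _ : unit -> K => True) (fun _ x => x)
  (fun _ _ _ => 0) (fun=> 1%g).
Proof.
have TT := affine_fun_alg point_affine.
split=> //.
- exact: point_affine.
- split=> // f _; exact: (mor_snd GG (@mor_id _ _ (fun _ : unit -> K => True)) (I : _ f)).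
- exact: zero_bracket.
- by move=> g x; rewrite mulg1 mulgV.
- by move=> f u x _ ru; rewrite /orbital !(pairing_cst eta e_lie) addr0 mulr0.
- move=> f g h x _ _ _; rewrite /jacobiator !addr0 /cartan_along /orbital.
  rewrite /cartan /contract2 big1 ?mulr0 // => j _; rewrite big1 // => k _.
  rewrite big1 // => l _; rewrite big1 // => m _.
  by rewrite (lie_cst (e_lie k)) mulr0 mul0r mulr0.
Qed.

Definition ltrans (g q : G) : G := (g * q)%g.
Definition rtrans (g q : G) : G := (q * g^-1)%g.

Lemma ltrans_action : regular_action reg ltrans.
Proof.
split=> [x|g h x|]; rewrite /ltrans ?mul1g ?mulgA //.
exact: (mor_mul GG2 mor2l mor2r).
Qed.

Lemma rtrans_action : regular_action reg rtrans.
Proof.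
split=> [x|g h x|]; rewrite /rtrans ?invg1 ?mulg1 ?invgM ?mulgA //.
exact: (mor_mul GG2 mor2r (mor_inv mor2l)).
Qed.

Lemma trans_comm : commuting ltrans rtrans.
Proof. by move=> p q x; rewrite /ltrans /rtrans mulgA. Qed.

(** Left translation by p^-1 at q is right translation by a conjugate of p; the
    inversion changes the sign of the 3-tensor and the conjugation preserves it. *)
Lemma cartan_edge f g h q : reg f -> reg g -> reg h ->
  cartan_along ltrans f g h q + cartan_along rtrans f g h q = 0.
Proof.
move=> rf rg rh.
have El u : orbital ltrans u q = (fun p => u (p^-1 * q)%g) by [].
have Er u : orbital rtrans u q = (fun p => u (q * p)%g).
  by apply: functional_extensionality => p; rewrite /orbital /rtrans invgK.
have Ec u : (fun p => u (p * q)%g) = (fun p => u (q * (q^-1 * p * q^-1^-1))%g).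
  by apply: functional_extensionality => p; rewrite invgK !mulgA mulgV mul1g.
rewrite /cartan_along !El !Er.
rewrite (cartan_inv eta e_lie (u := fun p => f (p * q)%g) (v := fun p => g (p * q)%g)
  (w := fun p => h (p * q)%g)); try exact: reg_mulr.
rewrite !Ec (cartan_conj e_lie eta_inv q^-1%g (u := fun p => f (q * p)%g)
  (v := fun p => g (q * p)%g) (w := fun p => h (q * p)%g)); try exact: reg_mull.
by rewrite addNr.
Qed.

(** The bracket of P_G.  Its moment condition amounts to the equality of the
    contractions of eta with two left and with two right derivatives at a point. *)
Lemma group_hamiltonian : hamiltonian reg (diagonal ltrans rtrans)
  (fused ltrans rtrans (fun _ _ _ => 0)) id.
Proof.
have [Rl Rr] := (ltrans_action, rtrans_action).
have Rd := diagonal_action GG Rl Rr trans_comm.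
have B0 := zero_bracket GG.
split=> //.
- exact: ag_affine.
- exact: fused_bracket.
- move=> g; apply: (fused_invariant eta_inv GG Rl Rr (g := g)) => //.
  + exact: (act_map GG Rd).
  + by move=> p x; rewrite /diagonal -trans_comm (conj_act Rl).
  + by move=> p x; rewrite /diagonal (conj_act Rr) trans_comm.
- by move=> g x; rewrite /diagonal /ltrans /rtrans mulgA.
- move=> f u x rf ru.
  rewrite !(pairing_diagonal eta e_lie Rl Rr) // /fused /fusion_term sub0r.
  have Er k : orbital rtrans k x = (fun p => k (x * p)%g).
    by apply: functional_extensionality => p; rewrite /orbital /rtrans invgK.
  rewrite !Er (pairing_invl eta e_lie (u := fun p => u (p * x)%g)); last exact: reg_mulr.
  have -> : pairing (orbital ltrans f x) (fun p => u (p * x)%g) =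
      - pairing (fun p => f (x * p)%g) (fun p => u (x * p)%g).
    have Ec k : (fun p => k (p * x)%g) = (fun p => k (x * (x^-1 * p * x^-1^-1))%g) :> (G -> K).
      by apply: functional_extensionality => p; rewrite invgK !mulgA mulgV mul1g.
    rewrite (pairing_invl eta e_lie (u := fun p => f (p * x)%g)); last exact: reg_mulr.
    rewrite !Ec (pairing_conj eta_inv x^-1%g (u := fun p => f (x * p)%g)
      (v := fun p => u (x * p)%g)) //; exact: reg_mull.
  rewrite (pairingC e eta_sym (fun p => u (p * x)%g)); ring.
- move=> f g h x rf rg rh.
  rewrite (fused_jacobi e_lie eta_sym eta_inv GG Rl Rr trans_comm B0 _ _ half_neq0
    (R := fun _ _ _ _ => 0)) ?addr0 // => f' g' h' x' rf' rg' rh'.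
  have := cartan_edge x' rf' rg' rh'; rewrite /cartan_along /jacobiator => ->.
  by rewrite !addr0 mulr0.
Qed.

Lemma biv_groupE f h x : reg f -> reg h ->
  biv_group e eta f h x = fused ltrans rtrans (fun _ _ _ => 0) f h x.
Proof.
move=> rf rh; rewrite /biv_group half_sum_wedge /fused /fusion_term sub0r.
have Er k : orbital rtrans k x = (fun p => k (x * p)%g).
  by apply: functional_extensionality => p; rewrite /orbital /rtrans invgK.
rewrite !Er (pairing_invl eta e_lie (u := fun p => f (p * x)%g)); last exact: reg_mulr.
rewrite (pairing_invl eta e_lie (u := fun p => h (p * x)%g)); last exact: reg_mulr.
ring.
Qed.

(** Every clause of [hamiltonian] passes to a stable subvariety to which the
    bracket is tangent. *)
Lemma restrict_hamiltonian V W (A : (V -> K) -> Prop) (B : (W -> K) -> Prop)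
    (a : G -> V -> V) (b : G -> W -> W) br br' Phi Psi (i : V -> W) :
  injective i -> (forall f, A f <-> exists2 F, B F & f = fun x => F (i x)) ->
  (forall g x, i (a g x) = b g (i x)) -> (forall x, Phi x = Psi (i x)) ->
  (forall F H, B F -> B H ->
     br (fun x => F (i x)) (fun x => H (i x)) = fun x => br' F H (i x)) ->
  is_affine_variety A -> hamiltonian B b br' Psi -> hamiltonian A a br Phi.
Proof.
move=> i_inj AE ai Pi brE aA H; have BB := affine_fun_alg (ham_affine H).
have AA := affine_fun_alg aA; have B' := ham_bracket H.
have [Rb Bi] : regular_action B b /\ forall F, B F -> A (fun x => F (i x)).
  by split; [exact: ham_action H | move=> F BF; apply/AE; exists F].
have oE F x : orbital a (fun y => F (i y)) x = orbital b F (i x).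
  by apply: functional_extensionality => p; rewrite /orbital ai.
split=> //.
- split=> [x|g h x|f /AE[F BF ->]].
  + by apply: i_inj; rewrite ai (act1 Rb).
  + by apply: i_inj; rewrite !ai (actM Rb).
  + have := prod_reg_mono (fun u (ru : reg u) => ru) Bi (act_reg Rb BF).
    move=> P; apply: fa_ext P _ => q /=; by rewrite ai.
- split=> [f g /AE[F BF ->] /AE[F' BF' ->]|h x /AE[H0 BH ->] c f g /AE[F BF ->] /AE[F' BF' ->]
    |f g x /AE[F BF ->] /AE[F' BF' ->]|f g h x /AE[F BF ->] /AE[F' BF' ->] /AE[H0 BH ->]].
  + by rewrite brE //; apply: Bi; apply: (br_reg B').
  + have BFF : B (fun y => c * F y + F' y) by apply: (faD BB) => //; apply: (faZ BB).
    by rewrite (brE _ _ BFF BH) !brE //; apply: (br_lin B').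
  + by rewrite !brE //; apply: (br_anti B').
  + by rewrite (brE _ _ (faM BB BF BF') BH) !brE //; apply: (br_leib B').
- move=> g f h x /AE[F BF ->] /AE[F' BF' ->].
  have := act_map BB Rb g; move=> Bg.
  have E k : (fun y => k (i (a g y))) = (fun y => k (b g (i y))) :> (V -> K).
    by apply: functional_extensionality => y; rewrite ai.
  rewrite !E (brE (fun y => F (b g y)) (fun y => F' (b g y))) ?brE //; try exact: Bg.
  by rewrite ai; apply: (ham_inv H).
- move=> u ru; apply: fa_ext (Bi _ (ham_mom H ru)) _ => x; by rewrite Pi.
- by move=> g x; rewrite !Pi ai; apply: (ham_equiv H).
- move=> f u x /AE[F BF ->] ru.
  have -> : (fun y => u (Phi y)) = (fun y => u (Psi (i y))).
    by apply: functional_extensionality => y; rewrite Pi.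
  rewrite (brE F (fun y => u (Psi y))) //; last exact: (ham_mom H).
  by rewrite oE Pi; apply: (ham_moment H).
- move=> f g h x /AE[F BF ->] /AE[F' BF' ->] /AE[H0 BH ->].
  rewrite /cartan_along !oE -/(cartan_along b F F' H0 (i x)) -(ham_jacobi H) //.
  by rewrite /jacobiator !brE //; apply: (br_reg B').
Qed.

Section ConjugacyClass.
Variables (C : G -> Prop) (CC : conjugacy_class C).
Hypothesis C_closed : zariski_closed reg C.
Let S := class_space e eta CC.

Lemma class_regE f : gs_reg (g := S) f <->
  exists2 F, reg F & f = fun x : {x | C x} => F (sval x).
Proof.
split=> [[F [rF EF]]|[F rF ->]]; last by exists F.
by exists F => //; apply: functional_extensionality => x; rewrite EF.
Qed.

Lemma sval_inj : injective (sval : {x | C x} -> G).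
Proof.
by move=> [x Cx] [y Cy] /= xy; subst y; congr exist; apply: proof_irrelevance.
Qed.

Lemma class_affine : is_affine_variety (@gs_reg K G S).
Proof.
have [m [phi [phi_inj [I zI] regE]]] := ag_affine G; have [J [Jreg zJ]] := C_closed.
exists m, (fun x => phi (sval x)); split.
- by move=> x y /phi_inj; apply: sval_inj.
- exists (fun p => I p \/ exists2 F, J F & forall x, F x = p.@[phi x]) => v; split.
    case=> [[x Cx] /= xv] p [Ip|[F JF EF]]; first by apply: (proj1 (zI v)) Ip; exists x.
    by rewrite -(meval_eq _ xv) -EF; apply: (proj1 (zJ x)) JF.
  move=> v0; have [|x xv] := proj2 (zI v); first by move=> p Ip; apply: v0; left.
  have Cx : C x.
    apply/zJ => F JF; have [p Ep] := proj1 (regE F) (Jreg F JF).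
    by rewrite Ep (meval_eq _ xv); apply: v0; right; exists F.
  by exists (exist C x Cx).
- move=> f; rewrite class_regE; split=> [[F /regE[p Ep] ->]|[p Ep]].
    by exists p => x.
  exists (fun x => p.@[phi x]); first by apply/regE; exists p.
  by apply: functional_extensionality => x; rewrite Ep.
Qed.

(** Tangency of P_G to the classes.  By the moment condition for the identity map
    of G the bracket at x sees its first argument only along the conjugation
    orbit of x. *)
Lemma group_bracket_local F F' H (x : {x | C x}) : reg F -> reg F' -> reg H ->
  (forall y, C y -> F y = F' y) ->
  fused ltrans rtrans (fun _ _ _ => 0) F H (sval x) =
  fused ltrans rtrans (fun _ _ _ => 0) F' H (sval x).
Proof.
move=> rF rF' rH FF'; have M := ham_moment group_hamiltonian.
rewrite (M F H _ rF rH) (M F' H _ rF' rH).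
have -> // : orbital (diagonal ltrans rtrans) F (sval x) =
             orbital (diagonal ltrans rtrans) F' (sval x).
apply: functional_extensionality => p; apply: FF'.
rewrite /diagonal /ltrans /rtrans mulgA; exact: conj_class_closed (svalP x).
Qed.

(** By tangency, the extensions chosen to define the bivector of a class do not
    matter. *)
Lemma class_bracketE F H : reg F -> reg H ->
  gs_biv (g := S) (fun x : {x | C x} => F (sval x)) (fun x => H (sval x)) =
  fun x => fused ltrans rtrans (fun _ _ _ => 0) F H (sval x).
Proof.
move=> rF rH; apply: functional_extensionality => x; rewrite /= /biv_class.
have ext k : reg k -> restricts_to (fun x : {x | C x} => k (sval x))
    (extend (fun x : {x | C x} => k (sval x))).
  by move=> rk; apply: epsilon_spec; exists k.
have [rF' EF] := ext F rF; have [rH' EH] := ext H rH.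
set F' := extend _ in rF' EF *; set H' := extend _ in rH' EH *.
rewrite biv_groupE //.
have on k k' : (forall x : {x | C x}, k (sval x) = k' (sval x)) ->
    forall y, C y -> k y = k' y :> K.
  by move=> E y Cy; apply: (E (exist C y Cy)).
have B := ham_bracket group_hamiltonian.
rewrite (group_bracket_local x rF' rF rH' (on _ _ EF)).
rewrite (br_anti B _ rF rH') (group_bracket_local x rH' rH rF (on _ _ EH)).
by rewrite -(br_anti B _ rF rH).
Qed.

Lemma class_hamiltonian : hamiltonian (@gs_reg K G S) (@gs_act K G S)
  (@gs_biv K G S) (@gs_mom K G S).
Proof.
apply: (restrict_hamiltonian sval_inj class_regE _ _ class_bracketE class_affine
  group_hamiltonian) => //.
by move=> g x; rewrite /= /diagonal /ltrans /rtrans mulgA.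
Qed.

End ConjugacyClass.

(** The double is made of two copies of G, with four commuting actions: x1, y1
    translate the first copy on the left and on the right, x2, y2 the second one.
    Fusing x1 with y2, and then y1 with x2, glues the two edges into a circle. *)
Section Double.
Local Notation A := (prod_reg reg reg).

Let x1 (g : G) (q : G * G) : G * G := (ltrans g q.1, q.2).
Let y1 (g : G) (q : G * G) : G * G := (rtrans g q.1, q.2).
Let x2 (g : G) (q : G * G) : G * G := (q.1, ltrans g q.2).
Let y2 (g : G) (q : G * G) : G * G := (q.1, rtrans g q.2).

Let Rx1 : regular_action A x1 := action_fst GG GG ltrans_action.
Let Ry1 : regular_action A y1 := action_fst GG GG rtrans_action.
Let Rx2 : regular_action A x2 := action_snd GG GG ltrans_action.
Let Ry2 : regular_action A y2 := action_snd GG GG rtrans_action.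

Let x1y1 : commuting x1 y1. Proof. by move=> p q z; rewrite /x1 /y1 trans_comm. Qed.
Let x2y2 : commuting x2 y2. Proof. by move=> p q z; rewrite /x2 /y2 trans_comm. Qed.

Let br1 := fused x1 y2 (fun _ _ _ => 0).
Definition double_bracket := fused y1 x2 br1.

Let B0 := zero_bracket GG2.
Let B1 : bracket A br1 := fused_bracket eta e_lie GG2 Rx1 Ry2 B0.

Let a := diagonal x1 y2.
Let b := diagonal y1 x2.

Let x1y2 : commuting x1 y2. Proof. by []. Qed.
Let y1x2 : commuting y1 x2. Proof. by []. Qed.
Let Ra : regular_action A a := diagonal_action GG2 Rx1 Ry2 x1y2.
Let Rb : regular_action A b := diagonal_action GG2 Ry1 Rx2 y1x2.

Let comm_conj (c c' : G -> G * G -> G * G) : commuting c c' ->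
  forall g p z, c g (c' p z) = c' (1 * p * 1^-1)%g (c g z).
Proof. by move=> cc g p z; rewrite mul1g invg1 mulg1. Qed.

Let br1_y1 g : invariant_under A br1 (y1 g).
Proof.
apply: (fused_invariant eta_inv GG2 Rx1 Ry2 (g := 1%g)) => //.
- exact: (act_map GG2 Ry1 g).
- by apply: comm_conj => p q z; rewrite x1y1.
- by apply: comm_conj.
Qed.

Let br1_x2 g : invariant_under A br1 (x2 g).
Proof.
apply: (fused_invariant eta_inv GG2 Rx1 Ry2 (g := 1%g)) => //.
- exact: (act_map GG2 Rx2 g).
- by apply: comm_conj.
- by apply: comm_conj => p q z; rewrite x2y2.
Qed.

Let br1_a g : invariant_under A br1 (a g).
Proof.
apply: (fused_invariant eta_inv GG2 Rx1 Ry2 (g := g)) => //.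
- exact: (act_map GG2 Ra g).
- by move=> p z; rewrite /a /diagonal -x1y2 (conj_act Rx1).
- by move=> p z; rewrite /a /diagonal (conj_act Ry2).
Qed.

Let orb_y1 k q : orbital y1 k q = fun p => k (q.1 * p, q.2)%g.
Proof. by apply: functional_extensionality => p; rewrite /orbital /y1 /rtrans invgK. Qed.

Let orb_y2 k q : orbital y2 k q = fun p => k (q.1, q.2 * p)%g.
Proof. by apply: functional_extensionality => p; rewrite /orbital /y2 /rtrans invgK. Qed.

Let reg1 k y : A k -> reg (fun v => k (v, y)) := prod_reg_slicel GG GG y.
Let reg2 k x : A k -> reg (fun v => k (x, v)) := prod_reg_slicer GG GG x.

Let regR1 k q : A k -> reg (fun p => k (p * q.1, q.2)%g).
Proof. by move/(reg1 q.2)/(reg_mulr q.1). Qed.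

Let regR2 k q : A k -> reg (fun p => k (q.1, p * q.2)%g).
Proof. by move/(reg2 q.1)/(reg_mulr q.2). Qed.

Lemma double_bracketE f h q : A f -> A h -> double_bracket f h q = 2%:R^-1 *
  ((pairing (fun p => f (q.1 * p, q.2)%g) (fun p => h (q.1, p * q.2)%g) -
    pairing (fun p => h (q.1 * p, q.2)%g) (fun p => f (q.1, p * q.2)%g)) +
   (pairing (fun p => f (p * q.1, q.2)%g) (fun p => h (q.1, q.2 * p)%g) -
    pairing (fun p => h (p * q.1, q.2)%g) (fun p => f (q.1, q.2 * p)%g))).
Proof.
move=> Af Ah; rewrite /double_bracket /fused /br1 /fused /fusion_term.
rewrite !orb_y1 !orb_y2.
rewrite (pairing_invl eta e_lie _ (regR1 q Af)) (pairing_invl eta e_lie _ (regR1 q Ah)).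
rewrite (pairing_invr e_lie eta_sym _ (regR2 q Af)) (pairing_invr e_lie eta_sym _ (regR2 q Ah)).
ring.
Qed.

(** The Jacobi expression of the zero bracket is the sum of the four 3-tensors,
    which is zero edge by edge; the two fusions then turn the four into the two of
    the fused actions.  For the moment conditions, conjugation by the value of one
    edge exchanges its left and right derivatives. *)
Lemma double_hamiltonian2 : hamiltonian2 A a b double_bracket
  (fun q => (q.1 * q.2)%g) (fun q => (q.1^-1 * q.2^-1)%g).
Proof.
have conj1 (f : G * G -> K) q : (fun p => f (q.1 * p, q.2)%g) =
    (fun p => f (q.1 * p * q.1^-1 * q.1, q.2)%g).
  by apply: functional_extensionality => p; rewrite mulgVK.
have conj2 (f : G * G -> K) q : (fun p => f (q.1, q.2 * p)%g) =
    (fun p => f (q.1, q.2 * p * q.2^-1 * q.2)%g).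
  by apply: functional_extensionality => p; rewrite mulgVK.
have mPhi : regular_map A reg (fun q => (q.1 * q.2)%g) := mor_mul GG2 mor2l mor2r.
have mPsi : regular_map A reg (fun q => (q.1^-1 * q.2^-1)%g).
  exact: (mor_mul GG2 (mor_inv mor2l) (mor_inv mor2r)).
split=> //.
- exact: prod_affine (ag_affine G) (ag_affine G).
- by move=> p q [u v]; rewrite /a /b /diagonal /x1 /x2 /y1 /y2 /= !trans_comm.
- exact: (fused_bracket eta e_lie GG2 Ry1 Rx2 B1).
- move=> g; apply: (fused_invariant eta_inv GG2 Ry1 Rx2 (g := 1%g)) => //.
  + exact: (act_map GG2 Ra g).
  + by apply: comm_conj => p q [u v]; rewrite /a /diagonal /x1 /y1 /y2 /= trans_comm.
  + by apply: comm_conj => p q [u v]; rewrite /a /diagonal /x1 /x2 /y2 /= trans_comm.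
- move=> g; apply: (fused_invariant eta_inv GG2 Ry1 Rx2 (g := g)) => //.
  + exact: (act_map GG2 Rb g).
  + by move=> p z; rewrite /b /diagonal -y1x2 (conj_act Ry1).
  + by move=> p z; rewrite /b /diagonal (conj_act Rx2).
  + exact: (invariant_under_comp (act_map GG2 Ry1 g) (br1_y1 g) (br1_x2 g)).
- by move=> g q; rewrite /a /diagonal /x1 /y2 /ltrans /rtrans /= !mulgA.
- by move=> g q; rewrite /b /diagonal /x2 /y1 /ltrans /rtrans /= mulgA mulgVK.
- by move=> g q; rewrite /a /diagonal /x1 /y2 /ltrans /rtrans /= !invgM invgK mulgA mulgVK.
- by move=> g q; rewrite /b /diagonal /x2 /y1 /ltrans /rtrans /= !invgM invgK !mulgA.
- move=> f u q Af ru; rewrite double_bracketE //=; last exact: mPhi.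
  rewrite !(pairing_diagonal eta e_lie Rx1 Ry2) // orb_y2.
  rewrite !(pairing_invl eta e_lie _ (regR1 q Af)).
  pose l := (fun p => u (q.1 * q.2 * p)%g); pose r := (fun p => u (p * (q.1 * q.2))%g).
  pose m := (fun p => u (q.1 * p * q.2)%g).
  have rr : reg r by apply: reg_mulr.
  have rm : reg m by apply: reg_mull (reg_mulr _ ru).
  have E1 : pairing (fun p => f (q.1 * p, q.2)%g) m =
            pairing (fun p => f (p * q.1, q.2)%g) r.
    rewrite conj1 -(pairing_conj eta_inv q.1 (regR1 q Af) rr); congr pairing.
    by apply: functional_extensionality => p; rewrite /m /r !mulgA mulgVK.
  have E2 : pairing (fun p => f (q.1, q.2 * p)%g) l =
            pairing (fun p => f (q.1, p * q.2)%g) m.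
    rewrite conj2 -(pairing_conj eta_inv q.2 (regR2 q Af) rm); congr pairing.
    by apply: functional_extensionality => p; rewrite /m /l !mulgA mulgVK.
  have -> : (fun p => u (q.1 * (p * q.2))%g) = m.
    by apply: functional_extensionality => p; rewrite mulgA.
  have -> : (fun p => u (q.1 * (q.2 * p))%g) = l.
    by apply: functional_extensionality => p; rewrite mulgA.
  have -> : (fun p => u (p * q.1 * q.2)%g) = r.
    by apply: functional_extensionality => p; rewrite -mulgA.
  rewrite (pairingC e eta_sym m) (pairingC e eta_sym r) E1 -E2 -/l -/r; ring.
- move=> f u q Af ru; rewrite double_bracketE //=; last exact: mPsi.
  rewrite !(pairing_diagonal eta e_lie Ry1 Rx2) // orb_y1.
  rewrite !(pairing_invl eta e_lie _ (regR2 q Af)).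
  pose l := (fun p => u (q.1^-1 * q.2^-1 * p)%g).
  pose r := (fun p => u (p * (q.1^-1 * q.2^-1))%g).
  pose m := (fun p => u (q.1^-1 * p * q.2^-1)%g).
  have rl : reg l by apply: reg_mull.
  have rr : reg r by apply: reg_mulr.
  have rm : reg m by apply: reg_mull (reg_mulr _ ru).
  have E1 : pairing (fun p => f (q.1 * p, q.2)%g) r =
            pairing (fun p => f (p * q.1, q.2)%g) m.
    rewrite conj1 -(pairing_conj eta_inv q.1 (regR1 q Af) rm); congr pairing.
    by apply: functional_extensionality => p; rewrite /m /r !mulgA mulVg mul1g.
  have E2 : pairing (fun p => f (q.1, q.2 * p)%g) m =
            pairing (fun p => f (q.1, p * q.2)%g) l.
    rewrite conj2 -(pairing_conj eta_inv q.2 (regR2 q Af) rl); congr pairing.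
    by apply: functional_extensionality => p; rewrite /m /l !mulgA mulgVK.
  have -> : (fun p => u (q.1^-1 * (p * q.2)^-1)%g) = (fun p => l p^-1%g).
    by apply: functional_extensionality => p; rewrite invgM mulgA.
  have -> : (fun p => u ((q.1 * p)^-1 * q.2^-1)%g) = (fun p => r p^-1%g).
    by apply: functional_extensionality => p; rewrite invgM -mulgA.
  have -> : (fun p => u (q.1^-1 * (q.2 * p)^-1)%g) = (fun p => m p^-1%g).
    by apply: functional_extensionality => p; rewrite invgM mulgA.
  have -> : (fun p => u ((p * q.1)^-1 * q.2^-1)%g) = (fun p => m p^-1%g).
    by apply: functional_extensionality => p; rewrite invgM.
  rewrite !(pairing_invr e_lie eta_sym) // !(pairing_invl eta e_lie) //.
  rewrite (pairingC e eta_sym m) (pairingC e eta_sym r) -E1 E2 -/l -/r; ring.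
- move=> f g h q Af Ag Ah.
  have edge1 k k' k'' z : A k -> A k' -> A k'' ->
      cartan_along x1 k k' k'' z + cartan_along y1 k k' k'' z = 0.
    by move=> Ak Ak' Ak''; exact: (cartan_edge z.1 (reg1 z.2 Ak) (reg1 z.2 Ak') (reg1 z.2 Ak'')).
  have edge2 k k' k'' z : A k -> A k' -> A k'' ->
      cartan_along x2 k k' k'' z + cartan_along y2 k k' k'' z = 0.
    by move=> Ak Ak' Ak''; exact: (cartan_edge z.2 (reg2 z.1 Ak) (reg2 z.1 Ak') (reg2 z.1 Ak'')).
  have J1 k k' k'' z : A k -> A k' -> A k'' -> jacobiator br1 k k' k'' z =
      - 4%:R^-1 * (cartan_along a k k' k'' z +
        (cartan_along y1 k k' k'' z + cartan_along x2 k k' k'' z)).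
    move=> Ak Ak' Ak''.
    apply: (fused_jacobi e_lie eta_sym eta_inv GG2 Rx1 Ry2 x1y2 B0 _ _ half_neq0
      (R := fun k k' k'' z => cartan_along y1 k k' k'' z + cartan_along x2 k k' k'' z)) => //.
    move=> f' g' h' z' Af' Ag' Ah'; rewrite /jacobiator !addr0.
    have := edge1 _ _ _ z' Af' Ag' Ah'; have := edge2 _ _ _ z' Af' Ag' Ah'.
    rewrite /cartan_along => /eqP; rewrite addr_eq0 => /eqP ->.
    by move/eqP; rewrite addr_eq0 => /eqP ->; ring.
  rewrite addrC; apply: (fused_jacobi e_lie eta_sym eta_inv GG2 Ry1 Rx2 y1x2 B1 br1_y1 br1_x2
    half_neq0 (R := cartan_along a)) => //.
  by move=> f' g' h' z' Af' Ag' Ah'; rewrite J1 // addrC.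
Qed.

End Double.
End BaseSpaces.

(** * Surfaces with boundary *)

Section Surfaces.
Variables (K : closedFieldType) (G : alg_group K).
Variables (d : nat) (e : 'I_d -> (G -> K) -> K) (eta : 'M[K]_d).
Hypotheses (e_lie : forall j, lie_element (e j)) (eta_sym : eta^T = eta).
Hypothesis eta_inv : Ad_invariant e eta.
Hypothesis half_neq0 : (2%:R : K) != 0.
Local Notation reg := (@ag_reg K G).

Lemma bivector_ext V (P P' : bivector K V) :
  (forall f h x, P f h x = P' f h x) -> P = P'.
Proof.
move=> E; exact: (functional_extensionality P P' (fun f =>
  functional_extensionality (P f) (P' f) (fun h =>
  functional_extensionality (P f h) (P' f h) (E f h)))).
Qed.

Definition hamiltonian_space (M : gspace G) : Prop :=
  hamiltonian e eta (@gs_reg K G M) (@gs_act K G M) (@gs_biv K G M) (@gs_mom K G M).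

Lemma fuse_biv (M : ggspace G) a b f h q :
  (forall p x, @gg_act K G M p 1%g x = a p x) ->
  (forall p x, @gg_act K G M 1%g p x = b p x) ->
  @gs_biv K G (fuse e eta M) f h q = fused e eta a b (@gg_biv K G M) f h q.
Proof.
move=> Ea Eb; rewrite /fused -half_sum_fusion_term.
have -> : a = fun p => gg_act p 1%g.
  by do 2 apply: functional_extensionality => ?; rewrite Ea.
have -> // : b = fun p => gg_act 1%g p.
by do 2 apply: functional_extensionality => ?; rewrite Eb.
Qed.

Lemma fusion_hamiltonian M N : hamiltonian_space M -> hamiltonian_space N ->
  hamiltonian_space (fusion e eta M N).
Proof.
move=> HM HN; have [RM RN] := (ham_action HM, ham_action HN).
have H := prod_hamiltonian HM HN.
suff E : @gs_biv K G (fusion e eta M N) = fused e eta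
    (fun g q => (gs_act g q.1, q.2)) (fun g q => (q.1, gs_act g q.2))
    (prod_bracket (@gs_biv K G M) (@gs_biv K G N)).
  by rewrite /hamiltonian_space E; apply: fuse_hamiltonian H.
apply: bivector_ext => f h q; apply: fuse_biv => p [x y] /=.
- by rewrite (act1 RN).
- by rewrite (act1 RM).
Qed.

Lemma half_sumD V (W W' : ((G -> K) -> K) -> ((G -> K) -> K) -> bivector K V) f h x :
  half_sum e eta (fun X Y f h x => W X Y f h x + W' X Y f h x) f h x =
  half_sum e eta W f h x + half_sum e eta W' f h x.
Proof.
rewrite /half_sum -mulrDr -big_split; congr (_ * _); apply: eq_bigr => j _.
by rewrite -big_split; apply: eq_bigr => k _; rewrite /= mulrDr.
Qed.

Lemma fused_double_hamiltonian : hamiltonian_space (fused_double e eta).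
Proof.
have H := double_hamiltonian2 e_lie eta_sym eta_inv half_neq0.
have := fuse_hamiltonian e_lie eta_sym eta_inv half_neq0 H.
set a := diagonal (fun g q => (ltrans g q.1, q.2)) _ in H *.
set b := diagonal (fun g q => (rtrans g q.1, q.2)) _ in H *.
have -> : diagonal a b = @gs_act K G (fused_double e eta).
  apply: functional_extensionality => g; apply: functional_extensionality => q.
  by rewrite /= /a /b /diagonal /ltrans /rtrans /= !mulgA.
apply: hamiltonian_ext => f h Af Ah; apply: functional_extensionality => q.
rewrite (@fuse_biv (Defs.double e eta) a b) => [|p x|p x]; first last.
- by rewrite /a /diagonal /ltrans /rtrans /= invg1 mulg1 mul1g.
- by rewrite /b /diagonal /ltrans /rtrans /= invg1 mulg1 mul1g.
by rewrite /fused double_bracketE //= half_sumD !half_sum_wedge -mulrDr.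
Qed.

Lemma surface_hamiltonian l : hamiltonian_space (surface e eta l).
Proof.
elim: l => [|l IH]; first exact: point_hamiltonian.
exact: fusion_hamiltonian IH fused_double_hamiltonian.
Qed.

Lemma surface_with_classes_hamiltonian l n (C : 'I_n -> G -> Prop)
    (CC : forall i, conjugacy_class (C i)) :
  (forall i, zariski_closed reg (C i)) ->
  hamiltonian_space (surface_with_classes e eta l CC).
Proof.
move=> Ccl; rewrite /surface_with_classes.
elim: (enum 'I_n) (surface e eta l) (surface_hamiltonian l) => [|i s IH] M HM //=.
apply: IH; apply: fusion_hamiltonian => //.
exact: class_hamiltonian.
Qed.

End Surfaces.

(** * Derivations that kill the equations of a closed subset *)

Section Derivation.
Variables (K : closedFieldType) (V : Type) (A : (V -> K) -> Prop).
Hypotheses (charK : [pchar K] =i pred0) (aA : is_affine_variety A).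
Variable D : (V -> K) -> V -> K.
Hypothesis D_reg : forall f, A f -> A (D f).
Hypothesis D_lin : forall x, lin_form A (fun f => D f x).
Hypothesis D_leib : forall f g x, A f -> A g ->
  D (fun y => f y * g y) x = f x * D g x + D f x * g x.
Let AA := affine_fun_alg aA.

Let DM f g : A f -> A g -> D (fun y => f y * g y) = fun y => f y * D g y + D f y * g y.
Proof. by move=> Af Ag; apply: functional_extensionality => x; apply: D_leib. Qed.

Lemma iter_reg n f : A f -> A (iter n D f).
Proof. by move=> Af; elim: n => //= n /D_reg. Qed.

Lemma iterD n f g : A f -> A g ->
  iter n D (fun y => f y + g y) = fun y => iter n D f y + iter n D g y.
Proof.
move=> Af Ag; elim: n => //= n ->; apply: functional_extensionality => x.
by rewrite (lfD (D_lin x)) //; apply: iter_reg.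
Qed.

Lemma iter0 n : iter n D (fun=> 0) = fun=> 0.
Proof.
by elim: n => //= n ->; apply: functional_extensionality => x; rewrite (lf0 AA (D_lin x)).
Qed.

Variable x : V.

Lemma iter_mul_vanish i n m f g : A f -> A g ->
  (forall j, (j < n)%N -> iter j D f x = 0) ->
  (forall j, (j < m)%N -> iter j D g x = 0) ->
  (i < n + m)%N -> iter i D (fun y => f y * g y) x = 0.
Proof.
elim: i n m f g => [|i IH] n m f g Af Ag f0 g0 lti.
  case: n f0 lti => [|n] f0 lti /=; last by rewrite (f0 0%N isT : f x = 0) mul0r.
  by rewrite (g0 0%N lti : g x = 0) mulr0.
have [ADf ADg] := (D_reg Af, D_reg Ag).
rewrite iterSr DM // iterD; [|exact: (faM AA)|exact: (faM AA)].
rewrite (IH n m.-1) // ?(IH n.-1 m) ?addr0 //.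
- by move=> j ltj; rewrite -iterSr f0 // -ltn_predRL.
- by case: n {f0} lti => [|n]; [move/ltnW|].
- by move=> j ltj; rewrite -iterSr g0 // -ltn_predRL.
- by case: m {g0} lti => [|m]; [move/ltnW|rewrite addnS].
Qed.

(** The first nonzero Taylor coefficients along D multiply: the only term of the
    Leibniz formula that survives at x. *)
Lemma iter_mul_lead n m f g : A f -> A g ->
  (forall j, (j < n)%N -> iter j D f x = 0) ->
  (forall j, (j < m)%N -> iter j D g x = 0) ->
  iter (n + m) D (fun y => f y * g y) x =
    'C(n + m, n)%:R * (iter n D f x * iter m D g x).
Proof.
move: {2}(n + m)%N (erefl (n + m)%N) => s; elim: s n m f g => [|s IH] n m f g nm Af Ag f0 g0.
  by move/eqP: nm; rewrite addn_eq0 => /andP[/eqP -> /eqP ->]; rewrite /= bin0 mul1r.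
have [ADf ADg] := (D_reg Af, D_reg Ag).
rewrite nm iterSr DM // iterD; [|exact: (faM AA)|exact: (faM AA)].
have fD0 j : (j < n.-1)%N -> iter j D (D f) x = 0.
  by move=> ltj; rewrite -iterSr f0 // -ltn_predRL.
have gD0 j : (j < m.-1)%N -> iter j D (D g) x = 0.
  by move=> ltj; rewrite -iterSr g0 // -ltn_predRL.
case: n nm f0 fD0 => [|n] nm f0 fD0.
  rewrite add0n in nm; subst m.
  rewrite (iter_mul_vanish (n := 0) (m := s.+1) ADf Ag) // addr0.
  have := IH 0%N s f (D g) (erefl _) Af ADg f0 gD0; rewrite add0n => ->.
  by rewrite !bin0 -iterSr.
case: m nm g0 gD0 => [|m] nm g0 gD0.
  rewrite addn0 in nm; move: nm f0 fD0 => [->] f0 fD0.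
  rewrite (iter_mul_vanish (n := s.+1) (m := 0) Af ADg) ?addn0 // add0r.
  have := IH s 0%N (D f) g (addn0 s) ADf Ag fD0 g0; rewrite addn0 => ->.
  by rewrite !binn -iterSr.
have nm1 : (n.+1 + m)%N = s by move: nm; rewrite addnS => -[].
have nm2 : (n + m.+1)%N = s by move: nm; rewrite addSn => -[].
have := IH n.+1 m f (D g) nm1 Af ADg f0 gD0; rewrite nm1 => ->.
have := IH n m.+1 (D f) g nm2 ADf Ag fD0 g0; rewrite nm2 => ->.
by rewrite -!iterSr binS natrD; ring.
Qed.

Variables (m : nat) (phi : V -> 'I_m -> K).
Hypothesis regE : forall f, A f <-> exists p : {mpoly K[m]}, forall y, f y = p.@[phi y].

(** The kernel of the Taylor expansion at x along the formal flow of D. *)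
Definition flat (p : {mpoly K[m]}) : Prop := forall n, iter n D (fun y => p.@[phi y]) x = 0.

Let Ap (p : {mpoly K[m]}) : A (fun y => p.@[phi y]).
Proof. by apply/regE; exists p. Qed.

Lemma flat_prime : prime_ideal flat.
Proof.
split.
- move=> n; rewrite (_ : (fun y => _) = fun=> 0) ?iter0 //.
  by apply: functional_extensionality => y; rewrite meval0.
- move=> p q p0 q0 n.
  rewrite (_ : (fun y => _) = fun y => p.@[phi y] + q.@[phi y]); last first.
    by apply: functional_extensionality => y; rewrite mevalD.
  by rewrite iterD // p0 q0 addr0.
- move=> p q q0 n.
  rewrite (_ : (fun y => _) = fun y => p.@[phi y] * q.@[phi y]); last first.
    by apply: functional_extensionality => y; rewrite mevalM.
  by apply: (iter_mul_vanish (n := 0) (m := n.+1)).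
- move=> p q pq0; apply: NNPP => /not_or_and[np nq].
  have lead r : ~ flat r -> exists2 n, iter n D (fun y => r.@[phi y]) x != 0 &
      forall j, (j < n)%N -> iter j D (fun y => r.@[phi y]) x = 0.
    move=> nr; have ex : exists n, iter n D (fun y => r.@[phi y]) x != 0.
      by apply: NNPP => no; apply: nr => n; apply/eqP/negPn/negP => rn; apply: no; exists n.
    case: (ex_minnP ex) => n rn minn; exists n => // j; rewrite ltnNge => nj.
    by apply/eqP/negPn/negP => /minn rj; rewrite rj in nj.
  have [[i pi p0] [j qj q0]] := (lead p np, lead q nq).
  have := pq0 (i + j)%N.
  rewrite (_ : (fun y => _) = fun y => p.@[phi y] * q.@[phi y]); last first.
    by apply: functional_extensionality => y; rewrite mevalM.
  rewrite iter_mul_lead // => /eqP; rewrite !mulf_eq0 (negPf pi) (negPf qj) !orbF.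
  by rewrite (proj1 (pcharf0P K) charK) -leqn0 leqNgt bin_gt0 leq_addr.
Qed.

End Derivation.

(** The points of the variety are the zeros of an arbitrary set of polynomials and
    T is an arbitrary set of constants of D; [flat] contains all the corresponding
    equations. *)
Lemma derivation_vanishes (K : closedFieldType) (V : Type) (A : (V -> K) -> Prop)
    (D : (V -> K) -> V -> K) (T : (V -> K) -> Prop) f :
  [pchar K] =i pred0 -> is_affine_variety A ->
  (forall g, A g -> A (D g)) -> (forall x, lin_form A (fun g => D g x)) ->
  (forall g h x, A g -> A h -> D (fun y => g y * h y) x = g x * D h x + D g x * h x) ->
  (forall b, T b -> A b /\ forall x, D b x = 0) ->
  A f -> (forall x, (forall b, T b -> b x = 0) -> f x = 0) ->
  forall x, (forall b, T b -> b x = 0) -> D f x = 0.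
Proof.
move=> charK aA Dreg Dlin Dleib TD Af f0 x Tx.
have [m [phi [_ [I zI] regE]]] := aA.
have P := flat_prime charK aA Dreg Dlin Dleib x regE.
have [p Ep] := proj1 (regE f) Af.
apply/eqP/negPn/negP => Df0.
have fE : f = fun y => p.@[phi y] by apply: functional_extensionality => y; rewrite Ep.
have [|v [v0 vp]] := prime_nullstellensatz P (g := p).
  by move/(_ 1%N) => /= E; rewrite fE E eqxx in Df0.
have [|y Ey] := proj2 (zI v).
  move=> q Iq; apply: v0 => n.
  rewrite (_ : (fun y => _) = fun=> 0) ?(iter0 aA Dlin) //.
  apply: functional_extensionality => y.
  by apply: (proj1 (zI (phi y))) Iq; exists y.
apply: vp; rewrite -(meval_eq _ Ey) -Ep; apply: f0 => b Tb.
have [Ab Db] := TD b Tb; have [q Eq] := proj1 (regE b) Ab.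
rewrite Eq (meval_eq _ Ey); apply: v0 => n.
have <- : b = fun y => q.@[phi y] by apply: functional_extensionality => z; rewrite Eq.
case: n => [|n]; first exact: Tx.
rewrite iterSr (_ : D b = fun=> 0) ?(iter0 aA Dlin) //.
exact: functional_extensionality.
Qed.

(** * Reduction *)

Section Reduction.
Variables (K : closedFieldType) (G : alg_group K).
Variables (d : nat) (e : 'I_d -> (G -> K) -> K) (eta : 'M[K]_d).
Hypotheses (charK : [pchar K] =i pred0) (e_lie : forall j, lie_element (e j)).
Variables (M : gspace G) (z : G).
Hypothesis HM : hamiltonian_space e eta M.
Local Notation reg := (@ag_reg K G).
Local Notation A := (@gs_reg K G M).
Local Notation br := (@gs_biv K G M).
Local Notation inv := (@invariant_regular K G M).
Let aA := ham_affine HM.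
Let AA := affine_fun_alg aA.
Let B := ham_bracket HM.

Lemma orbital_invariant f x : inv f -> orbital (@gs_act K G M) f x = fun=> f x.
Proof. by case=> _ fi; apply: functional_extensionality => p; apply: fi. Qed.

Lemma invariant_casimir f u x : inv f -> reg u -> br f (fun y => u (gs_mom y)) x = 0.
Proof.
move=> If ru; rewrite (ham_moment HM) ?(orbital_invariant x If) //; last by case: If.
by rewrite !(pairing_cst eta e_lie) addr0 mulr0.
Qed.

Lemma invariant_jacobi f g h x : inv f -> inv g -> inv h ->
  jacobiator br f g h x = 0.
Proof.
move=> If Ig Ih; have [[Af _] [Ag _] [Ah _]] := And3 If Ig Ih.
rewrite (ham_jacobi HM) // /cartan_along !orbital_invariant //.
rewrite /cartan /contract2 big1 ?mulr0 // => j _; rewrite big1 // => k _.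
rewrite big1 // => l _; rewrite big1 // => m _.
by rewrite (lie_cst (e_lie k)) mulr0 mul0r mulr0.
Qed.

Lemma invariant_fun_alg : fun_alg inv.
Proof.
split=> [c|f g [Af fi] [Ag gi]|f g [Af fi] [Ag gi]].
- by split=> //; apply: (fa_cst AA).
- by split=> [|p x]; [apply: (faD AA) | rewrite fi gi].
- by split=> [|p x]; [apply: (faM AA) | rewrite fi gi].
Qed.

Lemma invariant_bracket f g : inv f -> inv g -> inv (br f g).
Proof.
move=> [Af fi] [Ag gi]; split=> [|p x]; first exact: (br_reg B).
rewrite -(ham_inv HM p x Af Ag).
have E k : (forall p x, k (gs_act p x) = k x) -> (fun y => k (gs_act p y)) = k.
  by move=> ki; apply: functional_extensionality => y; apply: ki.
by rewrite !E.
Qed.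

Lemma invariant_poisson : is_poisson_algebra inv br.
Proof.
split=> [f g|c f g h [Af _] [Ag _] [Ah _] x|f g [Af _] [Ag _] x
  |f g h [Af _] [Ag _] [Ah _] x|f g h If Ig Ih x].
- exact: invariant_bracket.
- exact: (br_lin B).
- exact: (br_anti B).
- exact: (br_leib B).
- exact: invariant_jacobi.
Qed.

(** The fibre is cut out by the functions u o Phi - u(z), which Poisson commute
    with h. *)
Lemma fibre_poisson_ideal f h (q : fibre M z) : inv h -> A f ->
  (forall q' : fibre M z, f (sval q') = 0) -> br h f (sval q) = 0.
Proof.
move=> Ih Af f0; have [Ah _] := Ih.
pose T (b : gs_car M -> K) := exists2 u, reg u & b = fun y => u (gs_mom y) - u z.
have momE (y : gs_car M) : (forall b, T b -> b y = 0) <-> gs_mom y = z.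
  split=> [Ty|yz b [u _ ->]]; last by rewrite yz subrr.
  have [m [phi [phi_inj _ regE]]] := ag_affine G.
  apply: phi_inj => i; apply/eqP; rewrite -subr_eq0; apply/eqP.
  apply: (Ty (fun y => phi (gs_mom y) i - phi z i)).
  exists (fun g => phi g i) => //; apply/regE; exists 'X_i => g; by rewrite mevalXU.
apply: (derivation_vanishes (D := br h) (T := T) charK aA) => //.
- by move=> g Ag; apply: (br_reg B).
- by move=> x; exact: (br_linr AA B x Ah).
- by move=> g g' x Ag Ag'; apply: (br_leibr AA B).
- move=> b [u ru ->]; have Au := ham_mom HM ru.
  split=> [|x]; first by apply: (faB AA) => //; apply: (fa_cst AA).
  rewrite (lfB AA (br_linr AA B x Ah)) //; last exact: (fa_cst AA).
  by rewrite (invariant_casimir x Ih ru) (br_cstr AA B) // subrr.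
- by move=> x /momE xz; apply: (f0 (exist _ x xz)).
- by apply/momE; apply: (svalP q).
Qed.

Lemma bracket_on_fibre f f' h h' (q : fibre M z) : inv f -> inv f' -> inv h -> inv h' ->
  (forall q' : fibre M z, f (sval q') = f' (sval q')) ->
  (forall q' : fibre M z, h (sval q') = h' (sval q')) ->
  br f h (sval q) = br f' h' (sval q).
Proof.
move=> If If' Ih Ih' ff' hh'.
have [[Af _] [Af' _] [Ah _] [Ah' _]] := And4 If If' Ih Ih'.
transitivity (br f h' (sval q)).
  apply/eqP; rewrite -subr_eq0 -(lfB AA (br_linr AA B _ Af)) //; apply/eqP.
  by apply: fibre_poisson_ideal => //; [apply: (faB AA) | move=> q'; rewrite hh' subrr].
apply/eqP; rewrite -subr_eq0 -(lfB AA (br_lin B _ Ah')) //; apply/eqP.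
have Aff : A (fun x => f x - f' x) by apply: (faB AA).
rewrite (br_anti B) // fibre_poisson_ideal ?oppr0 // => q'; by rewrite ff' subrr.
Qed.

(** The bracket of two functions on the quotient is the one that lifts to the
    bracket of any invariant lifts; its axioms are checked on lifts. *)
Lemma quotient_bracket Y (O : (Y -> K) -> Prop) (p : fibre M z -> Y) :
  fun_alg O -> realizes_quotient O p -> bracket_descends O p.
Proof.
move=> OO [pull lift inj].
pose lifts (u : Y -> K) f := inv f /\ forall q, u (p q) = f (sval q).
have lifted u : O u -> exists f, lifts u f.
  by move=> /pull[f [If Ef]]; exists f.
pose spec u v w := O w /\ forall f h, lifts u f -> lifts v h ->
  forall q, w (p q) = br f h (sval q).
pose brY u v : Y -> K := epsilon (inhabits (fun=> 0)) (spec u v).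
have brYP u v : O u -> O v -> spec u v (brY u v).
  move=> Ou Ov; apply: epsilon_spec.
  have [[f [If uf]] [h [Ih vh]]] := (lifted u Ou, lifted v Ov).
  have [|w Ow wE] := lift (fun q => br f h (sval q)).
    by exists (br f h); split=> //; apply: invariant_bracket.
  exists w; split=> // f' h' [If' uf'] [Ih' vh'] q; rewrite -wE.
  by apply: bracket_on_fibre => // q'; rewrite -?uf -?vh.
have lifts_br u v f h : O u -> O v -> lifts u f -> lifts v h -> lifts (brY u v) (br f h).
  move=> Ou Ov uf vh; have [_ E] := brYP u v Ou Ov.
  by split=> [|q]; [apply: invariant_bracket; [case: uf | case: vh] | apply: E].
have OB u v : O u -> O v -> O (brY u v) by move=> Ou Ov; case: (brYP u v Ou Ov).
exists brY; split; last first.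
  by move=> u v f h Ou Ov If Ih uf vh q; have [_] := brYP u v Ou Ov; apply.
have Pinv := invariant_poisson; have II := invariant_fun_alg.
split=> // [c u v w Ou Ov Ow|u v Ou Ov|u v w Ou Ov Ow|u v w Ou Ov Ow];
  have [f uf] := lifted u Ou; have [g vg] := lifted v Ov;
  try have [h wh] := lifted w Ow.
- have [If Ef] := uf; have [Ig Eg] := vg; have [Ih Eh] := wh.
  have Ouv : O (fun y => c * u y + v y) by apply: (faD OO) => //; apply: (faZ OO).
  apply: inj => [||q]; [exact: OB | apply: (faD OO); [apply: (faZ OO)|]; exact: OB |].
  have [_ ->] := lifts_br _ _ _ _ Ou Ow uf wh; have [_ ->] := lifts_br _ _ _ _ Ov Ow vg wh.
  have luv : lifts (fun y => c * u y + v y) (fun x => c * f x + g x).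
    by split=> [|q']; [apply: (faD II) => //; apply: (faZ II) | rewrite Ef Eg].
  have [_ ->] := lifts_br _ _ _ _ Ouv Ow luv wh.
  by case: Pinv => _ L _ _ _; apply: L.
- apply: inj => [||q]; [exact: OB | apply: (faN OO); exact: OB |].
  have [_ ->] := lifts_br _ _ _ _ Ou Ov uf vg; have [_ ->] := lifts_br _ _ _ _ Ov Ou vg uf.
  by case: Pinv => _ _ L _ _; apply: L; [case: uf | case: vg].
- have [If Ef] := uf; have [Ig Eg] := vg; have [Ih Eh] := wh.
  have Ouv : O (fun y => u y * v y) by apply: (faM OO).
  have [Ovw Ouw] := (OB v w Ov Ow, OB u w Ou Ow).
  apply: inj => [||q]; [exact: OB | by apply: (faD OO); apply: (faM OO) |].
  have [_ ->] := lifts_br _ _ _ _ Ou Ow uf wh; have [_ ->] := lifts_br _ _ _ _ Ov Ow vg wh.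
  have luv : lifts (fun y => u y * v y) (fun x => f x * g x).
    by split=> [|q']; [apply: (faM II) | rewrite Ef Eg].
  have [_ ->] := lifts_br _ _ _ _ Ouv Ow luv wh; rewrite Ef Eg.
  by case: Pinv => _ _ _ L _; apply: L.
- have [Ouv Ovw Owu] := And3 (OB u v Ou Ov) (OB v w Ov Ow) (OB w u Ow Ou).
  apply: (inj _ (fun=> 0)) => [||q].
  + by apply: (faD OO); [apply: (faD OO)|]; apply: OB.
  + exact: (fa_cst OO).
  have luv := lifts_br _ _ _ _ Ou Ov uf vg.
  have lvw := lifts_br _ _ _ _ Ov Ow vg wh.
  have lwu := lifts_br _ _ _ _ Ow Ou wh uf.
  have [_ ->] := lifts_br _ _ _ _ Ouv Ow luv wh.
  have [_ ->] := lifts_br _ _ _ _ Ovw Ou lvw uf.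
  have [_ ->] := lifts_br _ _ _ _ Owu Ov lwu vg.
  by apply: invariant_jacobi; [case: uf | case: vg | case: wh].
Qed.

Lemma rep_coord_fun_alg : fun_alg (@rep_coord K G M z).
Proof.
have II := invariant_fun_alg.
split=> [c|u v [f [If Ef]] [g [Ig Eg]]|u v [f [If Ef]] [g [Ig Eg]]].
- by exists (fun=> c); split=> //; apply: (fa_cst II).
- by exists (fun x => f x + g x); split=> [|q]; [apply: (faD II) | rewrite Ef Eg].
- by exists (fun x => f x * g x); split=> [|q]; [apply: (faM II) | rewrite Ef Eg].
Qed.

Lemma hamiltonian_reduction : determines_affine_poisson_structure M z.
Proof.
split; first exact: invariant_poisson.
  apply: (quotient_bracket rep_coord_fun_alg); split=> // w Rw; by exists w.
by move=> Y O p /affine_fun_alg; apply: quotient_bracket.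
Qed.

End Reduction.

Theorem theorem8p6 (K : closedFieldType) (charK : [pchar K] =i pred0)
    (G : alg_group K) (redG : reductive G)
    (d : nat) (e : 'I_d -> (G -> K) -> K) (e_basis : lie_basis e)
    (eta : 'M[K]_d) (eta_sym : eta^T = eta) (eta_inv : Ad_invariant e eta) :
  (forall (l n : nat) (C : 'I_n -> G -> Prop)
      (CC : forall i, conjugacy_class (C i)),
    (l = 0%N -> (3 <= n)%N) -> (n = 0%N -> (1 <= l)%N) ->
    (forall i, zariski_closed (@ag_reg K G) (C i)) ->
    determines_affine_poisson_structure
      (surface_with_classes e eta l CC) 1%g)
  /\
  (forall (l : nat) (z : G), (1 <= l)%N -> central z ->
    (exists q : gs_car (surface e eta l), gs_mom q = z) ->
    determines_affine_poisson_structure (surface e eta l) z).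
Proof.
have e_lie j : lie_element (e j) by case: e_basis.
have half_neq0 : (2%:R : K) != 0 by rewrite (proj1 (pcharf0P K) charK).
split=> [l n C CC _ _ Ccl|l z _ _ _]; apply: (hamiltonian_reduction charK e_lie).
  exact: surface_with_classes_hamiltonian.
exact: surface_hamiltonian.
Qed.
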